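(* Let $S\subset\mathbb{R}^2$ be nonempty, closed, connected, with empty interior, and suppose that there exists $r_S>0$ such that the distance function $d_S$ is of class $\mathcal{C}$ in the set $\{x\in\mathbb{R}^2 : 0<d_S(x)<r_S\}$, where $\mathcal{C}$ is one of the following classes: $C^{k,\alpha}$ for some integer $k\ge 2$ and some $\alpha\in[0,1]$; $C^\infty$; or $C^\omega$. Then $S$ is either a singleton, or a $1$-dimensional manifold without boundary of the same class $\mathcal{C}$ (that is, respectively of class $C^{k,\alpha}$, $C^\infty$, or $C^\omega$).
   Context: For a nonempty closed set $S\subset\mathbb{R}^n$, $d_S(x):=\min_{y\in S}|x-y|$ denotes the Euclidean distance function from $S$. A function is of class $C^{k,\alpha}$ when all its derivatives up to order $k$ satisfy a Hölder condition of exponent $\alpha$, and of class $C^\omega$ when it is analytic. Manifolds are understood as embedded submanifolds of $\mathbb{R}^2$. *)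

(* Defs.v *)
From mathcomp Require Import all_boot all_order all_algebra.
From mathcomp Require Import all_classical all_reals all_analysis.

Set Implicit Arguments.
Unset Strict Implicit.
Unset Printing Implicit Defensive.

Import Order.TTheory GRing.Theory Num.Theory.
Import numFieldNormedType.Exports.

Local Open Scope classical_set_scope.
Local Open Scope ring_scope.

(* The canonical norm of 'rV[R]_n is the sup norm: it induces the usual
   topology of R^n, but the Euclidean norm has to be defined separately. *)
Definition enorm (R : realType) (n : nat) (x : 'rV[R]_n) : R :=
  Num.sqrt (\sum_(i < n) x ord0 i ^+ 2).

(* The infimum is a minimum as soon as S is nonempty and closed. *)
Definition dist (R : realType) (n : nat) (S : set 'rV[R]_n) (x : 'rV[R]_n) : R :=
  inf [set enorm (x - y) | y in S].

Definition partial (R : realType) (n : nat) (i : 'I_n.+1)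
    (f : 'rV[R]_n.+1 -> R) : 'rV[R]_n.+1 -> R :=
  fun x => 'D_(delta_mx ord0 i) f x.

(* partials [:: i1; ...; ik] f = d/dx_i1 (... (d/dx_ik f)) *)
Definition partials (R : realType) (n : nat) (s : seq 'I_n.+1)
    (f : 'rV[R]_n.+1 -> R) : 'rV[R]_n.+1 -> R :=
  foldr (@partial R n) f s.

Definition Ck (R : realType) (n k : nat) (U : set 'rV[R]_n.+1)
    (f : 'rV[R]_n.+1 -> R) : Prop :=
  (forall s (i : 'I_n.+1) x, (size s < k)%N -> U x ->
     derivable (partials s f) x (delta_mx ord0 i)) /\
  (forall s x, (size s <= k)%N -> U x -> {for x, continuous (partials s f)}).

(* Since 0 `^ 0 = 1, for alpha = 0 this only says that f is locally of bounded
   oscillation, which is automatic for continuous f. *)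
Definition loc_hoelder (R : realType) (n : nat) (alpha : R)
    (U : set 'rV[R]_n.+1) (f : 'rV[R]_n.+1 -> R) : Prop :=
  forall p, U p -> exists C : R, \forall x \near p & y \near p,
    `|f x - f y| <= C * enorm (x - y) `^ alpha.

(* Partial sum over the multi-indices m with m_i < N for all i of the power
   series with coefficients a. *)
Definition mpsum (R : realType) (n : nat) (a : {ffun 'I_n -> nat} -> R)
    (h : 'rV[R]_n) (N : nat) : R :=
  \sum_(m : {ffun 'I_n -> 'I_N})
    a [ffun i => m i : nat] * \prod_(i < n) h ord0 i ^+ m i.

(* Near p, f is the sum of an absolutely convergent power series. *)
Definition analytic_at (R : realType) (n : nat) (f : 'rV[R]_n.+1 -> R)
    (p : 'rV[R]_n.+1) : Prop :=
  exists a : {ffun 'I_n.+1 -> nat} -> R, \forall x \near p,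
    cvgn (mpsum (fun m => `|a m|) (map_mx Num.norm (x - p))) /\
    mpsum a (x - p) @ \oo --> f x.

Inductive regularity (R : realType) : Type :=
  | Hoelder of nat & R
  | Smooth
  | Analytic.

Definition admissible (R : realType) (c : regularity R) : Prop :=
  match c with
  | Hoelder k alpha => (2 <= k)%N /\ 0 <= alpha <= 1
  | Smooth => True
  | Analytic => True
  end.

(* f is of class c in the open set U.  Hoelder conditions are local, as always
   for regularity on an open set: e.g. the distance to a point is not C^{2,1}
   up to that point. *)
Definition of_class (R : realType) (n : nat) (c : regularity R)
    (U : set 'rV[R]_n.+1) (f : 'rV[R]_n.+1 -> R) : Prop :=
  match c with
  | Hoelder k alpha =>
      Ck k U f /\
      forall s, (size s <= k)%N -> loc_hoelder alpha U (partials s f)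
  | Smooth => forall k, Ck k U f
  | Analytic => forall p, U p -> analytic_at f p
  end.

Definition map_of_class (R : realType) (m n : nat) (c : regularity R)
    (U : set 'rV[R]_m.+1) (F : 'rV[R]_m.+1 -> 'rV[R]_n.+1) : Prop :=
  forall i : 'I_n.+1, of_class c U (fun x => F x ord0 i).

Definition diffeo (R : realType) (n : nat) (c : regularity R)
    (U V : set 'rV[R]_n.+1) (phi psi : 'rV[R]_n.+1 -> 'rV[R]_n.+1) : Prop :=
  [/\ open U, open V, map_of_class c U phi, map_of_class c V psi &
      (forall x, U x -> V (phi x) /\ psi (phi x) = x) /\
      (forall y, V y -> U (psi y) /\ phi (psi y) = y)].

(* S is an embedded d-dimensional submanifold (without boundary) of R^(n+1):
   around each of its points, a change of coordinates of class c of the ambient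
   space maps S onto the slice where the coordinates of index >= d vanish. *)
Definition submanifold (R : realType) (n : nat) (c : regularity R) (d : nat)
    (S : set 'rV[R]_n.+1) : Prop :=
  forall p, S p -> exists U V phi psi,
    [/\ diffeo c U V phi psi, U p &
        forall x, U x ->
          (S x <-> forall i : 'I_n.+1, (d <= i)%N -> phi x ord0 i = 0)].

(* Main.v *)
Require Import Defs.
From mathcomp Require Import all_boot all_order all_algebra.
From mathcomp Require Import all_classical all_reals all_analysis.
From mathcomp Require Import ring lra.

Set Implicit Arguments.
Unset Strict Implicit.
Unset Printing Implicit Defensive.

Import Order.TTheory GRing.Theory Num.Theory.
Import numFieldNormedType.Exports.

Local Open Scope classical_set_scope.
Local Open Scope ring_scope.

(* At a point x with 0 < d(x) < r the gradient of d is a unit vector n and the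
   foot point is p = x - d(x) n.  Moreover d(p + s n) = s for all 0 < s < r, so n
   is a normal of S at p of full length r, and the Hessian of d is k t t^T, with
   t orthogonal to n and k the Laplacian of d.
   If d(x) k(x) <> 1, the foot point map moves along t, and this forces -n to be
   a normal at p as well; comparing the two balls at p with the two balls at a
   nearby foot point gives d k <= 1/2.  Hence {d k = 1} is open and closed, and
   the foot point is constant on it: if it is nonempty, it contains a whole
   circle around p, and p is isolated in S, so S = {p}.
   Otherwise S lies locally between two balls at each of its points, and it is
   the graph of gamma_j o gamma_i^-1, where gamma is the foot point along a
   coordinate line.  This graph function has slope - (d_i d / d_j d) o gamma_i^-1,
   which recovers the derivative lost in the definition of gamma. *)

(** * Real functions of one and two variables *)

Section RealLine.
Variable R : realType.

(** The hypothesis says something about [d] off [S] only. A point [p] of [S] is therefore reached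
    from outside, which the empty interior permits, and the normals at nearby feet are passed to the
    limit by compactness. That all normals have the same length [r] keeps the balls touching [S]
    from shrinking in this limit. In the lowest class, C^2, the number [k] is merely continuous and
    the foot point has no second-order expansion. All comparisons of balls therefore use first-order
    expansions of [d] and [n] with errors o(s), and are arranged so that the terms of order s cancel
    or contradict a quadratic bound. The bound 1/2 serves twice: it separates [d k] from the value
    1, and it makes the coordinate of the foot along the line strictly monotone where the other
    component of [n] does not vanish, which gives the inverse of gamma_i. The regularity of this
    inverse is bootstrapped from its differential equation in the Hoelder classes; in the analytic
    class it comes from a fixed point of power series. Connectedness of [S] enters in the singleton
    case. *)

Lemma ler_eps_scale (x y C : R) : (forall e : R, 0 < e -> x <= y + C * e) -> x <= y.
Proof.
move=> h; apply/ler_addgt0Pr => e e0.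
have C0 : 0 < `|C| + 1 by rewrite ltr_wpDl.
apply: (le_trans (h (e / (`|C| + 1)) _)); first by rewrite divr_gt0.
rewrite lerD2l mulrCA ger_pMr// ler_pdivrMr// mul1r.
by rewrite (le_trans (ler_norm _))// lerDl.
Qed.

Lemma cauchy_schwarz2 (A B u v h k : R) : 0 <= A -> 0 <= B ->
  u ^+ 2 + v ^+ 2 <= A ^+ 2 -> h ^+ 2 + k ^+ 2 <= B ^+ 2 -> h * u + k * v <= A * B.
Proof.
move=> A0 B0 uA hB; apply: le_trans (ler_norm _) _.
rewrite -ler_sqr ?nnegrE ?mulr_ge0// real_normK ?num_real//.
apply: (@le_trans _ _ ((h ^+ 2 + k ^+ 2) * (u ^+ 2 + v ^+ 2))).
  have := sqr_ge0 (h * v - k * u); nra.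
by rewrite exprMn mulrC ler_pM// addr_ge0// sqr_ge0.
Qed.

Lemma is_deriveE_eps (f : R -> R) (x l : R) :
  is_derive x (1 : R) f l <-> (forall e : R, 0 < e -> exists2 d : R, 0 < d &
    forall h, `|h| < d -> `|f (x + h) - f x - l * h| <= e * `|h|).
Proof.
split=> [[df <-]|H].
- move=> e e0; have /cvgrPdist_le/(_ e e0)[d /= d0 dP] := df.
  exists d => // h hd; have [->|h0] := eqVneq h 0.
    by rewrite addr0 subrr mulr0 subrr normr0 mulr0.
  have := dP h; rewrite /= sub0r normrN => /(_ hd h0).
  rewrite /GRing.scale/= mulr1 [h + x]addrC => {}dP.
  have -> : f (x + h) - f x - 'D_1 f x * h =
      - h * ('D_1 f x - h^-1 * (f (x + h) - f x)) by field.
  by rewrite normrM normrN mulrC ler_wpM2r.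
- have cv : h^-1 *: (f (h *: 1 + x) - f x) @[h --> 0^'] --> l.
    apply/cvgrPdist_le => e e0; have [d d0 dP] := H e e0.
    exists d => //= h; rewrite /= sub0r normrN => hd h0.
    have := dP h hd; rewrite -ler_pdivrMr ?normr_gt0// -normfV -normrM distrC => {}dP.
    rewrite (le_trans _ dP)// le_eqVlt; apply/orP; left; apply/eqP.
    by congr `|_|; rewrite /GRing.scale/= mulr1 [h + x]addrC; field.
  apply: DeriveDef; first by apply: cvgP cv.
  exact: cvg_lim cv.
Qed.

Lemma is_derive_near_lt (f : R -> R) (x l e : R) : is_derive x (1 : R) f l -> 0 < e ->
  exists2 d : R, 0 < d & forall y, `|y - x| < d -> `|f y - f x| < e.
Proof.
move=> [df _] e0.
have cf : {for x, continuous f} by apply/differentiable_continuous/derivable1_diffP.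
have /cvgrPdist_lt/(_ e e0)[d /= d0 dP] := cf.
exists d => // y yx; rewrite distrC; apply: dP.
by rewrite /= distrC.
Qed.

Lemma is_derive_near_cst (f : R -> R) (x l d : R) : is_derive x (1 : R) f l ->
  0 < d -> (forall y, `|y - x| < d -> f y = f x) -> l = 0.
Proof.
move=> /is_deriveE_eps df d0 fc; apply/eqP; rewrite -normr_le0.
apply: (@ler_eps_scale _ _ 1) => e e0; have [d' d'0 dP] := df e e0.
pose h := Num.min d d' / 2.
have m0 : 0 < Num.min d d' by rewrite lt_min d0.
have h0 : 0 < h by rewrite divr_gt0.
have hm : h < Num.min d d' by rewrite /h ltr_pdivrMr// ltr_pMr// ltr1n.
have := dP h; rewrite (gtr0_norm h0) (lt_le_trans hm) ?ge_min ?lexx ?orbT//.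
move=> /(_ isT); rewrite fc; last first.
  by rewrite [x + h]addrC addrK gtr0_norm// (lt_le_trans hm)// ge_min lexx.
by rewrite subrr sub0r normrN normrM (gtr0_norm h0) ler_pM2r// add0r mul1r.
Qed.

Lemma MVT_ball (f f' : R -> R) (x d y z : R) :
  (forall w, `|w - x| < d -> is_derive w (1 : R) f (f' w)) ->
  `|y - x| < d -> `|z - x| < d ->
  exists c, [/\ `|c - x| < d, `|c - z| <= `|y - z| & f y - f z = f' c * (y - z)].
Proof.
move=> df.
have key a b : a <= b -> `|a - x| < d -> `|b - x| < d ->
    exists c, [/\ `|c - x| < d, a <= c, c <= b & f b - f a = f' c * (b - a)].
  move=> ab ax bx.
  have inab w : a <= w <= b -> `|w - x| < d.
    move=> /andP[aw wb]; move: ax bx; rewrite !ltr_norml => /andP[? ?] /andP[? ?].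
    apply/andP; split; lra.
  have dab w : w \in `]a, b[%R -> is_derive w (1 : R) f (f' w).
    by rewrite in_itv/= => /andP[aw wb]; apply/df/inab; rewrite !ltW.
  have cab : {within `[a, b], continuous f}.
    apply: continuous_in_subspaceT => w; rewrite inE/= in_itv/= => wab.
    have [dw _] := df _ (inab w wab).
    by apply: differentiable_continuous; apply/derivable1_diffP.
  have [c] := MVT_segment ab dab cab; rewrite in_itv/= => acb E.
  by exists c; split; rewrite // ?inab//; case/andP: acb.
move=> yx zx; have [yz|/ltW zy] := leP y z.
  have [c [cx yc cz E]] := key _ _ yz yx zx; exists c; split=> //; last by lra.
  by rewrite ler0_norm ?subr_le0// ler0_norm ?subr_le0// lerN2 lerD2r.
have [c [cx zc cy E]] := key _ _ zy zx yx; exists c; split=> //.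
by rewrite ger0_norm ?subr_ge0// ger0_norm ?subr_ge0// lerD2r.
Qed.

Lemma cst_of_is_derive0 (f : R -> R) (x d : R) :
  (forall y, `|y - x| < d -> is_derive y (1 : R) f 0) ->
  forall y, `|y - x| < d -> f y = f x.
Proof.
move=> df y yx; have xx : `|x - x| < d.
  by rewrite subrr normr0 (le_lt_trans (normr_ge0 (y - x))).
have [c [_ _]] := MVT_ball df yx xx.
by rewrite mul0r => /eqP; rewrite subr_eq0 => /eqP.
Qed.

Lemma clopen_line (P : R -> Prop) : P 0 ->
  (forall x, P x -> exists2 e : R, 0 < e & forall y, `|y - x| < e -> P y) ->
  (forall x, (forall e : R, 0 < e -> exists2 y, `|y - x| < e & P y) -> P x) ->
  forall x, P x.
Proof.
move=> P0 Po Pc x.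
have cT : connected [set: R] by apply/connected_intervalP => a b _ _ z.
suff PT : (P : set R) = [set: R] by move: (I : [set: R] x); rewrite -PT.
apply: cT; first by exists 0.
- exists (P : set R); last by rewrite setTI.
    rewrite openE => y /= /Po[e e0 eP]; exists e => //= z /= yz.
    by apply: eP; rewrite distrC.
- exists (P : set R); last by rewrite setTI.
  move=> y yc; apply: Pc => e e0.
    have [|z [Pz yz]] := yc (ball y e); first exact: nbhsx_ballx.
    by exists z => //; rewrite distrC.
Qed.

End RealLine.

(** * Coordinates, maxima and differentiability in the plane *)

Section Plane.
Variable R : realType.

(** Coordinates relative to a chosen axis [i]; [rev_ord i] is the other index, so that one argument
    covers both axes. *)
Definition pt (i : 'I_2) (a b : R) : 'rV[R]_2 := \row_k (if k == i then a else b).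

Lemma neq_rev_ord2 (i : 'I_2) : (rev_ord i == i) = false.
Proof. by case: i => [[|[|[]]]] // ?; apply/eqP => /(congr1 val). Qed.

Lemma ord2P (i k : 'I_2) : k = i \/ k = rev_ord i.
Proof.
case: i => [[|[|[]]]] // hi; case: k => [[|[|[]]]] // hk; by
  [left; apply: val_inj | right; apply: val_inj].
Qed.

Lemma pt1 i a b : pt i a b ord0 i = a.
Proof. by rewrite mxE eqxx. Qed.

Lemma pt2 i a b : pt i a b ord0 (rev_ord i) = b.
Proof. by rewrite mxE neq_rev_ord2. Qed.

Lemma ptE i (x : 'rV[R]_2) : x = pt i (x ord0 i) (x ord0 (rev_ord i)).
Proof.
by apply/rowP => k; rewrite mxE; case: (ord2P i k) => ->; rewrite ?eqxx ?neq_rev_ord2.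
Qed.

Lemma near_ptP i (a b : R) (P : 'rV[R]_2 -> Prop) :
  (\forall y \near pt i a b, P y) <->
  exists2 e : R, 0 < e & forall x y, `|x - a| < e -> `|y - b| < e -> P (pt i x y).
Proof.
split=> [/nbhs_ballP[e /= e0 eP]|[e e0 eP]].
  exists e => // x y xa yb; apply: eP; split=> // k l; rewrite ord1 {k}.
  by case: (ord2P i l) => ->; rewrite ?pt1 ?pt2; rewrite /ball/= distrC.
apply/nbhs_ballP; exists e => // y [_ yP]; rewrite (ptE i y).
apply: eP.
  by have := yP ord0 i; rewrite pt1 /ball/= distrC.
by have := yP ord0 (rev_ord i); rewrite pt2 /ball/= distrC.
Qed.

Lemma continuous_ptP i (a b : R) (f : 'rV[R]_2 -> R) :
  {for pt i a b, continuous f} <->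
  forall e : R, 0 < e -> exists2 d : R, 0 < d &
    forall x y, `|x - a| < d -> `|y - b| < d -> `|f (pt i x y) - f (pt i a b)| < e.
Proof.
have FF : ProperFilter (nbhs (pt i a b)) by exact: nbhs_pfilter.
split=> [cf e e0|H].
  have /(@cvgrPdist_lt _ _ _ _ FF)/(_ e e0)/near_ptP[d d0 dP] := cf.
  by exists d => // x y xa yb; rewrite distrC; exact: dP.
apply/(@cvgrPdist_lt _ _ _ _ FF) => e e0; apply/near_ptP.
have [d d0 dP] := H e e0.
by exists d => // x y xa yb; rewrite distrC; exact: dP.
Qed.

(** Serves three times: for nearest points of [S], for maxima over a disc, and for the
    semicontinuity of the normals. *)
Lemma EVT_plane (F : R -> R -> R) (K : R -> R -> Prop) (B C : R) :
  (forall a b x y, `|F x y - F a b| <= C * (`|x - a| + `|y - b|)) ->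
  (forall a b, K a b -> `|a| <= B /\ `|b| <= B) ->
  (forall a b, ~ K a b -> exists2 e : R, 0 < e &
     forall x y, `|x - a| < e -> `|y - b| < e -> ~ K x y) ->
  (exists a b, K a b) ->
  exists a b, K a b /\ forall x y, K x y -> F x y <= F a b.
Proof.
move=> FC KB Kc [a0 [b0 K0]].
pose A : set 'rV[R]_2 := [set v | K (v ord0 ord0) (v ord0 (rev_ord ord0))].
pose f (v : 'rV[R]_2) := F (v ord0 ord0) (v ord0 (rev_ord ord0)).
have A0 : A !=set0 by exists (pt ord0 a0 b0); rewrite /A/= pt1 pt2.
have cA : compact A.
  apply: bounded_closed_compact.
    exists B; split; first exact: num_real.
    move=> M BM v /KB[vB1 vB2].
    have M0 : 0 <= M by rewrite (le_trans (normr_ge0 (v ord0 ord0)))// (le_trans vB1)// ltW.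
    rewrite /= -[`|v|]/(mx_norm v) mx_normrE; apply: bigmax_le => // -[k l] _ /=.
    by rewrite ord1; case: (ord2P ord0 l) => ->; rewrite (le_trans _ (ltW BM)).
  rewrite -openC openE => v /= /Kc[e e0 eP].
  suff : \forall y \near pt ord0 (v ord0 ord0) (v ord0 (rev_ord ord0)), (~` A) y.
    by rewrite -ptE.
  apply/near_ptP; exists e => // x y xa yb.
  by rewrite /A/= pt1 pt2; exact: eP.
have cf : {within A, continuous f}.
  apply: continuous_subspaceT => v.
  suff : {for pt ord0 (v ord0 ord0) (v ord0 (rev_ord ord0)), continuous f} by rewrite -ptE.
  apply/continuous_ptP => e e0.
  have C0 : 0 < `|C| + 1 by rewrite ltr_wpDl.
  exists (e / (`|C| + 1) / 2); first by rewrite !divr_gt0.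
  move=> x y xa yb; rewrite /f !pt1 !pt2.
  apply: (le_lt_trans (FC _ _ _ _)).
  apply: (@le_lt_trans _ _ ((`|C| + 1) *
      (`|x - v ord0 ord0| + `|y - v ord0 (rev_ord ord0)|))).
    by rewrite ler_wpM2r ?addr_ge0// (le_trans (ler_norm _))// lerDl.
  rewrite mulrC -ltr_pdivlMr// [ltRHS]splitr ltrD//.
have [v] := compact_EVT_max A0 cA cf; rewrite inE => Av vP.
exists (v ord0 ord0), (v ord0 (rev_ord ord0)); split=> // x y Kxy.
have := vP (pt ord0 x y); rewrite inE /A/= /f !pt1 !pt2; exact.
Qed.

Definition diff2 (f : R -> R -> R) (a b fa fb : R) := forall e : R, 0 < e ->
  exists2 d : R, 0 < d & forall h k : R, `|h| < d -> `|k| < d ->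
    `|f (a + h) (b + k) - f a b - (fa * h + fb * k)| <= e * (`|h| + `|k|).

Lemma diff2_dir f (a b fa fb u v e : R) : diff2 f a b fa fb -> 0 < e ->
  exists2 d : R, 0 < d & forall s : R, `|s| < d ->
    `|f (a + s * u) (b + s * v) - f a b - (fa * u + fb * v) * s| <= e * `|s|.
Proof.
move=> df e0; set C := `|u| + `|v| + 1.
have C0 : 0 < C by rewrite ltr_wpDl// addr_ge0.
have [d d0 dP] := df (e / C) (divr_gt0 e0 C0).
have Cu : `|u| <= C by rewrite /C -addrA lerDl addr_ge0.
have Cv : `|v| <= C by rewrite /C [`|u| + _]addrC -addrA lerDl addr_ge0.
exists (d / C); first by rewrite divr_gt0.
move=> s; rewrite ltr_pdivlMr// => sd.
have hs : `|s * u| < d by rewrite normrM (le_lt_trans _ sd)// ler_wpM2l.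
have hv : `|s * v| < d by rewrite normrM (le_lt_trans _ sd)// ler_wpM2l.
have := dP _ _ hs hv.
have -> : fa * (s * u) + fb * (s * v) = (fa * u + fb * v) * s by ring.
move/le_trans; apply; rewrite !normrM -mulrDr mulrCA.
rewrite [leRHS]mulrC ler_wpM2l// mulrAC ler_pdivrMr// ler_wpM2l ?(ltW e0)//.
by rewrite /C lerDl.
Qed.

Lemma is_derive_diff2_dir f (a b fa fb u v : R) : diff2 f a b fa fb ->
  is_derive (0 : R) (1 : R) (fun s => f (a + s * u) (b + s * v)) (fa * u + fb * v).
Proof.
move=> df; apply/is_deriveE_eps => e e0.
have [d d0 dP] := diff2_dir u v df e0; exists d => // h hd.
by rewrite !add0r !mul0r !addr0; exact: dP.
Qed.

Lemma is_derive_diff2_fst f (a b fa fb : R) : diff2 f a b fa fb ->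
  is_derive a (1 : R) (f ^~ b) fa.
Proof.
move=> df; apply/is_deriveE_eps => e e0.
have [d d0 dP] := df _ e0; exists d => // h hd.
by have := dP h 0 hd; rewrite normr0 !addr0 mulr0 addr0; apply.
Qed.

Lemma is_derive_diff2_snd f (a b fa fb : R) : diff2 f a b fa fb ->
  is_derive b (1 : R) (f a) fb.
Proof.
move=> df; apply/is_deriveE_eps => e e0.
have [d d0 dP] := df _ e0; exists d => // h hd.
by have := dP 0 h; rewrite normr0 !addr0 mulr0 !add0r; apply.
Qed.

Definition nrm (a b : R) := Num.sqrt (a ^+ 2 + b ^+ 2).

Lemma nrm_ge0 a b : 0 <= nrm a b. Proof. exact: sqrtr_ge0. Qed.

Lemma sqr_nrm a b : nrm a b ^+ 2 = a ^+ 2 + b ^+ 2.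
Proof. by rewrite sqr_sqrtr// addr_ge0// sqr_ge0. Qed.

Lemma nrm_le a b c : 0 <= c -> (nrm a b <= c) = (a ^+ 2 + b ^+ 2 <= c ^+ 2).
Proof. by move=> c0; rewrite -sqr_nrm ler_sqr ?nnegrE ?nrm_ge0. Qed.

Lemma nrmD a b h k : nrm (a + h) (b + k) <= nrm a b + nrm h k.
Proof.
rewrite nrm_le ?addr_ge0 ?nrm_ge0//.
have : h * a + k * b <= nrm a b * nrm h k.
  by apply: cauchy_schwarz2; rewrite ?nrm_ge0 ?sqr_nrm.
have := sqr_nrm a b; have := sqr_nrm h k; nra.
Qed.

Lemma nrm_le_sum h k : nrm h k <= `|h| + `|k|.
Proof.
rewrite nrm_le ?addr_ge0//.
rewrite -(real_normK (num_real h)) -(real_normK (num_real k)).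
have := normr_ge0 h; have := normr_ge0 k; nra.
Qed.

Lemma nrm_lip a b x y : `|nrm x y - nrm a b| <= `|x - a| + `|y - b|.
Proof.
rewrite ler_norml; apply/andP; split.
  have := nrmD x y (a - x) (b - y); rewrite ![_ + (_ - _)]addrC !subrK.
  have := nrm_le_sum (a - x) (b - y); rewrite distrC [`|b - y|]distrC; lra.
have := nrmD a b (x - a) (y - b); rewrite ![_ + (_ - _)]addrC !subrK.
have := nrm_le_sum (x - a) (y - b); lra.
Qed.

End Plane.

(** * Geometry of a tube in which the distance is of class C^2 *)

Section Geometry.
Variable R : realType.

(* [S] and its distance function [D] in a pair of coordinates; the derivatives
   are data, so that the two coordinates can be exchanged. *)
Record C2_tube (S : R -> R -> Prop) (D d1 d2 d11 d12 d21 d22 : R -> R -> R) (r : R) :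
    Prop := C2Tube {
  tube_radius_gt0 : 0 < r;
  dist_nonneg : forall a b, 0 <= D a b;
  dist_le_sqr : forall a b f g, S f g -> D a b ^+ 2 <= (a - f) ^+ 2 + (b - g) ^+ 2;
  dist_attained : forall a b, exists f g,
    S f g /\ D a b ^+ 2 = (a - f) ^+ 2 + (b - g) ^+ 2;
  compl_dense : forall a b e : R, 0 < e ->
    exists x y, [/\ `|x - a| < e, `|y - b| < e & ~ S x y];
  dist_diff : forall a b, 0 < D a b < r -> diff2 D a b (d1 a b) (d2 a b);
  grad1_diff : forall a b, 0 < D a b < r -> diff2 d1 a b (d11 a b) (d12 a b);
  grad2_diff : forall a b, 0 < D a b < r -> diff2 d2 a b (d21 a b) (d22 a b);
  laplacian_cont : forall a b, 0 < D a b < r -> forall e : R, 0 < e ->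
    exists2 d : R, 0 < d & forall x y, `|x - a| < d -> `|y - b| < d ->
      `|(d11 x y + d22 x y) - (d11 a b + d22 a b)| < e }.

Variables (S : R -> R -> Prop) (D d1 d2 d11 d12 d21 d22 : R -> R -> R) (r : R).
Hypothesis tube : C2_tube S D d1 d2 d11 d12 d21 d22 r.

Let r0 : 0 < r. Proof. by case: tube. Qed.
Let D0 a b : 0 <= D a b. Proof. by case: tube. Qed.

Lemma dist_le a b f g c : S f g -> 0 <= c ->
  (a - f) ^+ 2 + (b - g) ^+ 2 <= c ^+ 2 -> D a b <= c.
Proof.
move=> Sf c0 h; rewrite -ler_sqr ?nnegrE// (le_trans _ h)//.
by case: tube => _ _ + _ _ _ _ _ _; apply.
Qed.

Lemma dist_on a b : S a b -> D a b = 0.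
Proof.
move=> Sab; apply/eqP; rewrite eq_le D0 andbT; apply: (dist_le Sab) => //.
by rewrite !subrr expr0n/= addr0.
Qed.

Lemma dist_gt0 a b : ~ S a b -> 0 < D a b.
Proof.
move=> nS; rewrite lt_neqAle D0 andbT; apply/eqP => E; apply: nS.
have [f [g [Sf]]] := dist_attained tube a b; rewrite -E => h.
have [/subr0_eq af /subr0_eq bg] : a - f = 0 /\ b - g = 0.
  have := sqr_ge0 (a - f); have := sqr_ge0 (b - g) => ? ?.
  by split; apply/eqP; rewrite -sqrf_eq0; apply/eqP; nra.
by rewrite af bg.
Qed.

Lemma dist_lip a b x y c : 0 <= c -> (x - a) ^+ 2 + (y - b) ^+ 2 <= c ^+ 2 ->
  D x y <= D a b + c.
Proof.
move=> c0 hc; have [f [g [Sf E]]] := dist_attained tube a b.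
apply: (dist_le Sf); first by rewrite addr_ge0.
have : (x - a) * (a - f) + (y - b) * (b - g) <= D a b * c.
  by apply: cauchy_schwarz2; rewrite // E.
nra.
Qed.

Lemma dist_lip1 a b x y : `|D x y - D a b| <= `|x - a| + `|y - b|.
Proof.
have n0 : 0 <= `|x - a| + `|y - b| by rewrite addr_ge0.
rewrite ler_norml; apply/andP; split.
  have : D a b <= D x y + (`|x - a| + `|y - b|).
    apply: dist_lip => //; rewrite -nrm_le// (le_trans (nrm_le_sum _ _))//.
    by rewrite (distrC a) (distrC b).
  lra.
have : D x y <= D a b + (`|x - a| + `|y - b|).
  by apply: dist_lip => //; rewrite -nrm_le// nrm_le_sum.
lra.
Qed.

(** Towards a nearest point [D] decreases at unit speed, so its derivative in the opposite direction
    [n] is at least 1. As [D] is 1-Lipschitz, its gradient has norm at most 1. The equality case of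
    Cauchy-Schwarz identifies the gradient with [n]; in particular the nearest point is unique. *)
Lemma dist_grad a b f g : S f g -> D a b ^+ 2 = (a - f) ^+ 2 + (b - g) ^+ 2 ->
  0 < D a b < r ->
  [/\ d1 a b ^+ 2 + d2 a b ^+ 2 = 1, a - f = D a b * d1 a b & b - g = D a b * d2 a b].
Proof.
move=> Sf E Dr; set t := D a b in E *.
have t0 : 0 < t by case/andP: Dr.
have tn0 : t != 0 by rewrite gt_eqF.
pose n1 := (a - f) / t; pose n2 := (b - g) / t.
have an1 : a - f = t * n1 by rewrite /n1 mulrC divfK.
have bn2 : b - g = t * n2 by rewrite /n2 mulrC divfK.
clearbody n1 n2.
have n1E : n1 ^+ 2 + n2 ^+ 2 = 1.
  have : t ^+ 2 * (n1 ^+ 2 + n2 ^+ 2) = t ^+ 2 * 1 by rewrite mulr1 {2}E an1 bn2; ring.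
  by apply: mulfI; rewrite sqrf_eq0.
set u := d1 a b; set v := d2 a b.
have nd : 1 <= n1 * u + n2 * v.
  apply: (@ler_eps_scale _ _ _ 1) => e e0.
  have [d d0 dP] := diff2_dir (- n1) (- n2) (dist_diff tube Dr) e0.
  pose s := Num.min (d / 2) t.
  have s0 : 0 < s by rewrite lt_min t0 divr_gt0.
  have sd : `|s| < d.
    by rewrite gtr0_norm// gt_min ltr_pdivrMr// ltr_pMr// ltr1n.
  have st : s <= t by rewrite ge_min lexx orbT.
  have := dP s sd; rewrite (gtr0_norm s0) ler_norml => /andP[h _].
  have : D (a + s * - n1) (b + s * - n2) <= t - s.
    apply: (dist_le Sf); first by rewrite subr_ge0.
    have -> : a + s * - n1 - f = (t - s) * n1 by rewrite mulrBl -an1; ring.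
    have -> : b + s * - n2 - g = (t - s) * n2 by rewrite mulrBl -bn2; ring.
    by rewrite !exprMn -mulrDr n1E mulr1.
  move: h; rewrite -/t -/u -/v => h h'.
  rewrite -(ler_pM2l s0); nra.
have uv1 : u ^+ 2 + v ^+ 2 <= 1.
  rewrite leNgt; apply/negP => uv1.
  (* Along the gradient [D] would grow at rate [L], against the Lipschitz rate [sqrt L]. The latter
     is replaced by the larger [(1 + L) / 2], which avoids the root and is still below [L]; [e] is
     half of the gap. *)
  pose L := u ^+ 2 + v ^+ 2; pose e := (L - 1) / 4.
  have e0 : 0 < e by rewrite divr_gt0// subr_gt0.
  have [d d0 dP] := diff2_dir u v (dist_diff tube Dr) e0.
  have sd : `|d / 2| < d by rewrite gtr0_norm ?divr_gt0// ltr_pdivrMr// ltr_pMr// ltr1n.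
  have s0 : 0 < d / 2 by rewrite divr_gt0.
  set s := d / 2 in sd s0.
  have := dP s sd; rewrite (gtr0_norm s0) ler_norml => /andP[h _].
  have : D (a + s * u) (b + s * v) <= t + s * ((1 + L) / 2).
    apply: dist_lip; first by rewrite mulr_ge0 ?(ltW s0)// /L; lra.
    rewrite [a + _]addrC [b + _]addrC !addrK [leRHS]exprMn [(s * u) ^+ 2]exprMn.
    rewrite [(s * v) ^+ 2]exprMn -mulrDr ler_wpM2l ?sqr_ge0//.
    rewrite -/L; have := sqr_ge0 (L - 1); nra.
  move: h; rewrite -/t -/u -/v => h h'.
  have : s * L <= s * ((1 + L) / 2) + e * s by rewrite /L in h' *; nra.
  rewrite /e => hh; have : L <= (1 + L) / 2 + (L - 1) / 4.
    by rewrite -(ler_pM2l s0); nra.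
  rewrite /L; lra.
have z : (n1 - u) ^+ 2 + (n2 - v) ^+ 2 <= 0.
  have -> : (n1 - u) ^+ 2 + (n2 - v) ^+ 2 =
    (n1 ^+ 2 + n2 ^+ 2) + (u ^+ 2 + v ^+ 2) - 2 * (n1 * u + n2 * v) by ring.
  rewrite n1E; lra.
have [z1 z2] : n1 = u /\ n2 = v.
  have := sqr_ge0 (n1 - u); have := sqr_ge0 (n2 - v) => ? ?.
  by split; apply/eqP; rewrite -subr_eq0 -sqrf_eq0; apply/eqP; lra.
by rewrite -z1 -z2.
Qed.

(** * Normals and their semicontinuity *)

Definition normal p1 p2 n1 n2 := [/\ S p1 p2, n1 ^+ 2 + n2 ^+ 2 = 1 &
  forall s, 0 < s < r -> D (p1 + s * n1) (p2 + s * n2) = s].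

Lemma max_disc a b (e c : R) : 0 <= e ->
  exists x y, nrm (x - a) (y - b) <= e /\
    forall z w, nrm (z - a) (w - b) <= e ->
      D z w - c * nrm (z - a) (w - b) <= D x y - c * nrm (x - a) (y - b).
Proof.
move=> e0.
apply: (@EVT_plane _ (fun x y => D x y - c * nrm (x - a) (y - b))
   (fun x y => nrm (x - a) (y - b) <= e) (e + `|a| + `|b|) (1 + `|c|)).
- move=> p q x y.
  have -> : D x y - c * nrm (x - a) (y - b) - (D p q - c * nrm (p - a) (q - b)) =
    (D x y - D p q) - c * (nrm (x - a) (y - b) - nrm (p - a) (q - b)) by ring.
  rewrite (le_trans (ler_normB _ _))// mulrDl mul1r lerD ?dist_lip1//.
  have -> : x - p = x - a - (p - a) by ring.
  have -> : y - q = y - b - (q - b) by ring.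
  by rewrite normrM ler_wpM2l// nrm_lip.
- move=> x y; rewrite nrm_le// => h.
  have hx : `|x - a| <= e.
    rewrite -ler_sqr ?nnegrE// real_normK ?num_real//.
    by rewrite (le_trans _ h)// lerDl sqr_ge0.
  have hy : `|y - b| <= e.
    rewrite -ler_sqr ?nnegrE// real_normK ?num_real//.
    by rewrite (le_trans _ h)// lerDr sqr_ge0.
  have := ler_normD (x - a) a; have := ler_normD (y - b) b; rewrite !subrK.
  by have := normr_ge0 a; have := normr_ge0 b => *; split; lra.
- move=> x y /negP; rewrite -ltNge => h.
  exists ((nrm (x - a) (y - b) - e) / 2); first by rewrite divr_gt0// subr_gt0.
  move=> z w zx wy; apply/negP; rewrite -ltNge.
  have := nrm_lip (x - a) (y - b) (z - a) (w - b).
  have -> : z - a - (x - a) = z - x by ring.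
  have -> : w - b - (y - b) = w - y by ring.
  rewrite ler_norml => /andP[+ _]; lra.
- by exists a, b; rewrite !subrr nrm_le// expr0n/= addr0 sqr_ge0.
Qed.

(* The distance grows at unit speed along a normal: if its maximum on a disc
   around the point [y] were too small, then [D - c |. - y|] with [c < 1] would be
   maximal at an interior point, where the gradient of [D] has norm 1. *)
Lemma normal_extend f g n1 n2 s : S f g -> n1 ^+ 2 + n2 ^+ 2 = 1 -> 0 < s < r ->
  D (f + s * n1) (g + s * n2) = s -> normal f g n1 n2.
Proof.
move=> Sf nE sr Ds; split => // s' /andP[s'0 s'r].
have sg0 : 0 < s by case/andP: sr.
have up : D (f + s' * n1) (g + s' * n2) <= s'.
  apply: (dist_le Sf); first exact: ltW.
  by rewrite ![_ + s' * _]addrC !addrK !exprMn -mulrDr nE mulr1.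
apply/eqP; rewrite eq_le up /=.
(* Between the foot and the given point the triangle inequality suffices; only [s < s'] needs the
   gradient. *)
have [s's|ss'] := leP s' s.
  have : D (f + s * n1) (g + s * n2) <= D (f + s' * n1) (g + s' * n2) + (s - s').
    apply: dist_lip; first lra.
    have -> : f + s * n1 - (f + s' * n1) = (s - s') * n1 by ring.
    have -> : g + s * n2 - (g + s' * n2) = (s - s') * n2 by ring.
    by rewrite !exprMn -mulrDr nE mulr1.
  by rewrite Ds; lra.
set a := f + s * n1 in Ds *; set b := g + s * n2 in Ds *.
pose e := s' - s; have e0 : 0 < e by rewrite subr_gt0.
have [m1 [m2 [mde mP]]] := @max_disc a b e 0 (ltW e0).
have {}mP z w : nrm (z - a) (w - b) <= e -> D z w <= D m1 m2.
  by move/mP; rewrite !mul0r !subr0.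
have ms' : s' <= D m1 m2.
  rewrite leNgt; apply/negP => ms'.
  have sm : s <= D m1 m2.
    by rewrite -[leLHS]Ds; apply: mP; rewrite !subrr nrm_le ?(ltW e0)// expr0n/= addr0 sqr_ge0.
  (* The midpoint of 1 and the average growth rate: [c < 1], yet [c * e] exceeds the total growth,
     so the new maximum point cannot lie on the boundary circle. *)
  pose c := (1 + (D m1 m2 - s) / e) / 2.
  have q1 : (D m1 m2 - s) / e < 1 by rewrite ltr_pdivrMr// mul1r /e ltrD2r.
  have q0 : 0 <= (D m1 m2 - s) / e by rewrite divr_ge0 ?subr_ge0// ltW.
  have c0 : 0 < c by rewrite /c divr_gt0//; lra.
  have c1 : c < 1 by rewrite /c; lra.
  have ce : D m1 m2 - s < c * e.
    by rewrite -ltr_pdivrMr// /c; lra.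
  have [x [y [xye xyP]]] := max_disc a b c (ltW e0).
  have rs : c * nrm (x - a) (y - b) + s <= D x y.
    have := xyP a b; rewrite !subrr.
    have -> : nrm 0 0 = 0 :> R by rewrite /nrm expr0n/= addr0 sqrtr0.
    by rewrite Ds (ltW e0) => /(_ isT); lra.
  have re : nrm (x - a) (y - b) < e.
    by rewrite -(ltr_pM2l c0); have := mP _ _ xye; lra.
  have Dxy : 0 < D x y < r.
    have := mP _ _ xye; have := nrm_ge0 (x - a) (y - b) => ? ?.
    have : 0 <= c * nrm (x - a) (y - b) by rewrite mulr_ge0// ltW.
    by move=> ?; apply/andP; split; lra.
  have [f' [g' [Sf' E']]] := dist_attained tube x y.
  have [gE _ _] := dist_grad Sf' E' Dxy.
  have h0 : 0 < (1 - c) / 2 by rewrite divr_gt0// subr_gt0.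
  have [d dg0 dP] := diff2_dir (d1 x y) (d2 x y) (dist_diff tube Dxy) h0.
  pose t := Num.min (d / 2) (e - nrm (x - a) (y - b)).
  have t0 : 0 < t by rewrite lt_min divr_gt0//= subr_gt0.
  have td : `|t| < d.
    by rewrite gtr0_norm// gt_min ltr_pdivrMr// ltr_pMr// ltr1n.
  have te : t <= e - nrm (x - a) (y - b) by rewrite ge_min lexx orbT.
  have := dP t td; rewrite (gtr0_norm t0) -!expr2 gE ler_norml => /andP[hl _].
  have nt : nrm (x + t * d1 x y - a) (y + t * d2 x y - b) <= nrm (x - a) (y - b) + t.
    have -> : x + t * d1 x y - a = x - a + t * d1 x y by ring.
    have -> : y + t * d2 x y - b = y - b + t * d2 x y by ring.
    rewrite (le_trans (nrmD _ _ _ _))// lerD2l nrm_le ?(ltW t0)//.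
    by rewrite !exprMn -mulrDr gE mulr1.
  have := xyP (x + t * d1 x y) (y + t * d2 x y).
  have -> : nrm (x + t * d1 x y - a) (y + t * d2 x y - b) <= e by lra.
  move/(_ isT) => h.
  have : c * nrm (x + t * d1 x y - a) (y + t * d2 x y - b) <=
     c * (nrm (x - a) (y - b) + t) by rewrite ler_wpM2l ?(ltW c0).
  have : c * t < t by rewrite gtr_pMl.
  nra.
(* The point [m] is within [e] of [a] and at least [s + e] away from the foot, which is at distance
   [s] from [a]. Equality in the triangle inequality puts [m] on the ray, at [f + s' n]. *)
have ne : (m1 - a) ^+ 2 + (m2 - b) ^+ 2 <= e ^+ 2 by rewrite -nrm_le// ltW.
have mf : s' ^+ 2 <= (m1 - f) ^+ 2 + (m2 - g) ^+ 2.
  apply: le_trans (dist_le_sqr tube m1 m2 Sf).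
  by rewrite ler_sqr ?nnegrE// ltW.
pose v1 := m1 - a; pose v2 := m2 - b.
have vn : e <= v1 * n1 + v2 * n2.
  have E1 : m1 - f = v1 + s * n1 by rewrite /v1 /a; ring.
  have E2 : m2 - g = v2 + s * n2 by rewrite /v2 /b; ring.
  move: mf; rewrite E1 E2.
  have -> : (v1 + s * n1) ^+ 2 + (v2 + s * n2) ^+ 2 = (v1 ^+ 2 + v2 ^+ 2) +
    2 * s * (v1 * n1 + v2 * n2) + s ^+ 2 * (n1 ^+ 2 + n2 ^+ 2) by ring.
  rewrite nE -/v1 -/v2 in ne * => h.
  rewrite -(ler_pM2l sg0).
  have : s' ^+ 2 = e ^+ 2 + 2 * e * s + s ^+ 2 by rewrite /e; ring.
  move: h ne; rewrite -/v1 -/v2; lra.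
have z : (v1 - e * n1) ^+ 2 + (v2 - e * n2) ^+ 2 <= 0.
  have -> : (v1 - e * n1) ^+ 2 + (v2 - e * n2) ^+ 2 = (v1 ^+ 2 + v2 ^+ 2) -
    2 * e * (v1 * n1 + v2 * n2) + e ^+ 2 * (n1 ^+ 2 + n2 ^+ 2) by ring.
  rewrite nE; have : e * e <= e * (v1 * n1 + v2 * n2) by rewrite ler_wpM2l ?(ltW e0).
  move: ne; rewrite -/v1 -/v2; lra.
have [z1 z2] : v1 = e * n1 /\ v2 = e * n2.
  have := sqr_ge0 (v1 - e * n1); have := sqr_ge0 (v2 - e * n2) => ? ?.
  by split; apply/eqP; rewrite -subr_eq0 -sqrf_eq0; apply/eqP; lra.
have -> : f + s' * n1 = m1 by rewrite -[RHS](subrK a) -/v1 z1 /e /a; ring.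
have -> : g + s' * n2 = m2 by rewrite -[RHS](subrK b) -/v2 z2 /e /b; ring.
by [].
Qed.

Lemma normal_grad p1 p2 n1 n2 s : normal p1 p2 n1 n2 -> 0 < s < r ->
  d1 (p1 + s * n1) (p2 + s * n2) = n1 /\ d2 (p1 + s * n1) (p2 + s * n2) = n2.
Proof.
move=> [Sp nE nP] sr; have Ds := nP s sr.
have s0 : s != 0 by rewrite gt_eqF//; case/andP: sr.
have [] := @dist_grad (p1 + s * n1) (p2 + s * n2) p1 p2 Sp.
- by rewrite Ds ![_ + s * _]addrC !addrK !exprMn -mulrDr nE mulr1.
- by rewrite Ds.
- rewrite Ds ![_ + s * _]addrC !addrK => _ /(mulfI s0) <- /(mulfI s0) <-.
  by [].
Qed.

Lemma normal_foot a b : 0 < D a b < r ->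
  normal (a - D a b * d1 a b) (b - D a b * d2 a b) (d1 a b) (d2 a b).
Proof.
move=> Dr; have [f [g [Sf E]]] := dist_attained tube a b.
have [nE E1 E2] := dist_grad Sf E Dr.
rewrite -E1 -E2 !opprB ![_ + (_ - _)]addrC !subrK.
apply: (normal_extend Sf nE Dr).
by rewrite -E1 -E2 ![_ + (_ - _)]addrC !subrK.
Qed.

(** The open ball of radius [s] about [p + s n] misses [S]. Expanded at [q], this says that the
    component of [q - p] along [n] is at most quadratic in [q - p]. *)
Lemma normal_ball p1 p2 n1 n2 q1 q2 s : normal p1 p2 n1 n2 -> S q1 q2 -> 0 < s < r ->
  2 * s * ((q1 - p1) * n1 + (q2 - p2) * n2) <= (q1 - p1) ^+ 2 + (q2 - p2) ^+ 2.
Proof.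
move=> [Sp nE nP] Sq sr; have := dist_le_sqr tube (p1 + s * n1) (p2 + s * n2) Sq.
rewrite (nP _ sr) => h.
have := congr1 (fun x => s ^+ 2 * x) nE; nra.
Qed.

Lemma unit_le1 (u v : R) : u ^+ 2 + v ^+ 2 = 1 -> `|u| <= 1 /\ `|v| <= 1.
Proof.
move=> E; have := sqr_ge0 u; have := sqr_ge0 v => v0 u0.
by split; rewrite -(expr_le1 (n := 2))// real_normK ?num_real//; lra.
Qed.

(** Upper semicontinuity of the set of normals. [K] collects the points of the disc of radius [t]
    about [p] that stay away from [p + t m] for every normal [m] at [p]. By compactness the maximum
    of [D] on [K] is less than [t], whereas [D (p + t n)] is close to [t] when [n] is a normal at a
    point close to [p]. *)
Lemma normal_near p1 p2 (e : R) : S p1 p2 -> 0 < e ->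
  exists2 d : R, 0 < d & forall f g n1 n2, normal f g n1 n2 ->
    `|f - p1| < d -> `|g - p2| < d ->
    exists m1 m2, [/\ normal p1 p2 m1 m2, `|n1 - m1| < e & `|n2 - m2| < e].
Proof.
move=> Sp e0; pose t := r / 2.
have t0 : 0 < t by rewrite divr_gt0.
have tr : 0 < t < r by rewrite t0 ltr_pdivrMr// ltr_pMr// ltr1n.
clearbody t; pose K x y := nrm (x - p1) (y - p2) <= t /\ forall m1 m2, normal p1 p2 m1 m2 ->
  (t * e <= `|x - (p1 + t * m1)|) || (t * e <= `|y - (p2 + t * m2)|).
have notK x y : nrm (x - p1) (y - p2) <= t -> ~ K x y -> exists m1 m2,
    [/\ normal p1 p2 m1 m2, `|x - (p1 + t * m1)| < t * e & `|y - (p2 + t * m2)| < t * e].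
  move=> xt nK; apply: contrapT => nm; apply: nK; split=> // m1 m2 mn.
  apply: contrapT => /negP; rewrite negb_or -!ltNge => /andP[? ?].
  by apply: nm; exists m1, m2.
have fin f g n1 n2 : normal f g n1 n2 -> ~ K (p1 + t * n1) (p2 + t * n2) ->
    exists m1 m2, [/\ normal p1 p2 m1 m2, `|n1 - m1| < e & `|n2 - m2| < e].
  move=> [_ nE _] /notK[].
    rewrite nrm_le ?(ltW t0)// ![_ + t * _]addrC !addrK.
    by rewrite [(t * n1) ^+ 2]exprMn [(t * n2) ^+ 2]exprMn -mulrDr nE mulr1.
  move=> m1 [m2 [mn]]; rewrite !opprD ![p1 + _]addrC ![p2 + _]addrC.
  have -> : t * n1 + p1 + (- p1 - t * m1) = t * (n1 - m1) by ring.
  have -> : t * n2 + p2 + (- p2 - t * m2) = t * (n2 - m2) by ring.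
  rewrite !normrM (gtr0_norm t0) !ltr_pM2l// => ? ?.
  by exists m1, m2.
have [Kne|Kem] := pselect (exists x y, K x y); last first.
  exists 1 => // f g n1 n2 nn _ _; apply: (fin f g) => // ?; apply: Kem.
  by exists (p1 + t * n1), (p2 + t * n2).
have [x [y [Kxy xyP]]] : exists x y, K x y /\ forall z w, K z w -> D z w <= D x y.
  apply: (@EVT_plane _ D K (t + `|p1| + `|p2|) 1) => //.
  - by move=> a b z w; rewrite mul1r dist_lip1.
  - move=> z w [+ _]; rewrite nrm_le ?(ltW t0)// => h.
    have hx : `|z - p1| <= t.
      rewrite -ler_sqr ?nnegrE ?(ltW t0)// real_normK ?num_real//.
      by rewrite (le_trans _ h)// lerDl sqr_ge0.
    have hy : `|w - p2| <= t.
      rewrite -ler_sqr ?nnegrE ?(ltW t0)// real_normK ?num_real//.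
      by rewrite (le_trans _ h)// lerDr sqr_ge0.
    have := ler_normD (z - p1) p1; have := ler_normD (w - p2) p2; rewrite !subrK.
    by have := normr_ge0 p1; have := normr_ge0 p2 => *; split; lra.
  - move=> a b nK; have [at'|at'] := leP (nrm (a - p1) (b - p2)) t.
      have [m1 [m2 [mn am bm]]] := notK _ _ at' nK.
      exists (Num.min (t * e - `|a - (p1 + t * m1)|) (t * e - `|b - (p2 + t * m2)|)).
        by rewrite lt_min !subr_gt0 am bm.
      move=> z w; rewrite !lt_min => /andP[z1 z2] /andP[w1 w2] [_ /(_ _ _ mn)].
      have := ler_normD (z - a) (a - (p1 + t * m1)).
      have := ler_normD (w - b) (b - (p2 + t * m2)).
      by rewrite !addrA !subrK => h1 h2 /orP[]; lra.
    exists ((nrm (a - p1) (b - p2) - t) / 2); first by rewrite divr_gt0// subr_gt0.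
    move=> z w za wb [+ _].
    have := nrm_lip (a - p1) (b - p2) (z - p1) (w - p2).
    have -> : z - p1 - (a - p1) = z - a by ring.
    have -> : w - p2 - (b - p2) = w - b by ring.
    by rewrite ler_norml => /andP[+ _]; lra.
(* A point of the disc with [D >= t] lies on the boundary circle, and [normal_extend] makes its
   direction a normal at [p]; such a point is not in [K]. *)
have Mt : D x y < t.
  rewrite ltNge; apply/negP => tD; case: Kxy => xt Km.
  have Dn : D x y <= nrm (x - p1) (y - p2).
    by apply: (dist_le Sp); rewrite ?nrm_ge0// sqr_nrm.
  have Dt : D x y = t by apply/eqP; rewrite eq_le tD (le_trans Dn xt).
  have nt : nrm (x - p1) (y - p2) = t by apply/eqP; rewrite eq_le xt -Dt Dn.
  have tn0 : t != 0 by rewrite gt_eqF.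
  pose m1 := (x - p1) / t; pose m2 := (y - p2) / t.
  have xm : x = p1 + t * m1 by rewrite /m1 mulrC divfK// addrC subrK.
  have ym : y = p2 + t * m2 by rewrite /m2 mulrC divfK// addrC subrK.
  have mE : m1 ^+ 2 + m2 ^+ 2 = 1.
    by rewrite !expr_div_n -mulrDl -sqr_nrm nt divff// expf_neq0.
  have mn : normal p1 p2 m1 m2.
    by apply: (@normal_extend _ _ _ _ t) => //; rewrite -xm -ym.
  have := Km _ _ mn; rewrite -xm -ym !subrr normr0 orbb leNgt mulr_gt0//.
exists ((t - D x y) / 2); first by rewrite divr_gt0// subr_gt0.
move=> f g n1 n2 nn fp gp; apply: (fin f g) => // /xyP; apply/negP; rewrite -ltNge.
have := dist_lip1 (p1 + t * n1) (p2 + t * n2) (f + t * n1) (g + t * n2).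
case: nn => _ _ -> //.
have -> : f + t * n1 - (p1 + t * n1) = f - p1 by ring.
have -> : g + t * n2 - (p2 + t * n2) = g - p2 by ring.
rewrite ler_norml => /andP[_]; lra.
Qed.

(** Points outside [S] exist arbitrarily close to [p]; their feet are close to [p] as well and carry
    normals, so [normal_near] yields one at [p]. *)
Lemma normal_exists p1 p2 : S p1 p2 -> exists n1 n2, normal p1 p2 n1 n2.
Proof.
move=> Sp; have [d d0 dP] := normal_near Sp ltr01.
(* The outer point is within [e] of [p] in each coordinate, hence at distance less than [2 e] from
   [S], and its foot is within [3 e] of [p] in each coordinate. *)
pose e := Num.min d r / 4.
have m0 : 0 < Num.min d r by rewrite lt_min d0.
have e0 : 0 < e by rewrite divr_gt0.
have [x [y [xe ye nS]]] := compl_dense tube p1 p2 e0.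
have Dg := dist_gt0 nS.
have De : D x y < e + e.
  by have := dist_lip1 p1 p2 x y; rewrite (dist_on Sp) subr0 ger0_norm; lra.
have [ed er] : 4 * e <= d /\ 4 * e <= r.
  rewrite /e mulrC divfK ?pnatr_eq0//; split; rewrite ge_min lexx ?orbT//.
have Dr : 0 < D x y < r by rewrite Dg /=; lra.
have nf := normal_foot Dr; have [_ /unit_le1[u1 v1] _] := nf.
have b (u : R) : `|u| <= 1 -> `|D x y * u| <= e + e.
  move=> uu; rewrite normrM (gtr0_norm Dg) (le_trans _ (ltW De))//.
  by rewrite ler_piMr// ltW.
have [||m1 [m2 [mn _ _]]] := dP _ _ _ _ nf; last by exists m1, m2.
- have := ler_normB (x - p1) (D x y * d1 x y); have := b _ u1.
  by rewrite addrAC; lra.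
- have := ler_normB (y - p2) (D x y * d2 x y); have := b _ v1.
  by rewrite addrAC; lra.
Qed.

(** * The Hessian of the distance *)

Lemma grad_along_normal a b : 0 < D a b < r -> exists2 d : R, 0 < d & forall s, `|s| < d ->
  d1 (a + s * d1 a b) (b + s * d2 a b) = d1 a b /\
  d2 (a + s * d1 a b) (b + s * d2 a b) = d2 a b.
Proof.
move=> Dr; have [Dg Dl] := andP Dr.
exists (Num.min (D a b) (r - D a b)); first by rewrite lt_min Dg subr_gt0.
move=> s; rewrite lt_min => /andP[]; rewrite !ltr_norml => /andP[s1 s2] /andP[s3 s4].
have sr : 0 < D a b + s < r by apply/andP; split; lra.
have := normal_grad (normal_foot Dr) sr.
by rewrite !mulrDl !addrA !subrK.
Qed.

Lemma dist_near_range a b : 0 < D a b < r -> exists2 d : R, 0 < d &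
  forall x y, `|x - a| < d -> `|y - b| < d -> 0 < D x y < r.
Proof.
move=> /andP[Dg Dl]; exists (Num.min (D a b) (r - D a b) / 2).
  by rewrite divr_gt0// lt_min Dg subr_gt0.
move=> x y xa yb; have := dist_lip1 a b x y; rewrite ler_norml => /andP[h1 h2].
have : Num.min (D a b) (r - D a b) <= D a b by rewrite ge_min lexx.
have : Num.min (D a b) (r - D a b) <= r - D a b by rewrite ge_min lexx orbT.
move=> h3 h4; apply/andP; split; lra.
Qed.

Lemma grad_unit a b : 0 < D a b < r -> d1 a b ^+ 2 + d2 a b ^+ 2 = 1.
Proof. by move=> /normal_foot[]. Qed.

Definition lap a b := d11 a b + d22 a b.

(* The Hessian annihilates the normal on both sides: on one side because the
   gradient is constant along normals, on the other because it has norm 1. *)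
Lemma hess_tangent a b : 0 < D a b < r ->
  [/\ d11 a b = lap a b * d2 a b ^+ 2, d12 a b = - (lap a b * (d1 a b * d2 a b)),
      d21 a b = - (lap a b * (d1 a b * d2 a b)) & d22 a b = lap a b * d1 a b ^+ 2].
Proof.
move=> Dr; have nE := grad_unit Dr.
have g1 := grad1_diff tube Dr; have g2 := grad2_diff tube Dr.
have [d d0 dP] := grad_along_normal Dr.
have e1 : d11 a b * d1 a b + d12 a b * d2 a b = 0.
  apply: (is_derive_near_cst (is_derive_diff2_dir (d1 a b) (d2 a b) g1) d0).
  by move=> s; rewrite subr0 !mul0r !addr0 => /dP[].
have e2 : d21 a b * d1 a b + d22 a b * d2 a b = 0.
  apply: (is_derive_near_cst (is_derive_diff2_dir (d1 a b) (d2 a b) g2) d0).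
  by move=> s; rewrite subr0 !mul0r !addr0 => /dP[].
have [d' d'0 d'P] := dist_near_range Dr.
have e3 : d1 a b * d11 a b + d2 a b * d21 a b = 0.
  have h1 := is_derive_diff2_fst g1; have h2 := is_derive_diff2_fst g2.
  have h : is_derive a (1 : R) ((d1 ^~ b) ^+ 2 + (d2 ^~ b) ^+ 2)
     (2 * (d1 a b * d11 a b + d2 a b * d21 a b)).
    apply: (is_derive_eq (is_deriveD (is_deriveX 2 h1) (is_deriveX 2 h2))).
    by rewrite /GRing.scale/= !expr1 mulrDr !mulrA.
  have := is_derive_near_cst h d'0 => /(_ _)/eqP.
  rewrite mulf_eq0 pnatr_eq0 /= => h'; apply/eqP; apply: h' => x xa.
  rewrite !fctE /= nE; apply: grad_unit.
  by apply: d'P; rewrite ?subrr ?normr0.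
have e4 : d1 a b * d12 a b + d2 a b * d22 a b = 0.
  have h1 := is_derive_diff2_snd g1; have h2 := is_derive_diff2_snd g2.
  have h : is_derive b (1 : R) ((d1 a) ^+ 2 + (d2 a) ^+ 2)
     (2 * (d1 a b * d12 a b + d2 a b * d22 a b)).
    apply: (is_derive_eq (is_deriveD (is_deriveX 2 h1) (is_deriveX 2 h2))).
    by rewrite /GRing.scale/= !expr1 mulrDr !mulrA.
  have := is_derive_near_cst h d'0 => /(_ _)/eqP.
  rewrite mulf_eq0 pnatr_eq0 /= => h'; apply/eqP; apply: h' => x xa.
  rewrite !fctE /= nE; apply: grad_unit.
  by apply: d'P; rewrite ?subrr ?normr0.
rewrite /lap; move: nE e1 e2 e3 e4.
set n1 := d1 a b; set n2 := d2 a b; set A := d11 a b; set B := d12 a b.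
set C := d21 a b; set E := d22 a b => nE e1 e2 e3 e4.
have m x : x = x * (n1 ^+ 2 + n2 ^+ 2) by rewrite nE mulr1.
split.
- have : A * n1 ^+ 2 = E * n2 ^+ 2.
    transitivity (- (B * n1 * n2)); first by rewrite -[LHS]subr0 -[X in _ - X](mul0r n1) -e1; ring.
    by rewrite -[RHS]subr0 -[X in _ - X](mul0r n2) -e4; ring.
  by move=> h; rewrite {1}[A]m; lra.
- rewrite {1}[B]m.
  have : B * n2 ^+ 2 = - (A * n1 * n2).
    by rewrite -[LHS]subr0 -[X in _ - X](mul0r n2) -e1; ring.
  have : B * n1 ^+ 2 = - (E * n1 * n2).
    by rewrite -[LHS]subr0 -[X in _ - X](mul0r n1) -e4; ring.
  by move=> h1 h2; rewrite mulrDr h1 h2; ring.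
- rewrite {1}[C]m.
  have : C * n2 ^+ 2 = - (A * n1 * n2).
    by rewrite -[LHS]subr0 -[X in _ - X](mul0r n2) -e3; ring.
  have : C * n1 ^+ 2 = - (E * n1 * n2).
    by rewrite -[LHS]subr0 -[X in _ - X](mul0r n1) -e2; ring.
  by move=> h1 h2; rewrite mulrDr h1 h2; ring.
- have : A * n1 ^+ 2 = E * n2 ^+ 2.
    transitivity (- (B * n1 * n2)); first by rewrite -[LHS]subr0 -[X in _ - X](mul0r n1) -e1; ring.
    by rewrite -[RHS]subr0 -[X in _ - X](mul0r n2) -e4; ring.
  by move=> h; rewrite {1}[E]m; lra.
Qed.

(** * First-order motion of the foot, and normals on both sides *)

Lemma dot_le (u v x z y : R) : `|u| <= 1 -> `|v| <= 1 -> `|x| <= y -> `|z| <= y ->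
  `|u * x + v * z| <= 2 * y.
Proof.
move=> u1 v1 xy zy; have y0 : 0 <= y by apply: le_trans xy.
rewrite (le_trans (ler_normD _ _))// !normrM.
have : `|u| * `|x| <= 1 * y by rewrite ler_pM.
have : `|v| * `|z| <= 1 * y by rewrite ler_pM.
lra.
Qed.

Lemma slope_error (x y l e s : R) : s != 0 -> `|x - y - l * s| <= e * `|s| ->
  exists2 v, `|v| <= e & x = y + s * (l + v).
Proof.
move=> s0 h; exists ((x - y - l * s) / s); last by field.
by rewrite normrM normfV ler_pdivrMr ?normr_gt0.
Qed.

(** Along the tangent [(- d2, d1)] the distance is stationary and the normal turns at rate [lap], so
    the foot moves at rate [c]. The errors are explicit numbers bounded by [e], which allows
    substitution into the inequality of [normal_ball]. *)
Lemma foot_tangent a b (e : R) : 0 < D a b < r -> 0 < e ->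
  exists2 d : R, 0 < d & forall s : R, s != 0 -> `|s| < d ->
    let x := a - s * d2 a b in let y := b + s * d1 a b in
    let c := 1 - D a b * lap a b in
    0 < D x y < r /\ exists u1 u2 v1 v2 : R,
      [/\ [/\ `|u1| <= e, `|u2| <= e, `|v1| <= e & `|v2| <= e],
        x - D x y * d1 x y = a - D a b * d1 a b + s * (- (c * d2 a b) + u1),
        y - D x y * d2 x y = b - D a b * d2 a b + s * (c * d1 a b + u2),
        d1 x y = d1 a b + s * (- (lap a b * d2 a b) + v1) &
        d2 x y = d2 a b + s * (lap a b * d1 a b + v2)].
Proof.
move=> Dr e0; have nE := grad_unit Dr; have [n1l n2l] := unit_le1 nE.
have [H11 H12 H21 H22] := hess_tangent Dr.
have [dr dr0 drP] := dist_near_range Dr.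
set n1 := d1 a b in nE n1l n2l *; set n2 := d2 a b in nE n1l n2l *.
set t := D a b in Dr *; set q := lap a b.
have t0 : 0 < t by case/andP: Dr.
(* The error of the foot has three terms, at most [t h], [h] and, because [|s| < 1], [h (|q| + 1)];
   their sum is [C h]. *)
pose C := t + 2 + `|q|.
have C0 : 0 < C by have := normr_ge0 q; rewrite /C; lra.
pose h := Num.min 1 (e / C).
have h0 : 0 < h by rewrite lt_min ltr01 divr_gt0.
have h1 : h <= 1 by rewrite ge_min lexx.
have hC : C * h <= e.
  by rewrite mulrC -ler_pdivlMr// ge_min lexx orbT.
have he : h <= e.
  apply: le_trans hC; rewrite ler_peMl ?(ltW h0)//.
  by have := normr_ge0 q; rewrite /C; lra.
have [dD dD0 dDP] := diff2_dir (- n2) n1 (dist_diff tube Dr) h0.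
have [da da0 daP] := diff2_dir (- n2) n1 (grad1_diff tube Dr) h0.
have [db db0 dbP] := diff2_dir (- n2) n1 (grad2_diff tube Dr) h0.
clearbody h.
exists (Num.min (Num.min dD da) (Num.min db (Num.min dr 1))).
  by rewrite !lt_min dD0 da0 db0 dr0 ltr01.
move=> s s0; rewrite !lt_min => /andP[/andP[sD sa] /andP[sb /andP[sr s1]]] x y c.
have xE : a + s * - n2 = x by rewrite mulrN.
have := dDP s sD; have := daP s sa; have := dbP s sb; rewrite -/n1 -/n2 -/t !xE -/y.
rewrite H11 H12 H21 H22 -/n1 -/n2 -/q.
have -> : - (q * (n1 * n2)) * - n2 + q * n1 ^+ 2 * n1 = q * n1.
  by rewrite -[RHS]mulr1 -nE; ring.
have -> : q * n2 ^+ 2 * - n2 + - (q * (n1 * n2)) * n1 = - (q * n2).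
  by rewrite -[RHS]mulr1 -nE; ring.
have -> : n1 * - n2 + n2 * n1 = 0 by ring.
move=> /(slope_error s0)[v2 v2h E2] /(slope_error s0)[v1 v1h E1].
move=> /(slope_error s0)[w wh E0]; rewrite add0r in E0.
have Dxy : 0 < D x y < r.
  apply: drP.
    have -> : x - a = - (s * n2) by rewrite /x; ring.
    by rewrite normrN normrM (le_lt_trans _ sr)// ler_piMr.
  have -> : y - b = s * n1 by rewrite /y; ring.
  by rewrite normrM (le_lt_trans _ sr)// ler_piMr.
split=> //; rewrite E0 E1 E2.
have W (v l : R) : `|v| <= h -> `|l| <= 1 -> `|n1| <= 1 -> `|w * (s * (q * l + v))| <= h * (`|q| + 1).
  move=> vh l1 _; rewrite normrM ler_pM// normrM -[leRHS]mul1r ler_pM// ?(ltW s1)//.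
  rewrite (le_trans (ler_normD _ _))// lerD ?(le_trans vh)//.
  by rewrite normrM ler_piMr.
exists (- t * v1 - w * n1 - w * (s * (q * - n2 + v1))).
exists (- t * v2 - w * n2 - w * (s * (q * n1 + v2))), v1, v2.
split; [split| | |by []|by []].
- have := W v1 (- n2) v1h; rewrite normrN => /(_ n2l n1l) h3.
  have : `|t * v1| <= t * h by rewrite normrM (gtr0_norm t0) ler_pM2l.
  have : `|w * n1| <= h by rewrite normrM -[leRHS]mulr1 ler_pM.
  rewrite !ler_norml => /andP[i1 i2] /andP[i3 i4]; move: h3; rewrite ler_norml => /andP[i5 i6].
  rewrite /C in hC; clear -tube r0 D0 hC i1 i2 i3 i4 i5 i6.
  by apply/andP; split; lra.
- have h3 := W v2 n1 v2h n1l n1l.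
  have : `|t * v2| <= t * h by rewrite normrM (gtr0_norm t0) ler_pM2l.
  have : `|w * n2| <= h by rewrite normrM -[leRHS]mulr1 ler_pM.
  rewrite !ler_norml => /andP[i1 i2] /andP[i3 i4]; move: h3; rewrite ler_norml => /andP[i5 i6].
  rewrite /C in hC; clear -tube r0 D0 hC i1 i2 i3 i4 i5 i6.
  by apply/andP; split; lra.
- exact: le_trans he.
- exact: le_trans he.
- by rewrite /x /c; ring.
- by rewrite /y /c; ring.
Qed.

(** If [m] had a tangential component, a tangential move with the right sign would push the foot
    into the ball supported by [m]: as [c != 0], the displacement along [m] is of first order, while
    the ball allows second order only. *)
Lemma normal_dichotomy a b m1 m2 : 0 < D a b < r -> D a b * lap a b != 1 ->
  normal (a - D a b * d1 a b) (b - D a b * d2 a b) m1 m2 ->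
  (m1 = d1 a b /\ m2 = d2 a b) \/ (m1 = - d1 a b /\ m2 = - d2 a b).
Proof.
move=> Dr reg nm; have nE := grad_unit Dr; have [n1l n2l] := unit_le1 nE.
have mE : m1 ^+ 2 + m2 ^+ 2 = 1 by case: nm.
have [m1l m2l] := unit_le1 mE.
have t0 : 0 < D a b by case/andP: Dr.
have FT := foot_tangent Dr.
set n1 := d1 a b in nE n1l n2l nm FT *; set n2 := d2 a b in nE n1l n2l nm FT *.
set t := D a b in t0 Dr nm FT *.
set c := 1 - t * lap a b in FT.
have c0 : c != 0 by rewrite subr_eq0 eq_sym.
have [q0|q0] := eqVneq (c * (- n2 * m1 + n1 * m2)) 0.
  have {}q0 : - n2 * m1 + n1 * m2 = 0.
    by move/eqP: q0; rewrite mulf_eq0 (negbTE c0) /= => /eqP.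
  pose w := n1 * m1 + n2 * m2.
  have e1 : m1 = w * n1.
    by rewrite -[LHS]mulr1 -nE /w -[RHS]subr0 -[X in _ - X](mul0r n2) -q0; ring.
  have e2 : m2 = w * n2.
    by rewrite -[LHS]mulr1 -nE /w -[LHS]subr0 -[X in _ - X](mul0r n1) -q0; ring.
  clearbody w; have : w ^+ 2 = 1.
    by rewrite -[LHS]mulr1 -{1}nE mulrDr -!exprMn -e1 -e2.
  move=> /eqP; rewrite sqrf_eq1 e1 e2 => /orP[/eqP -> | /eqP ->]; [left|right].
    by rewrite !mul1r.
  by rewrite !mulN1r.
exfalso; set q := c * (- n2 * m1 + n1 * m2) in q0.
have e0 : 0 < `|q| / 8 by rewrite divr_gt0// normr_gt0.
set e := `|q| / 8 in e0.
have [d d0 dP] := FT e e0.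
pose C := (`|c| + e) ^+ 2 + 1.
have C0 : 0 < C by rewrite ltr_wpDl// sqr_ge0.
(* Length of the move; its sign will be that of [q]. The second bound makes the squared displacement
   at most [t z |q|], whereas with [e = |q| / 8] the displacement along [m], multiplied by [2 t], is
   at least [3/2 t z |q|]. *)
pose z := Num.min (d / 2) (t * `|q| / (2 * C)).
have z0 : 0 < z by rewrite lt_min !divr_gt0 ?mulr_gt0 ?normr_gt0.
have zd : z < d by rewrite gt_min ltr_pdivrMr// ltr_pMr// ltr1n.
have zC : z * (2 * C) <= t * `|q|.
  by rewrite -ler_pdivlMr ?mulr_gt0// ge_min lexx orbT.
clearbody z; pose s := Num.sg q * z.
have s0 : s != 0 by rewrite mulf_neq0 ?sgr_eq0// gt_eqF.
have sz : `|s| = z by rewrite normrM normr_sg q0 mul1r gtr0_norm.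
have sq : s * q = z * `|q| by rewrite /s mulrAC -normrEsg mulrC.
have [|Dxy [u1 [u2 [v1 [v2 [[u1e u2e _ _] E1 E2 _ _]]]]]] := dP s s0.
  by rewrite sz.
have := normal_foot Dxy; rewrite E1 E2 => -[Sf _ _].
have := normal_ball nm Sf Dr.
rewrite ![_ + s * _ - _]addrAC !subrr !add0r => hb.
have A1 : `|- (c * n2) + u1| <= `|c| + e.
  by rewrite (le_trans (ler_normD _ _))// lerD// normrN normrM ler_piMr.
have A2 : `|c * n1 + u2| <= `|c| + e.
  by rewrite (le_trans (ler_normD _ _))// lerD// normrM ler_piMr.
have B1 : (s * (- (c * n2) + u1)) ^+ 2 + (s * (c * n1 + u2)) ^+ 2 <= z ^+ 2 * (2 * C).
  have ss : s ^+ 2 = z ^+ 2 by rewrite -sz real_normK ?num_real.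
  rewrite [(s * _) ^+ 2]exprMn [(s * (c * n1 + u2)) ^+ 2]exprMn ss -mulrDr ler_wpM2l ?sqr_ge0//.
  rewrite -real_normK ?num_real// -[(c * n1 + u2) ^+ 2]real_normK ?num_real//.
  have : `|- (c * n2) + u1| ^+ 2 <= (`|c| + e) ^+ 2.
    by rewrite ler_sqr// nnegrE addr_ge0// ltW.
  have : `|c * n1 + u2| ^+ 2 <= (`|c| + e) ^+ 2.
    by rewrite ler_sqr// nnegrE addr_ge0// ltW.
  rewrite /C; lra.
have B2 : z * (`|q| - 2 * e) <=
   s * (- (c * n2) + u1) * m1 + s * (c * n1 + u2) * m2.
  have -> : s * (- (c * n2) + u1) * m1 + s * (c * n1 + u2) * m2 =
     s * q + s * (m1 * u1 + m2 * u2) by rewrite /q; ring.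
  rewrite sq mulrBr lerD2l.
  have : `|s * (m1 * u1 + m2 * u2)| <= z * (2 * e).
    by rewrite normrM sz ler_wpM2l ?(ltW z0)// dot_le.
  by rewrite ler_norml => /andP[].
have B3 : z ^+ 2 * (2 * C) <= z * (t * `|q|) by rewrite expr2 -mulrA ler_wpM2l ?(ltW z0).
have B4 : 2 * t * (z * (`|q| - 2 * e)) <= z * (t * `|q|).
  apply: le_trans B3; apply: le_trans B1; apply: le_trans hb.
  by rewrite ler_wpM2l// mulr_ge0// ltW.
have : 0 < z * t * `|q| by rewrite !mulr_gt0// normr_gt0.
rewrite /e in B4; nra.
Qed.

(** Here [w] joins two points of the level [D = t] and [N] is the variation of the gradient, so that
    [w - t N] is the displacement of the foot. A move within a level is nearly tangential, and the
    Hessian being [q] times the tangential projection, the foot moves by nearly [1 - t q] times the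
    tangential part of [w]. *)
Lemma foot_slope_le (n1 n2 t q h w1 w2 N1 N2 : R) :
  n1 ^+ 2 + n2 ^+ 2 = 1 -> 0 < t -> h <= 1 / 8 -> h * (4 * (1 + 4 * t)) <= `|1 - t * q| ->
  `|n1 * w1 + n2 * w2| <= h * (`|w1| + `|w2|) ->
  `|N1 - (q * n2 ^+ 2 * w1 + - (q * (n1 * n2)) * w2)| <= h * (`|w1| + `|w2|) ->
  `|N2 - (- (q * (n1 * n2)) * w1 + q * n1 ^+ 2 * w2)| <= h * (`|w1| + `|w2|) ->
  `|n1 * (w1 - t * N1) + n2 * (w2 - t * N2)| <=
  `|- n2 * (w1 - t * N1) + n1 * (w2 - t * N2)|.
Proof.
move=> nE t0 h8 hc B0 B1 B2; have [n1l n2l] := unit_le1 nE.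
have [W WE] : exists W, W = `|w1| + `|w2| by eexists.
rewrite -WE in B0 B1 B2.
have W0 : 0 <= W by rewrite WE addr_ge0.
have [we weE] : exists we, we = - n2 * w1 + n1 * w2 by eexists.
have [wn wnE] : exists wn, wn = n1 * w1 + n2 * w2 by eexists.
have n2l' : `|- n2| <= 1 by rewrite normrN.
have {}B2 : `|N2 - q * n1 * we| <= h * W.
  by apply: le_trans B2; rewrite weE le_eqVlt; apply/orP; left; apply/eqP; congr `|_|; ring.
have {}B1 : `|N1 - - (q * n2 * we)| <= h * W.
  by apply: le_trans B1; rewrite weE le_eqVlt; apply/orP; left; apply/eqP; congr `|_|; ring.
rewrite -wnE in B0.
(* The normal part of [w] is at most [W / 8], so the tangential part [we] controls all of [w]. *)
have Wwe : W <= 4 * `|we|.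
  have e1 : w1 = n1 * wn - n2 * we.
    by rewrite -[LHS]mulr1 -{1}nE wnE weE; ring.
  have e2 : w2 = n2 * wn + n1 * we.
    by rewrite -[LHS]mulr1 -{1}nE wnE weE; ring.
  have a1 : `|w1| <= `|wn| + `|we|.
    by rewrite e1 (le_trans (ler_normB _ _))// !normrM lerD// ler_piMl.
  have a2 : `|w2| <= `|wn| + `|we|.
    by rewrite e2 (le_trans (ler_normD _ _))// !normrM lerD// ler_piMl.
  have hW : h * W <= 1 / 8 * W by rewrite ler_wpM2r.
  have we0 := normr_ge0 we.
  clear -tube r0 D0 WE hW B0 a1 a2 we0; lra.
have E1 : `|(- n2 * (w1 - t * N1) + n1 * (w2 - t * N2)) - (1 - t * q) * we| <= 2 * t * (h * W).
  have -> : (- n2 * (w1 - t * N1) + n1 * (w2 - t * N2)) - (1 - t * q) * we =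
      - (t * (- n2 * (N1 - - (q * n2 * we)) + n1 * (N2 - q * n1 * we))).
    have -> : - n2 * (N1 - - (q * n2 * we)) + n1 * (N2 - q * n1 * we) =
      - n2 * N1 + n1 * N2 - q * we * (n1 ^+ 2 + n2 ^+ 2) by ring.
    by rewrite nE weE; ring.
  rewrite normrN normrM (gtr0_norm t0) -[leRHS]mulrA [leRHS]mulrCA ler_wpM2l ?(ltW t0)//.
  exact: dot_le.
have E2 : `|n1 * (w1 - t * N1) + n2 * (w2 - t * N2)| <= (1 + 2 * t) * (h * W).
  have -> : n1 * (w1 - t * N1) + n2 * (w2 - t * N2) =
      wn - t * (n1 * (N1 - - (q * n2 * we)) + n2 * (N2 - q * n1 * we)).
    by rewrite wnE; ring.
  rewrite (le_trans (ler_normB _ _))// mulrDl mul1r lerD//.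
  rewrite normrM (gtr0_norm t0) -[leRHS]mulrA [leRHS]mulrCA ler_wpM2l ?(ltW t0)//.
  exact: dot_le.
(* [H1] to [H3] bound the tangential part below by [(1 + 4 t) h W - 2 t h W], which is the bound in
   [E2]; hence the factor [4 (1 + 4 t)] in the hypothesis. *)
apply: (le_trans E2).
set Fe := (- n2 * (w1 - t * N1) + n1 * (w2 - t * N2)) in E1 *.
have H1 : `|1 - t * q| * `|we| - 2 * t * (h * W) <= `|Fe|.
  have := ler_normB Fe (Fe - (1 - t * q) * we).
  rewrite subKr normrM.
  clear -tube r0 D0 E1; lra.
have H2 : `|1 - t * q| * W <= `|1 - t * q| * (4 * `|we|) by rewrite ler_wpM2l.
have H3 : h * (4 * (1 + 4 * t)) * W <= `|1 - t * q| * W by rewrite ler_wpM2r.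
clear -tube r0 D0 H1 H2 H3; lra.
Qed.

(** [F] is the displacement from [p] of the foot of [p - s n + r], a point with distance [y] and
    normal [n + N]. Each coordinate of the error [r - y N] is at most [(s + y) / 8], so the
    tangential part is at most a quarter of [s + y] and the normal part at least three quarters. *)
Lemma foot_slope_gt (n1 n2 s y r1 r2 N1 N2 F1 F2 : R) :
  n1 ^+ 2 + n2 ^+ 2 = 1 -> 0 < s -> 0 < y -> `|r1| < s / 8 -> `|r2| < s / 8 ->
  `|N1| < 1 / 8 -> `|N2| < 1 / 8 ->
  F1 = - (s + y) * n1 + (r1 - y * N1) -> F2 = - (s + y) * n2 + (r2 - y * N2) ->
  `|- n2 * F1 + n1 * F2| < `|n1 * F1 + n2 * F2|.
Proof.
move=> nE s0 y0 r1s r2s N1l N2l F1E F2E; have [n1l n2l] := unit_le1 nE.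
have RB (u v : R) : `|u| < s / 8 -> `|v| < 1 / 8 -> `|u - y * v| <= (s + y) / 8.
  move=> us vl; rewrite (le_trans (ler_normB _ _))//.
  have H : `|y * v| <= y * (1 / 8).
    by rewrite normrM (gtr0_norm y0) ler_wpM2l ?(ltW y0)// ltW.
  clear -tube r0 D0 H us; lra.
have R1 := RB _ _ r1s N1l; have R2 := RB _ _ r2s N2l.
have n2l' : `|- n2| <= 1 by rewrite normrN.
have E4 : `|- n2 * F1 + n1 * F2| <= 2 * ((s + y) / 8).
  have -> : - n2 * F1 + n1 * F2 = - n2 * (r1 - y * N1) + n1 * (r2 - y * N2).
    by rewrite F1E F2E; ring.
  exact: dot_le.
have E5 : `|n1 * (r1 - y * N1) + n2 * (r2 - y * N2)| <= 2 * ((s + y) / 8) by exact: dot_le.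
have E6 : n1 * (r1 - y * N1) + n2 * (r2 - y * N2) = n1 * F1 + n2 * F2 + (s + y).
  by rewrite F1E F2E -[X in _ = _ + X]mulr1 -nE; ring.
rewrite E6 in E5; apply: (le_lt_trans E4).
have := ler_normB (n1 * F1 + n2 * F2 + (s + y)) (n1 * F1 + n2 * F2).
rewrite [X in _ <= X -> _]addrC addrAC subrr add0r [`|s + y|]gtr0_norm ?addr_gt0//.
clear -tube r0 D0 E5 s0 y0; lra.
Qed.

(* There are points outside [S] close to [p - s n]; if [n] were the only normal at
   [p], the normals at the feet of these points would be close to [n], although the
   feet are displaced from [p] mainly along [n] ([foot_slope_gt]), which the
   expansion of the gradient at [p + t n] excludes ([foot_slope_le]). *)
Lemma normal_other a b : 0 < D a b < r -> D a b * lap a b != 1 ->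
  exists m1 m2, normal (a - D a b * d1 a b) (b - D a b * d2 a b) m1 m2 /\
    ~ (m1 = d1 a b /\ m2 = d2 a b).
Proof.
move=> Dr reg; apply: contrapT => nex.
have nE := grad_unit Dr; have [n1l n2l] := unit_le1 nE.
have [H11 H12 H21 H22] := hess_tangent Dr.
have nn := normal_foot Dr.
have {}nex m1 m2 : normal (a - D a b * d1 a b) (b - D a b * d2 a b) m1 m2 ->
    m1 = d1 a b /\ m2 = d2 a b.
  by move=> nm; apply: contrapT => h; apply: nex; exists m1, m2.
have GD := dist_diff tube Dr; have G1 := grad1_diff tube Dr.
have G2 := grad2_diff tube Dr.
rewrite H11 H12 in G1; rewrite H21 H22 in G2.
set n1 := d1 a b in nE n1l n2l nn nex GD G1 G2.
set n2 := d2 a b in nE n1l n2l nn nex GD G1 G2.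
set t := D a b in Dr nn reg nex; set q := lap a b in reg G1 G2.
set p1 := a - t * n1 in nn nex; set p2 := b - t * n2 in nn nex.
have t0 : 0 < t by case/andP: Dr.
have r0' := tube_radius_gt0 tube.
pose c := `|1 - t * q|.
have c0 : 0 < c by rewrite normr_gt0 subr_eq0 eq_sym.
pose h := Num.min (1 / 8) (c / (4 * (1 + 4 * t))).
have T0 : 0 < 4 * (1 + 4 * t).
  clear -tube r0 D0 t0; lra.
have h0 : 0 < h by rewrite lt_min !divr_gt0.
have h8 : h <= 1 / 8 by rewrite ge_min lexx.
have hc : h * (4 * (1 + 4 * t)) <= c.
  by rewrite -ler_pdivlMr// ge_min lexx orbT.
clearbody h.
have [dD dD0 dDP] := GD h h0; have [da da0 daP] := G1 h h0; have [db db0 dbP] := G2 h h0.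
pose dm := Num.min dD (Num.min da db).
have dm0 : 0 < dm by rewrite !lt_min dD0 da0.
have dmP (w : R) : w < dm -> [/\ w < dD, w < da & w < db].
  by rewrite !lt_min => /andP[? /andP[]].
clearbody dm; pose e := Num.min (1 / 8) (dm / (2 * t)).
have e0 : 0 < e by rewrite lt_min !divr_gt0// mulr_gt0.
have e8 : e <= 1 / 8 by rewrite ge_min lexx.
have te : e * (2 * t) <= dm by rewrite -ler_pdivlMr ?mulr_gt0// ge_min lexx orbT.
clearbody e.
have Sp : S p1 p2 by case: nn.
have [d d0 dP] := normal_near Sp e0.
(* The outer point will have distance at most [9/4 s], so its foot is within [4 s] of [p] in each
   coordinate. This is below [d], and at most [dm / 4], which leaves room for the [dm / 2] caused by
   the turn of the normal. *)
pose s := Num.min d (Num.min dm r) / 16.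
have s0 : 0 < s by rewrite divr_gt0// lt_min d0 /= lt_min dm0.
have [sd sm sr] : [/\ s * 16 <= d, s * 16 <= dm & s * 16 <= r].
  by rewrite /s divfK ?pnatr_eq0//; split; rewrite !ge_min lexx ?orbT.
clearbody s; have s80 : 0 < s / 8 by rewrite divr_gt0.
have [q1 [q2 [h1 h2 nS]]] := compl_dense tube (p1 - s * n1) (p2 - s * n2) s80.
have Dq0 := dist_gt0 nS.
have sn1 : `|s * n1| <= s by rewrite normrM (gtr0_norm s0) ler_piMr// ltW.
have sn2 : `|s * n2| <= s by rewrite normrM (gtr0_norm s0) ler_piMr// ltW.
pose r1 := q1 - (p1 - s * n1); pose r2 := q2 - (p2 - s * n2).
have r1s : `|r1| < s / 8 by []. have r2s : `|r2| < s / 8 by [].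
have q1E : q1 = p1 - s * n1 + r1 by rewrite /r1; ring.
have q2E : q2 = p2 - s * n2 + r2 by rewrite /r2; ring.
clearbody r1 r2.
have Dqs : D q1 q2 <= s * 9 / 4.
  have := dist_lip1 p1 p2 q1 q2; rewrite (dist_on Sp) subr0 (gtr0_norm Dq0).
  have -> : q1 - p1 = r1 - s * n1 by rewrite q1E; ring.
  have -> : q2 - p2 = r2 - s * n2 by rewrite q2E; ring.
  have := ler_normB r1 (s * n1); have := ler_normB r2 (s * n2).
  clear -tube r0 D0 sn1 sn2 r1s r2s; lra.
have Dqr : 0 < D q1 q2 < r.
  rewrite Dq0 /=.
  clear -tube r0 D0 Dqs sr s0; lra.
have nf := normal_foot Dqr.
set y := D q1 q2 in Dq0 Dqs Dqr nf.
set f1 := d1 q1 q2 in nf; set f2 := d2 q1 q2 in nf.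
have fE : f1 ^+ 2 + f2 ^+ 2 = 1 by case: nf.
have [f1l f2l] := unit_le1 fE.
pose F1 := q1 - y * f1 - p1; pose F2 := q2 - y * f2 - p2.
have yf (u : R) : `|u| <= 1 -> `|y * u| <= y.
  by move=> u1; rewrite normrM (gtr0_norm Dq0) ler_piMr// ltW.
have F1s : `|F1| < s * 4.
  have -> : F1 = r1 - s * n1 - y * f1 by rewrite /F1 q1E; ring.
  have := ler_normB (r1 - s * n1) (y * f1); have := ler_normB r1 (s * n1).
  have := yf _ f1l.
  clear -tube r0 D0 r1s sn1 Dqs s0; lra.
have F2s : `|F2| < s * 4.
  have -> : F2 = r2 - s * n2 - y * f2 by rewrite /F2 q2E; ring.
  have := ler_normB (r2 - s * n2) (y * f2); have := ler_normB r2 (s * n2).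
  have := yf _ f2l.
  clear -tube r0 D0 r2s sn2 Dqs s0; lra.
have [||m1 [m2 [/nex[-> ->] N1e N2e]]] := dP _ _ _ _ nf.
- rewrite (lt_le_trans F1s)//.
  clear -tube r0 D0 sd s0; lra.
- rewrite (lt_le_trans F2s)//.
  clear -tube r0 D0 sd s0; lra.
(* The new foot is pushed out along its own normal to distance [t]: there the gradient is this
   normal and [D] has the same value as at the given point. *)
have [g1 g2] := normal_grad nf Dr.
have Dx : D (q1 - y * f1 + t * f1) (q2 - y * f2 + t * f2) = t by case: nf => _ _ ->.
pose N1 := f1 - n1; pose N2 := f2 - n2.
pose w1 := F1 + t * N1; pose w2 := F2 + t * N2.
have x1E : q1 - y * f1 + t * f1 = a + w1 by rewrite /w1 /F1 /N1 /p1; ring.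
have x2E : q2 - y * f2 + t * f2 = b + w2 by rewrite /w2 /F2 /N2 /p2; ring.
have w1m : `|w1| < dm.
  have := ler_normD F1 (t * N1); have : `|t * N1| <= t * e.
    by rewrite normrM (gtr0_norm t0) ler_wpM2l ?(ltW t0)// ltW.
  rewrite -/w1.
  clear -tube r0 D0 F1s te sm s0; lra.
have w2m : `|w2| < dm.
  have := ler_normD F2 (t * N2); have : `|t * N2| <= t * e.
    by rewrite normrM (gtr0_norm t0) ler_wpM2l ?(ltW t0)// ltW.
  rewrite -/w2.
  clear -tube r0 D0 F2s te sm s0; lra.
have [w1D w1a w1b] := dmP _ w1m; have [w2D w2a w2b] := dmP _ w2m.
have := dDP _ _ w1D w2D; have := daP _ _ w1a w2a; have := dbP _ _ w1b w2b.
rewrite -x1E -x2E Dx g1 g2 -/n1 -/n2 -/t -/N1 -/N2 subrr sub0r normrN => B2 B1 B0.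
have := foot_slope_le nE t0 h8 hc B0 B1 B2.
have -> : w1 - t * N1 = - (s + y) * n1 + (r1 - y * N1) by rewrite /w1 /F1 q1E /N1; ring.
have -> : w2 - t * N2 = - (s + y) * n2 + (r2 - y * N2) by rewrite /w2 /F2 q2E /N2; ring.
rewrite leNgt (foot_slope_gt nE s0 Dq0 r1s r2s (lt_le_trans N1e e8) (lt_le_trans N2e e8))//.
Qed.

Lemma normal_opp a b : 0 < D a b < r -> D a b * lap a b != 1 ->
  normal (a - D a b * d1 a b) (b - D a b * d2 a b) (- d1 a b) (- d2 a b).
Proof.
move=> Dr reg; have [m1 [m2 [nm nE]]] := normal_other Dr reg.
by have [//|[<- <-]] := normal_dichotomy Dr reg nm.
Qed.

(** * The gap for [D * lap], and the case where it takes the value 1 *)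

Lemma dist_lap_cont a b (e : R) : 0 < D a b < r -> 0 < e ->
  exists2 d : R, 0 < d & forall x y : R, `|x - a| < d -> `|y - b| < d ->
    `|D x y * lap x y - D a b * lap a b| < e.
Proof.
move=> Dr e0; pose q := `|lap a b| + 1; pose u := D a b + 1.
have q0 : 0 < q by rewrite ltr_wpDl.
have u0 : 0 < u by rewrite ltr_wpDl.
have e1 : 0 < Num.min 1 (e / 2 / u) by rewrite lt_min ltr01 !divr_gt0.
have [d d0 dP] := laplacian_cont tube Dr e1.
exists (Num.min d (e / 4 / q)); first by rewrite lt_min d0 !divr_gt0.
move=> x y; rewrite !lt_min => /andP[xd xe] /andP[yd ye].
have := dP x y xd yd; rewrite lt_min -/(lap x y) -/(lap a b) => /andP[k1 k2].
have -> : D x y * lap x y - D a b * lap a b =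
   (D x y - D a b) * lap x y + D a b * (lap x y - lap a b) by ring.
rewrite (le_lt_trans (ler_normD _ _))// [e]splitr ltr_leD// normrM.
  have kq : `|lap x y| <= q.
    by have := ler_normD (lap x y - lap a b) (lap a b); rewrite subrK /q; lra.
  apply: (@le_lt_trans _ _ (`|D x y - D a b| * q)); first by rewrite ler_wpM2l.
  rewrite -ltr_pdivlMr// (le_lt_trans (dist_lip1 _ _ _ _))//.
  have -> : e / 2 / q = e / 4 / q + e / 4 / q by field; rewrite gt_eqF.
  exact: ltrD.
rewrite ger0_norm//; apply: (@le_trans _ _ (u * (e / 2 / u))).
  by rewrite ler_pM// ?ltW// /u ltrDl.
by rewrite mulrC divfK ?gt_eqF.
Qed.

(* Each of two nearby foot points lies outside both balls touching [S] at the
   other one, so their difference is orthogonal to the variation of the normal up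
   to second order: [t |c q| <= c^2], with [c = 1 - t q]. *)
Lemma lap_gap a b : 0 < D a b < r -> D a b * lap a b != 1 -> D a b * lap a b <= 1 / 2.
Proof.
move=> Dr reg; have nE := grad_unit Dr; have [n1l n2l] := unit_le1 nE.
have t0 : 0 < D a b by case/andP: Dr.
set t := D a b in t0 *; set q := lap a b; set c := 1 - t * q.
suff key : t * `|c * q| <= c ^+ 2.
  (* Division by [|c|] leaves [|t q| <= |1 - t q|], that is [t q <= 1 / 2]. *)
  have c0 : 0 < `|c| by rewrite normr_gt0 subr_eq0 eq_sym.
  have : `|c| * `|t * q| <= `|c| * `|c|.
    by rewrite -expr2 real_normK ?num_real// (le_trans _ key)// !normrM (gtr0_norm t0) mulrCA.
  rewrite ler_pM2l// => h.
  have := ler_norm (t * q); have [cg|cl] := leP 0 c.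
    by move: h; rewrite (ger0_norm cg) /c; lra.
  move: h; rewrite (ltr0_norm cl) ger0_norm; last by rewrite /c in cl; lra.
  by rewrite /c; lra.
apply: (@ler_eps_scale _ _ _ (t * (2 * `|c| + 2 * `|q| + 2) + 4 * `|c| + 2)) => e' e'0.
pose e := Num.min 1 e'.
have e0 : 0 < e by rewrite lt_min ltr01.
have e1 : e <= 1 by rewrite ge_min lexx.
have ee' : e <= e' by rewrite ge_min lexx orbT.
clearbody e.
have [d d0 dP] := foot_tangent Dr e0.
(* The neighbour must satisfy [D * lap != 1] too, for its normal to be two-sided. *)
have re0 : 0 < `|t * q - 1| by rewrite normr_gt0 subr_eq0.
have [d' d'0 d'P] := dist_lap_cont Dr re0.
pose s := Num.min d d' / 2.
have m0 : 0 < Num.min d d' by rewrite lt_min d0.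
have s0 : 0 < s by rewrite divr_gt0.
have [sd sd'] : s < d /\ s < d'.
  have : s < Num.min d d' by rewrite ltr_pdivrMr// ltr_pMr// ltr1n.
  by rewrite lt_min => /andP[].
clearbody s.
have [] := dP s (lt0r_neq0 s0); first by rewrite gtr0_norm.
set x := a - s * d2 a b; set y := b + s * d1 a b.
move=> Dxy [u1 [u2 [v1 [v2 [[u1e u2e v1e v2e] E1 E2 E3 E4]]]]].
have reg' : D x y * lap x y != 1.
  apply/eqP => E; have := d'P x y; rewrite E -/t -/q [`|1 - _|]distrC ltxx.
  have -> : x - a = - (s * d2 a b) by rewrite /x; ring.
  have -> : y - b = s * d1 a b by rewrite /y; ring.
  have sl (u : R) : `|u| <= 1 -> `|s * u| < d'.
    by move=> ul; rewrite normrM (gtr0_norm s0) (le_lt_trans _ sd')// ler_piMr// ltW.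
  by rewrite normrN !sl// => /(_ isT isT).
have nx := normal_foot Dxy; have ox := normal_opp Dxy reg'.
have na := normal_foot Dr; have oa := normal_opp Dr reg.
have Sx : S (x - D x y * d1 x y) (y - D x y * d2 x y) by case: nx.
have Sa : S (a - D a b * d1 a b) (b - D a b * d2 a b) by case: na.
have b1 := normal_ball na Sx Dr; have b2 := normal_ball oa Sx Dr.
have b3 := normal_ball nx Sa Dr; have b4 := normal_ball ox Sa Dr.
move: b1 b2 b3 b4; rewrite E1 E2 E3 E4 -/t -/q -/c.
move: nE n1l n2l; set n1 := d1 a b; set n2 := d2 a b => nE n1l n2l.
have cl (z w : R) : z + w - z = w by ring.
have cr (z w : R) : z - (z + w) = - w by ring.
rewrite !cl !cr.
set A1 := - (c * n2) + u1; set A2 := c * n1 + u2.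
set B1 := - (q * n2) + v1; set B2 := q * n1 + v2.
move=> b1 b2 b3 b4.
have sg : 0 < s ^+ 2 by rewrite exprn_gt0.
(* A ball inequality at one foot is added to the one at the other foot with the matching normal: the
   terms of order [s] cancel, and those of order [s^2] remain. The two sides of [S] give the two
   signs. *)
have AB : t * `|A1 * B1 + A2 * B2| <= A1 ^+ 2 + A2 ^+ 2.
  rewrite -(ler_pM2l sg) -{1}(gtr0_norm t0) -normrM -{1}(gtr0_norm sg) -normrM ler_norml.
  clear -tube r0 D0 b1 b2 b3 b4; apply/andP; split; lra.
have n2l' : `|- n2| <= 1 by rewrite normrN.
have f1 : `|- n2 * u1 + n1 * u2| <= 2 * e by exact: dot_le.
have f2 : `|- n2 * v1 + n1 * v2| <= 2 * e by exact: dot_le.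
have f3 : `|u1 * v1 + u2 * v2| <= 2 * e.
  by apply: dot_le => //; [apply: le_trans e1 | apply: le_trans e1].
have f4 : `|u1 * u1 + u2 * u2| <= 2 * e.
  by apply: dot_le => //; [apply: le_trans e1 | apply: le_trans e1].
have AA : A1 ^+ 2 + A2 ^+ 2 = c ^+ 2 + (2 * c * (- n2 * u1 + n1 * u2) +
    (u1 * u1 + u2 * u2)).
  by rewrite -[c ^+ 2]mulr1 -{1}nE /A1 /A2; ring.
have AE : A1 * B1 + A2 * B2 = c * q + (c * (- n2 * v1 + n1 * v2) +
   q * (- n2 * u1 + n1 * u2) + (u1 * v1 + u2 * v2)).
  by rewrite -[X in _ = X + _]mulr1 -nE /A1 /A2 /B1 /B2; ring.
have g1 : `|2 * c * (- n2 * u1 + n1 * u2) + (u1 * u1 + u2 * u2)| <=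
   (4 * `|c| + 2) * e.
  rewrite (le_trans (ler_normD _ _))// [leRHS]mulrDl lerD// -mulrA !normrM ger0_norm//.
  have : `|c| * `|- n2 * u1 + n1 * u2| <= `|c| * (2 * e) by rewrite ler_wpM2l.
  clear -tube r0 D0; lra.
have g2 : `|c * (- n2 * v1 + n1 * v2) + q * (- n2 * u1 + n1 * u2) +
    (u1 * v1 + u2 * v2)| <= (2 * `|c| + 2 * `|q| + 2) * e.
  rewrite (le_trans (ler_normD _ _))// [leRHS]mulrDl lerD// (le_trans (ler_normD _ _))//.
  rewrite [leRHS]mulrDl lerD// normrM [2 * _]mulrC -mulrA ler_wpM2l//.
have g3 : t * `|c * q| - t * ((2 * `|c| + 2 * `|q| + 2) * e) <= t * `|A1 * B1 + A2 * B2|.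
  rewrite -mulrBr ler_wpM2l ?(ltW t0)// AE lerBlDr.
  move: g2; set z := c * _ + q * _ + _ => g2.
  have := ler_normB (c * q + z) z; rewrite addrK => h.
  by rewrite (le_trans h)// lerD2l.
have g4 : A1 ^+ 2 + A2 ^+ 2 <= c ^+ 2 + (4 * `|c| + 2) * e.
  by rewrite AA lerD2l (le_trans (ler_norm _)).
have g5 : (t * (2 * `|c| + 2 * `|q| + 2) + 4 * `|c| + 2) * e <=
  (t * (2 * `|c| + 2 * `|q| + 2) + 4 * `|c| + 2) * e'.
  by rewrite ler_wpM2l// !addr_ge0// ?mulr_ge0// ?(ltW t0)// !addr_ge0// mulr_ge0.
clear -tube r0 D0 g3 g4 g5 AB; lra.
Qed.

(** By [lap_gap] the continuous function [D * lap] is either 1 or at most [1 / 2], so it cannot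
    leave the value 1 gradually. *)
Lemma irregular_open a b : 0 < D a b < r -> D a b * lap a b = 1 ->
  exists2 d : R, 0 < d & forall x y : R, `|x - a| < d -> `|y - b| < d ->
    0 < D x y < r /\ D x y * lap x y = 1.
Proof.
move=> Dr E; have [d d0 dP] := dist_near_range Dr.
have h0 : 0 < 1 / 2 :> R by rewrite divr_gt0.
have [d' d'0 d'P] := dist_lap_cont Dr h0.
exists (Num.min d d'); first by rewrite lt_min d0.
move=> x y; rewrite !lt_min => /andP[xd xd'] /andP[yd yd'].
have Dxy := dP _ _ xd yd; split=> //; apply/eqP; apply: contraT => reg.
have := d'P _ _ xd' yd'; have := lap_gap Dxy reg.
by rewrite E ltr_norml => ? /andP[? ?]; lra.
Qed.

(** The differential of the foot map is [1 - D * lap] times the tangential projection and vanishes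
    here; the foot is followed along one axis, then along the other. *)
Lemma irregular_foot a b : 0 < D a b < r -> D a b * lap a b = 1 ->
  exists2 d : R, 0 < d & forall x y : R, `|x - a| < d -> `|y - b| < d ->
    [/\ 0 < D x y < r, D x y * lap x y = 1, x - D x y * d1 x y = a - D a b * d1 a b &
        y - D x y * d2 x y = b - D a b * d2 a b].
Proof.
move=> Dr E; have [d d0 dP] := irregular_open Dr E.
exists d => // x y xa yb; have [Dxy Exy] := dP _ _ xa yb; split=> //.
  transitivity (a - D a y * d1 a y).
    apply: (@cst_of_is_derive0 _ (fun z => z - D z y * d1 z y) _ d) => // z za.
    have [Dz Ez] := dP _ _ za yb.
    have h1 := is_derive_diff2_fst (dist_diff tube Dz).
    have h2 := is_derive_diff2_fst (grad1_diff tube Dz).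
    have := is_deriveB (is_derive_id z (1:R)) (is_deriveM h1 h2).
    congr is_derive; rewrite /GRing.scale/=.
    have [-> _ _ _] := hess_tangent Dz; rewrite mulrA Ez mul1r.
    by rewrite -(grad_unit Dz); ring.
  apply: (@cst_of_is_derive0 _ (fun z => a - D a z * d1 a z) _ d) => // z zb.
  have aa : `|a - a| < d by rewrite subrr normr0.
  have [Dz Ez] := dP _ _ aa zb.
  have h1 := is_derive_diff2_snd (dist_diff tube Dz).
  have h2 := is_derive_diff2_snd (grad1_diff tube Dz).
  have := is_deriveB (is_derive_cst a z (1:R)) (is_deriveM h1 h2).
  congr is_derive; rewrite /GRing.scale/=.
  have [_ -> _ _] := hess_tangent Dz.
  transitivity ((D a z * lap a z - 1) * (d1 a z * d2 a z)); first by ring.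
  by rewrite Ez subrr mul0r.
transitivity (b - D x b * d2 x b).
  apply: (@cst_of_is_derive0 _ (fun z => z - D x z * d2 x z) _ d) => // z zb.
  have [Dz Ez] := dP _ _ xa zb.
  have h1 := is_derive_diff2_snd (dist_diff tube Dz).
  have h2 := is_derive_diff2_snd (grad2_diff tube Dz).
  have := is_deriveB (is_derive_id z (1:R)) (is_deriveM h1 h2).
  congr is_derive; rewrite /GRing.scale/=.
  have [_ _ _ ->] := hess_tangent Dz; rewrite mulrA Ez mul1r.
  by rewrite -(grad_unit Dz); ring.
apply: (@cst_of_is_derive0 _ (fun z => b - D z b * d2 z b) _ d) => // z za.
have bb : `|b - b| < d by rewrite subrr normr0.
have [Dz Ez] := dP _ _ za bb.
have h1 := is_derive_diff2_fst (dist_diff tube Dz).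
have h2 := is_derive_diff2_fst (grad2_diff tube Dz).
have := is_deriveB (is_derive_cst b z (1:R)) (is_deriveM h1 h2).
congr is_derive; rewrite /GRing.scale/=.
have [_ _ -> _] := hess_tangent Dz.
transitivity ((D z b * lap z b - 1) * (d1 z b * d2 z b)); first by ring.
by rewrite Ez subrr mul0r.
Qed.

Lemma cos_sin_surj (u v : R) : u ^+ 2 + v ^+ 2 = 1 -> exists w, cos w = u /\ sin w = v.
Proof.
move=> E; have u1 : -1 <= u <= 1 by rewrite -ler_norml; case: (unit_le1 E).
have vE : Num.sqrt (1 - u ^+ 2) = `|v| by rewrite -sqrtr_sqr -E addrAC subrr add0r.
have [v0|v0] := leP 0 v.
  by exists (acos u); rewrite acosK ?sin_acos// vE ger0_norm.
by exists (- acos u); rewrite cosN sinN acosK ?sin_acos// vE ltr0_norm ?opprK.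
Qed.

(* Rotating the normal at [p] keeps it normal, by a connectedness argument on
   the circle of radius [D a b] around [p]. *)
Lemma irregular_circle a b w : 0 < D a b < r -> D a b * lap a b = 1 ->
  D (a - D a b * d1 a b + D a b * (cos w * d1 a b - sin w * d2 a b))
    (b - D a b * d2 a b + D a b * (cos w * d2 a b + sin w * d1 a b)) = D a b.
Proof.
move=> Dr E; have nE := grad_unit Dr; have [n1l n2l] := unit_le1 nE.
have Sp : S (a - D a b * d1 a b) (b - D a b * d2 a b) by case: (normal_foot Dr).
set t := D a b in Dr E Sp *; set p1 := a - _ in Sp *; set p2 := b - _ in Sp *.
set n1 := d1 a b in nE n1l n2l *; set n2 := d2 a b in nE n1l n2l *.
have t0 : 0 < t by case/andP: Dr.
pose X w := p1 + t * (cos w * n1 - sin w * n2).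
pose Y w := p2 + t * (cos w * n2 + sin w * n1).
have XY v : (X v - p1) ^+ 2 + (Y v - p2) ^+ 2 = t ^+ 2.
  rewrite /X /Y ![_ + t * _]addrC !addrK.
  transitivity (t ^+ 2 * (cos v ^+ 2 + sin v ^+ 2) * (n1 ^+ 2 + n2 ^+ 2)); first by ring.
  by rewrite cos2Dsin2 nE !mulr1.
have Xc v : {for v, continuous X}.
  apply: continuousD; first exact: cst_continuous.
  apply: continuousM; first exact: cst_continuous.
  apply: continuousB; (apply: continuousM; last exact: cst_continuous).
    exact: continuous_cos.
  exact: continuous_sin.
have Yc v : {for v, continuous Y}.
  apply: continuousD; first exact: cst_continuous.
  apply: continuousM; first exact: cst_continuous.
  apply: continuousD; (apply: continuousM; last exact: cst_continuous).
    exact: continuous_cos.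
  exact: continuous_sin.
have XYn v (e : R) : 0 < e -> exists2 d : R, 0 < d & forall z, `|z - v| < d ->
    `|X z - X v| < e /\ `|Y z - Y v| < e.
  move=> e0; have /cvgrPdist_lt/(_ e e0)[d1' /= d10 dP1] := Xc v.
  have /cvgrPdist_lt/(_ e e0)[d2' /= d20 dP2] := Yc v.
  exists (Num.min d1' d2'); first by rewrite lt_min d10.
  move=> z; rewrite lt_min distrC => /andP[z1 z2].
  rewrite (distrC (X z)) (distrC (Y z)); exact: (conj (dP1 _ z1) (dP2 _ z2)).
suff : forall v, D (X v) (Y v) = t /\ t * lap (X v) (Y v) = 1 by move=> /(_ w)[].
apply: clopen_line.
- rewrite /X /Y cos0 sin0 !mul1r !mul0r subr0 addr0 /p1 /p2 !subrK.
  by split.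
(* Openness: points near the one at angle [v] share its foot, which is [p] by uniqueness of the
   nearest point; so on the circle their distance to [S] is its radius. *)
- move=> v [Dv Ev]; have Dv' : 0 < D (X v) (Y v) < r by rewrite Dv.
  have Ev' : D (X v) (Y v) * lap (X v) (Y v) = 1 by rewrite Dv.
  have [d d0 dP] := irregular_foot Dv' Ev'.
  have [d' d'0 d'P] := XYn v d d0.
  exists d' => // z /d'P[xz yz]; have [Dz Ez F1 F2] := dP _ _ xz yz.
  have [_ G1 G2] : [/\ d1 (X v) (Y v) ^+ 2 + d2 (X v) (Y v) ^+ 2 = 1,
      X v - p1 = D (X v) (Y v) * d1 (X v) (Y v) &
      Y v - p2 = D (X v) (Y v) * d2 (X v) (Y v)].
    by apply: dist_grad => //; rewrite Dv XY.
  rewrite -G1 subKr in F1; rewrite -G2 subKr in F2.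
  have hx : X z - p1 = D (X z) (Y z) * d1 (X z) (Y z) by rewrite -F1; ring.
  have hy : Y z - p2 = D (X z) (Y z) * d2 (X z) (Y z) by rewrite -F2; ring.
  have : D (X z) (Y z) ^+ 2 = t ^+ 2.
    by rewrite -(XY z) hx hy !exprMn -mulrDr grad_unit// mulr1.
  move=> /eqP; rewrite eqrXn2// ?(ltW t0)// => /eqP h.
  by split=> //; rewrite -h.
- move=> v H; have Dv : D (X v) (Y v) = t.
    apply/eqP; rewrite -subr_eq0 -normr_le0.
    apply: (@ler_eps_scale _ _ _ 2) => e e0; rewrite add0r.
    have [d d0 dP] := XYn v e e0; have [z zv [Dz _]] := H d d0.
    have [xz yz] := dP _ zv.
    by have := dist_lip1 (X v) (Y v) (X z) (Y z); rewrite Dz distrC; lra.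
  split=> //; have Dv' : 0 < D (X v) (Y v) < r by rewrite Dv.
  rewrite -{1}Dv; apply/eqP; rewrite -subr_eq0 -normr_le0.
  apply: (@ler_eps_scale _ _ _ 1) => e e0; rewrite add0r mul1r.
  have [d' d'0 d'P] := dist_lap_cont Dv' e0.
  have [d d0 dP] := XYn v d' d'0; have [z zv [Dz Ez]] := H d d0.
  have [xz yz] := dP _ zv.
  by have := d'P _ _ xz yz; rewrite Dz Ez distrC => /ltW.
Qed.

(** A point [q] of [S] inside the circle, at distance [l > 0] from the centre, would be at distance
    [t - l] from the point of the circle in its direction, which has distance [t] to [S]. *)
Lemma irregular_isolated a b q1 q2 : 0 < D a b < r -> D a b * lap a b = 1 -> S q1 q2 ->
  let p1 := a - D a b * d1 a b in let p2 := b - D a b * d2 a b in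
  (q1 = p1 /\ q2 = p2) \/ D a b ^+ 2 <= (q1 - p1) ^+ 2 + (q2 - p2) ^+ 2.
Proof.
move=> Dr E Sq p1 p2; have nE := grad_unit Dr.
have t0 : 0 < D a b by case/andP: Dr.
have [|h] := leP (D a b ^+ 2) ((q1 - p1) ^+ 2 + (q2 - p2) ^+ 2); [by right|left].
rewrite -sqr_nrm ltr_sqr ?nnegrE ?nrm_ge0 ?(ltW t0)// in h.
have N := sqr_nrm (q1 - p1) (q2 - p2).
have [z|z] := eqVneq (nrm (q1 - p1) (q2 - p2)) 0.
  move: N; rewrite z expr0n/= => N.
  have h1 := sqr_ge0 (q1 - p1); have h2 := sqr_ge0 (q2 - p2).
  by split; apply/eqP; rewrite -subr_eq0 -sqrf_eq0; apply/eqP; lra.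
have z0 : 0 < nrm (q1 - p1) (q2 - p2) by rewrite lt_neqAle eq_sym z nrm_ge0.
set l := nrm _ _ in h z z0 N.
exfalso; pose n1 := d1 a b; pose n2 := d2 a b.
have [w [cw sw]] : exists w,
    cos w = ((q1 - p1) * n1 + (q2 - p2) * n2) / l /\
    sin w = ((q2 - p2) * n1 - (q1 - p1) * n2) / l.
  apply: cos_sin_surj; rewrite !expr_div_n -mulrDl.
  rewrite [X in X / _](_ : _ = ((q1 - p1) ^+ 2 + (q2 - p2) ^+ 2) * (n1 ^+ 2 + n2 ^+ 2)).
    by rewrite nE -N mulr1 divff// expf_neq0.
  by ring.
have := irregular_circle w Dr E; rewrite cw sw -/n1 -/n2 -/p1 -/p2.
set t := D a b in h t0 *.
have -> : ((q1 - p1) * n1 + (q2 - p2) * n2) / l * n1 -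
   ((q2 - p2) * n1 - (q1 - p1) * n2) / l * n2 = (q1 - p1) / l.
  by rewrite -[RHS]mulr1 -nE -/n1 -/n2; field.
have -> : ((q1 - p1) * n1 + (q2 - p2) * n2) / l * n2 +
   ((q2 - p2) * n1 - (q1 - p1) * n2) / l * n1 = (q2 - p2) / l.
  by rewrite -[RHS]mulr1 -nE -/n1 -/n2; field.
move=> H; have : D (p1 + t * ((q1 - p1) / l)) (p2 + t * ((q2 - p2) / l)) <= t - l.
  apply: (dist_le Sq); first by rewrite subr_ge0 ltW.
  have -> : p1 + t * ((q1 - p1) / l) - q1 = (t - l) / l * (q1 - p1) by field.
  have -> : p2 + t * ((q2 - p2) / l) - q2 = (t - l) / l * (q2 - p2) by field.
  rewrite [X in X + _]exprMn [X in _ + X]exprMn -mulrDr -N.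
  by rewrite -[leLHS]exprMn divfK.
by rewrite H; lra.
Qed.

(** * [S] as a local graph when [D * lap] is never 1 *)

Lemma is_derive_foot_fst a b : 0 < D a b < r ->
  is_derive a (1 : R) (fun x => x - D x b * d1 x b) (d2 a b ^+ 2 * (1 - D a b * lap a b)).
Proof.
move=> Dr; have h1 := is_derive_diff2_fst (dist_diff tube Dr).
have h2 := is_derive_diff2_fst (grad1_diff tube Dr).
have := is_deriveB (is_derive_id a (1:R)) (is_deriveM h1 h2).
congr is_derive; rewrite /GRing.scale/=.
have [-> _ _ _] := hess_tangent Dr.
by rewrite -{1}(grad_unit Dr); ring.
Qed.

Lemma is_derive_foot_snd a b : 0 < D a b < r ->
  is_derive a (1 : R) (fun x => b - D x b * d2 x b)
    (- (d1 a b * d2 a b * (1 - D a b * lap a b))).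
Proof.
move=> Dr; have h1 := is_derive_diff2_fst (dist_diff tube Dr).
have h2 := is_derive_diff2_fst (grad2_diff tube Dr).
have := is_deriveB (is_derive_cst b a (1:R)) (is_deriveM h1 h2).
congr is_derive; rewrite /GRing.scale/=.
have [_ _ -> _] := hess_tangent Dr.
by ring.
Qed.

Hypothesis regular : forall a b, 0 < D a b < r -> D a b * lap a b != 1.

Lemma normal_neg p1 p2 n1 n2 : normal p1 p2 n1 n2 -> normal p1 p2 (- n1) (- n2).
Proof.
move=> nn; have t0 : 0 < r / 2 < r by rewrite divr_gt0//= ltr_pdivrMr// ltr_pMr// ltr1n.
have [g1 g2] := normal_grad nn t0; have [_ _ /(_ _ t0) Dx] := nn.
have Dr : 0 < D (p1 + r / 2 * n1) (p2 + r / 2 * n2) < r by rewrite Dx.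
by have := normal_opp Dr (regular Dr); rewrite g1 g2 Dx !addrK.
Qed.

Lemma regular_slope_gt0 a b : 0 < D a b < r -> d2 a b != 0 ->
  0 < d2 a b ^+ 2 * (1 - D a b * lap a b).
Proof.
move=> Dr d20; apply: mulr_gt0; first by rewrite exprn_even_gt0.
by have := lap_gap Dr (regular Dr); lra.
Qed.

(** The feet of the points of a segment through [p + t n], parallel to the first axis, provide the
    points of the graph. If a point of [S] has the abscissa of such a foot but ordinate [v != Y],
    the two balls at the foot give [2 t |f2| <= |v - Y|], where [|f2| > |n2| / 2] by semicontinuity
    of the normals. This contradicts [|v - Y| < 2 e <= t |n2|]. *)
Lemma regular_graph p1 p2 n1 n2 : normal p1 p2 n1 n2 -> n2 != 0 ->
  exists x1 x2 d e : R, [/\ 0 < d, 0 < e,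
    x1 - D x1 x2 * d1 x1 x2 = p1 /\ x2 - D x1 x2 * d2 x1 x2 = p2,
    forall x, `|x - x1| < d -> [/\ 0 < D x x2 < r, d2 x x2 != 0,
      S (x - D x x2 * d1 x x2) (x2 - D x x2 * d2 x x2) &
      `|x2 - D x x2 * d2 x x2 - p2| < e] &
    forall x v, `|x - x1| < d -> `|v - p2| < e -> S (x - D x x2 * d1 x x2) v ->
      v = x2 - D x x2 * d2 x x2].
Proof.
move=> nn n20; have nE : n1 ^+ 2 + n2 ^+ 2 = 1 by case: nn.
have Sp : S p1 p2 by case: nn.
have [t tE] : exists t, t = r / 2 by eexists.
have tr : 0 < t < r by rewrite tE divr_gt0//= ltr_pdivrMr// ltr_pMr// ltr1n.
have t0 : 0 < t by case/andP: tr.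
have [g1 g2] := normal_grad nn tr; have [_ _ /(_ _ tr) Dx] := nn.
pose x1 := p1 + t * n1; pose x2 := p2 + t * n2; rewrite -/x1 -/x2 in g1 g2 Dx.
have f1 : x1 - D x1 x2 * d1 x1 x2 = p1 by rewrite Dx g1 addrK.
have f2 : x2 - D x1 x2 * d2 x1 x2 = p2 by rewrite Dx g2 addrK.
have Dr : 0 < D x1 x2 < r by rewrite Dx.
have h0 : 0 < `|n2| / 2 by rewrite divr_gt0// normr_gt0.
have [dn dn0 dnP] := normal_near Sp h0.
pose e := Num.min dn (t * `|n2| / 2).
have e0 : 0 < e by rewrite lt_min dn0 divr_gt0// mulr_gt0// normr_gt0.
have en : e <= dn by rewrite ge_min lexx.
have et : e <= t * `|n2| / 2 by rewrite ge_min lexx orbT.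
clearbody e; have [dG dG0 dGP] := is_derive_near_lt (is_derive_foot_fst Dr) e0.
have [dY dY0 dYP] := is_derive_near_lt (is_derive_foot_snd Dr) e0.
have [dr dr0 drP] := dist_near_range Dr.
have [db db0 dbP] := is_derive_near_lt (is_derive_diff2_fst (grad2_diff tube Dr)) h0.
exists x1, x2, (Num.min (Num.min dG dY) (Num.min dr db)), e.
have near_x x : `|x - x1| < Num.min (Num.min dG dY) (Num.min dr db) ->
   [/\ `|x - D x x2 * d1 x x2 - p1| < e, 0 < D x x2 < r, d2 x x2 != 0,
      S (x - D x x2 * d1 x x2) (x2 - D x x2 * d2 x x2) &
      `|x2 - D x x2 * d2 x x2 - p2| < e].
  rewrite !lt_min => /andP[/andP[xG xY] /andP[xr xb]].
  have Drx : 0 < D x x2 < r by apply: drP; rewrite // subrr normr0.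
  split=> //.
  - by have := dGP _ xG; rewrite f1.
  - have := dbP _ xb; rewrite g2; apply: contraTneq => ->.
    by rewrite sub0r normrN -leNgt ler_pdivrMr// ler_peMr// ler1n.
  - by case: (normal_foot Drx).
  - by have := dYP _ xY; rewrite f2.
split=> //.
- by rewrite !lt_min dG0 dY0 dr0 db0.
- by move=> x /near_x[].
- move=> x v /near_x[Ge Drx d20 SGY Ye] ve Sv.
  have [f1' [f2' nf]] := normal_exists SGY.
  have [||m1 [m2 [nm _ f2m]]] := dnP _ _ _ _ nf; [exact: lt_le_trans en..|].
  have m2E : `|m2| = `|n2|.
    have := @normal_dichotomy x1 x2 m1 m2 Dr (regular Dr).
    rewrite f1 f2 g1 g2 => /(_ nm) [[_ ->]//|[_ ->]].
    by rewrite normrN.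
  have fn : `|n2| / 2 < `|f2'|.
    have := ler_normB f2' (f2' - m2); rewrite subKr m2E.
    by clear -tube r0 D0 f2m; lra.
  apply/eqP; rewrite -subr_eq0; apply: contraT => c0.
  have b1 := normal_ball nf Sv tr; have b2 := normal_ball (normal_neg nf) Sv tr.
  set Y := x2 - _ in ve Ye c0 b1 b2.
  rewrite subrr !mul0r expr0n/= !add0r in b1 b2.
  have cp : 0 < `|v - Y| by rewrite normr_gt0.
  have : `|v - Y| * (2 * t * `|f2'|) <= `|v - Y| * `|v - Y|.
    rewrite -expr2 real_normK ?num_real// mulrCA -normrM.
    rewrite -[2 * t]gtr0_norm ?mulr_gt0// -normrM ler_norml.
    by clear -tube r0 D0 b1 b2; apply/andP; split; lra.
  rewrite ler_pM2l// => h.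
  have vY : `|v - Y| < e + e.
    have -> : v - Y = (v - p2) - (Y - p2) by ring.
    by rewrite (le_lt_trans (ler_normB _ _))// ltrD.
  have : t * `|n2| < t * (2 * `|f2'|).
    by rewrite ltr_pM2l// mulrC -ltr_pdivrMr.
  by clear -tube r0 D0 h vY et; lra.
Qed.

End Geometry.

(** * Hoelder classes on the line and in the plane *)

Section HoelderLine.
Variables (R : realType) (al : R).
Hypothesis al01 : 0 <= al <= 1.

Definition cont1 (f : R -> R) (x : R) := forall e : R, 0 < e ->
  exists2 d : R, 0 < d & forall y, `|y - x| < d -> `|f y - f x| < e.

Definition lip1 (f : R -> R) (x : R) := exists L d : R, 0 < d /\ forall y z,
  `|y - x| < d -> `|z - x| < d -> `|f y - f z| <= L * `|y - z|.

Definition hoelder1 (f : R -> R) (x : R) := exists C d : R, 0 < d /\ forall y z,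
  `|y - x| < d -> `|z - x| < d -> `|f y - f z| <= C * `|y - z| `^ al.

(** Continuity is demanded separately because the Hoelder bound does not imply it when [al = 0]. *)
Definition reg1 f x := cont1 f x /\ hoelder1 f x.

Fixpoint CH (k : nat) (J : R -> Prop) (f : R -> R) : Prop :=
  (forall x, J x -> reg1 f x) /\
  if k is k'.+1 then exists2 f' : R -> R,
    (forall x, J x -> is_derive x (1 : R) f (f' x)) & CH k' J f'
  else True.

Lemma CH_reg k J f x : CH k J f -> J x -> reg1 f x.
Proof. by case: k => [|k] [h _]; exact: h. Qed.

Lemma CHW k J f : CH k.+1 J f -> CH k J f.
Proof.
elim: k J f => [|k IH] J f /= [h [f' df [h' H]]]; split=> //.
by exists f' => //; apply: IH; split.
Qed.

Lemma CH_sub k (I J : R -> Prop) f : (forall x, I x -> J x) -> CH k J f -> CH k I f.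
Proof.
move=> IJ; elim: k f => [|k IH] f /= [h H]; split=> //; try by move=> x /IJ; exact: h.
by case: H => f' df H; exists f'; [move=> x /IJ; exact: df | exact: IH].
Qed.

Lemma cont1_bounded f x : cont1 f x -> exists M d : R, [/\ 0 < M, 0 < d &
  forall y, `|y - x| < d -> `|f y| <= M].
Proof.
move=> /(_ 1 ltr01)[d d0 dP]; exists (`|f x| + 1), d; split=> //.
move=> y /dP h; have := ler_normD (f y - f x) (f x); rewrite subrK; lra.
Qed.

Lemma lip1_reg f x : lip1 f x -> reg1 f x.
Proof.
move=> [L [d [d0 dP]]]; split.
  move=> e e0; have L0 : 0 < `|L| + 1 by rewrite ltr_wpDl.
  exists (Num.min d (e / (`|L| + 1))); first by rewrite lt_min d0 divr_gt0.
  move=> y; rewrite lt_min => /andP[yd ye].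
  rewrite (le_lt_trans (dP y x yd _)) ?subrr ?normr0//.
  rewrite ltr_pdivlMr// in ye; rewrite (le_lt_trans _ ye)// mulrC ler_wpM2l//.
  by rewrite (le_trans (ler_norm _))// lerDl.
(* Two points within [1 / 2] of [x] are less than 1 apart, and a length below 1 is at most its power
   of exponent [al <= 1]. *)
exists `|L|, (Num.min d (1 / 2)); split; first by rewrite lt_min d0 divr_gt0.
move=> y z; rewrite !lt_min => /andP[yd y1] /andP[zd z1].
rewrite (le_trans (dP y z yd zd))//.
apply: (@le_trans _ _ (`|L| * `|y - z|)); first by rewrite ler_wpM2r// ler_norm.
rewrite ler_wpM2l//; have [->|yz] := eqVneq (y - z) 0; first by rewrite normr0 powR_ge0.
apply: ger1_powR; last by case/andP: al01.
rewrite normr_gt0 yz /=.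
have -> : y - z = (y - x) - (z - x) by ring.
by rewrite (le_trans (ler_normB _ _))//; lra.
Qed.

Lemma reg1_cst c x : reg1 (fun=> c) x.
Proof.
by apply: lip1_reg; exists 0, 1; split=> // y z _ _; rewrite subrr normr0 mul0r.
Qed.

Lemma reg1_id x : reg1 id x.
Proof. by apply: lip1_reg; exists 1, 1; split=> // y z _ _; rewrite mul1r. Qed.

Lemma reg1D f g x : reg1 f x -> reg1 g x -> reg1 (fun y => f y + g y) x.
Proof.
move=> [cf [Cf [df [df0 dfP]]]] [cg [Cg [dg [dg0 dgP]]]]; split.
  move=> e e0; have e2 : 0 < e / 2 by rewrite divr_gt0.
  have [d1 d10 dP1] := cf _ e2; have [d2 d20 dP2] := cg _ e2.
  exists (Num.min d1 d2); first by rewrite lt_min d10.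
  move=> y; rewrite lt_min => /andP[/dP1 h1 /dP2 h2].
  have -> : f y + g y - (f x + g x) = (f y - f x) + (g y - g x) by ring.
  by rewrite (le_lt_trans (ler_normD _ _))//; lra.
exists (Cf + Cg), (Num.min df dg); split; first by rewrite lt_min df0.
move=> y z; rewrite !lt_min => /andP[y1 y2] /andP[z1 z2].
have -> : f y + g y - (f z + g z) = (f y - f z) + (g y - g z) by ring.
by rewrite (le_trans (ler_normD _ _))// mulrDl lerD ?dfP ?dgP.
Qed.

Lemma reg1M f g x : reg1 f x -> reg1 g x -> reg1 (fun y => f y * g y) x.
Proof.
move=> [cf [Cf [df [df0 dfP]]]] [cg [Cg [dg [dg0 dgP]]]].
have [Mf [ef [Mf0 ef0 efP]]] := cont1_bounded cf.
have [Mg [eg [Mg0 eg0 egP]]] := cont1_bounded cg.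
have E y z : `|y - x| < ef -> `|z - x| < eg ->
    `|f y * g y - f z * g z| <= Mf * `|g y - g z| + Mg * `|f y - f z|.
  move=> yx zx.
  have -> : f y * g y - f z * g z = f y * (g y - g z) + g z * (f y - f z) by ring.
  rewrite (le_trans (ler_normD _ _))// !normrM lerD// ler_wpM2r//.
    exact: efP.
  exact: egP.
split.
  move=> e e0; have eg2 : 0 < e / 2 / Mf by rewrite !divr_gt0.
  have ef2 : 0 < e / 2 / Mg by rewrite !divr_gt0.
  have [d1 d10 dP1] := cf _ ef2; have [d2 d20 dP2] := cg _ eg2.
  exists (Num.min ef (Num.min d1 d2)); first by rewrite !lt_min ef0 d10.
  move=> y; rewrite !lt_min => /andP[y1 /andP[/dP1 h1 /dP2 h2]].
  have xx : `|x - x| < eg by rewrite subrr normr0.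
  rewrite (le_lt_trans (E y x y1 xx))// [e]splitr ltrD//.
    by rewrite mulrC -ltr_pdivlMr.
  by rewrite mulrC -ltr_pdivlMr.
exists (Mf * Cg + Mg * Cf), (Num.min (Num.min ef eg) (Num.min df dg)); split.
  by rewrite !lt_min ef0 eg0 df0.
move=> y z; rewrite !lt_min => /andP[/andP[y1 y2] /andP[y3 y4]] /andP[/andP[z1 z2] /andP[z3 z4]].
rewrite (le_trans (E y z y1 z2))// mulrDl -!mulrA lerD// ler_wpM2l ?(ltW Mf0) ?(ltW Mg0)//.
  exact: dgP.
exact: dfP.
Qed.

Lemma reg1V f x : f x != 0 -> reg1 f x -> reg1 (fun y => (f y)^-1) x.
Proof.
move=> fx0 [cf [Cf [df [df0 dfP]]]].
have h0 : 0 < `|f x| / 2 by rewrite divr_gt0// normr_gt0.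
have [d d0 dP] := cf _ h0.
have big y : `|y - x| < d -> `|f x| / 2 <= `|f y|.
  by move=> /dP h; have := ler_normB (f y) (f y - f x); rewrite subKr; lra.
have nz y : `|y - x| < d -> f y != 0.
  by move=> /big h; rewrite -normr_gt0 (lt_le_trans h0).
pose K := (`|f x| / 2)^-1 * (`|f x| / 2)^-1.
have K0 : 0 < K by rewrite mulr_gt0// invr_gt0.
have E y z : `|y - x| < d -> `|z - x| < d ->
    `|(f y)^-1 - (f z)^-1| <= K * `|f y - f z|.
  move=> yx zx.
  have -> : (f y)^-1 - (f z)^-1 = - ((f y)^-1 * (f z)^-1 * (f y - f z)).
    by field; rewrite !nz.
  rewrite normrN normrM ler_wpM2r// normrM !normfV ler_pM ?invr_ge0//.
    by rewrite lef_pV2 ?posrE ?normr_gt0 ?nz// big.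
  by rewrite lef_pV2 ?posrE ?normr_gt0 ?nz// big.
split.
  move=> e e0; have eK : 0 < e / K by rewrite divr_gt0.
  have [d1 d10 dP1] := cf _ eK.
  exists (Num.min d d1); first by rewrite lt_min d0.
  move=> y; rewrite lt_min => /andP[yd /dP1 h].
  have xx : `|x - x| < d by rewrite subrr normr0.
  by rewrite (le_lt_trans (E y x yd xx))// mulrC -ltr_pdivlMr.
exists (K * Cf), (Num.min d df); split; first by rewrite lt_min d0.
move=> y z; rewrite !lt_min => /andP[y1 y2] /andP[z1 z2].
rewrite (le_trans (E y z y1 z1))// -[leRHS]mulrA ler_wpM2l ?(ltW K0)//.
exact: dfP.
Qed.

(** A Hoelder inner function would multiply the exponents; a Lipschitz one preserves [al]. *)
Lemma reg1_comp f T x : reg1 f (T x) -> lip1 T x -> reg1 (fun y => f (T y)) x.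
Proof.
move=> [cf [Cf [df [df0 dfP]]]] lT; have [cT _] := lip1_reg lT.
case: lT => L [dT [dT0 dTP]]; split.
  move=> e e0; have [d d0 dP] := cf e e0; have [d' d'0 d'P] := cT d d0.
  by exists d' => // y /d'P /dP.
have [d d0 dP] := cT _ df0.
exists (`|Cf| * `|L| `^ al), (Num.min d dT); split; first by rewrite lt_min d0.
move=> y z; rewrite !lt_min => /andP[/dP y1 y2] /andP[/dP z1 z2].
rewrite (le_trans (dfP _ _ y1 z1))//.
apply: (@le_trans _ _ (`|Cf| * `|T y - T z| `^ al)).
  by rewrite ler_wpM2r ?powR_ge0// ler_norm.
rewrite -mulrA ler_wpM2l// -powRM//; apply: ge0_ler_powR.
- by case/andP: al01.
- by rewrite nnegrE.
- by rewrite nnegrE mulr_ge0.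
- by rewrite (le_trans (dTP _ _ y2 z2))// ler_wpM2r// ler_norm.
Qed.

Lemma lip1_deriv f f' x d : 0 < d ->
  (forall y, `|y - x| < d -> is_derive y (1 : R) f (f' y)) -> cont1 f' x -> lip1 f x.
Proof.
move=> d0 df cf; have [M [e [M0 e0 eP]]] := cont1_bounded cf.
exists M, (Num.min d e); split; first by rewrite lt_min d0.
move=> y z yx zx.
have [c [cx _ ->]] : exists c, [/\ `|c - x| < Num.min d e, `|c - z| <= `|y - z| &
    f y - f z = f' c * (y - z)].
  by apply: MVT_ball => // w; rewrite lt_min => /andP[/df].
by rewrite normrM ler_wpM2r// eP//; move: cx; rewrite lt_min => /andP[].
Qed.

Lemma CH_cst k J c : CH k J (fun=> c).
Proof.
elim: k c => [|k IH] c /=; split=> //; try by move=> x _; exact: reg1_cst.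
by exists (fun=> 0) => // x _; exact: is_derive_cst.
Qed.

Lemma CH_id k J : CH k J id.
Proof.
case: k => [|k] /=; split=> //; try by move=> x _; exact: reg1_id.
by exists (fun=> 1) => [x _|]; [exact: is_derive_id|exact: CH_cst].
Qed.

Lemma CHD k J f g : CH k J f -> CH k J g -> CH k J (fun y => f y + g y).
Proof.
elim: k f g => [|k IH] f g /= [rf Hf] [rg Hg]; split=> //;
  try by move=> x Jx; apply: reg1D; auto.
case: Hf Hg => f' df Hf [g' dg Hg]; exists (fun y => f' y + g' y); last exact: IH.
by move=> x Jx; apply: is_deriveD; [exact: df|exact: dg].
Qed.

Lemma CHM k J f g : CH k J f -> CH k J g -> CH k J (fun y => f y * g y).
Proof.
elim: k f g => [|k IH] f g /= Kf Kg; have [rf Hf] := Kf; have [rg Hg] := Kg;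
  split=> //; try by move=> x Jx; apply: reg1M; auto.
have kf := CHW Kf; have kg := CHW Kg.
case: Hf Hg => f' df Hf [g' dg Hg].
exists (fun y => f y * g' y + g y * f' y).
  by move=> x Jx; apply: is_deriveM; [exact: df|exact: dg].
by apply: CHD; apply: IH.
Qed.

Lemma CHN k J f : CH k J f -> CH k J (fun y => - f y).
Proof.
move=> Kf; have := CHM (CH_cst k J (-1)) Kf.
by congr CH; apply/funext => y; rewrite mulN1r.
Qed.

Lemma CHV k J f : (forall x, J x -> f x != 0) -> CH k J f -> CH k J (fun y => (f y)^-1).
Proof.
move=> f0; elim: k => [|k IH] /= Kf; have [rf Hf] := Kf; split=> //;
  try by move=> x Jx; apply: reg1V; auto.
have Vf := IH (CHW Kf); case: Hf => f' df Hf.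
exists (fun y => - (((f y)^-1 * (f y)^-1) * f' y)); last first.
  by apply/CHN/CHM => //; exact: CHM.
move=> x Jx; have dfx := df x Jx.
have := is_deriveV (f0 x Jx) dfx.
by congr is_derive; rewrite /GRing.scale/= -exprVn expr2 mulNr.
Qed.

Lemma CH_comp k I J f T : (forall x, I x -> J (T x)) -> (forall x, I x -> lip1 T x) ->
  CH k J f -> CH k I T -> CH k I (fun y => f (T y)).
Proof.
move=> IJ lT; elim: k f => [|k IH] f /= Kf KT; have [rf Hf] := Kf; have [rT HT] := KT;
  split=> //; try by move=> x Ix; apply: reg1_comp; auto.
have kT := CHW KT; case: Hf HT => f' df Hf [T' dT HT].
exists (fun y => f' (T y) * T' y); last by apply: CHM => //; exact: IH.
by move=> x Ix; have h1 := dT _ Ix; have h2 := df _ (IJ _ Ix); exact: is_derive1_comp.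
Qed.

(** Bootstrap on [T' = 1 / G'(T)]: each order of regularity of [T], up to [k], yields the next one,
    starting from the Lipschitz bound. *)
Lemma CH_inverse k I J G' T : (forall x, I x -> J (T x)) ->
  (forall x, I x -> lip1 T x) -> CH k J G' -> (forall x, J x -> G' x != 0) ->
  (forall u, I u -> is_derive u (1 : R) T (G' (T u))^-1) -> CH k.+1 I T.
Proof.
move=> IJ lT KG G0 dT.
have H j : CH j J G' -> CH j I T -> CH j.+1 I T.
  move=> KjG KjT; split; first by move=> x Ix; exact: CH_reg KjT Ix.
  exists (fun u => (G' (T u))^-1) => //.
  by apply: (@CH_comp j I J (fun x => (G' x)^-1)) => //; exact: CHV.
have HG j : (j <= k)%N -> CH j J G'.
  move=> jk; rewrite -(subnK jk) in KG; elim: (k - j)%N KG => [//|n IHn].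
  by rewrite addSn => /CHW.
apply: (H k) => //.
suff : forall j, (j <= k)%N -> CH j I T by apply.
elim=> [|j IH] jk; first by split=> // x Ix; apply: lip1_reg; exact: lT.
by apply: (H j); [apply: HG; exact: ltnW | apply: IH; exact: ltnW].
Qed.

End HoelderLine.

(** * From the plane to coordinate lines *)

Section PlaneLine.
Variable R : realType.

Lemma pt_rev i (a b : R) : pt (rev_ord i) b a = pt i a b.
Proof.
apply/rowP => k; rewrite !mxE.
by case: (ord2P i k) => ->; rewrite eqxx ?[i == _]eq_sym neq_rev_ord2.
Qed.

Lemma enorm_pt i (x : 'rV[R]_2) : enorm x = nrm (x ord0 i) (x ord0 (rev_ord i)).
Proof.
rewrite /enorm /nrm; congr Num.sqrt; rewrite (bigD1 i)//= (bigD1 (rev_ord i)) ?neq_rev_ord2//=.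
by rewrite big1 ?addr0// => k; case: (ord2P i k) => ->; rewrite eqxx ?andbF.
Qed.

Lemma is_derive_pt i (F : 'rV[R]_2 -> R) (a b l : R) :
  is_derive (pt i a b) (delta_mx ord0 i) F l <->
  is_derive a (1 : R) (fun x => F (pt i x b)) l.
Proof.
have E : (fun h : R => h^-1 *: ((F \o shift (pt i a b)) (h *: delta_mx ord0 i) - F (pt i a b))) =
    (fun h : R => h^-1 *: (((fun x => F (pt i x b)) \o shift a) (h *: (1 : R)) - F (pt i a b))).
  apply/funext => h /=; congr (_ *: (F _ - _)).
  apply/rowP => k; rewrite !mxE eqxx /=.
  by case: (ord2P i k) => ->;
    rewrite ?eqxx ?neq_rev_ord2 /GRing.scale/= ?mulr1 ?mulr0 ?add0r.
split=> -[df dE]; apply: DeriveDef.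
- by move: df; rewrite /derivable E.
- by move: dE; rewrite /derive E.
- by move: df; rewrite /derivable E.
- by move: dE; rewrite /derive E.
Qed.

Lemma diff2_C1 (f f1 f2 : R -> R -> R) (a b d : R) : 0 < d ->
  (forall x y : R, `|x - a| < d -> `|y - b| < d ->
     is_derive x (1 : R) (f ^~ y) (f1 x y) /\ is_derive y (1 : R) (f x) (f2 x y)) ->
  (forall e : R, 0 < e -> exists2 d' : R, 0 < d' & forall x y, `|x - a| < d' ->
     `|y - b| < d' -> `|f1 x y - f1 a b| < e) ->
  (forall e : R, 0 < e -> exists2 d' : R, 0 < d' & forall x y, `|x - a| < d' ->
     `|y - b| < d' -> `|f2 x y - f2 a b| < e) ->
  diff2 f a b (f1 a b) (f2 a b).
Proof.
move=> d0 df c1 c2 e e0.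
have [d1 d10 dP1] := c1 e e0; have [d2 d20 dP2] := c2 e e0.
pose m := Num.min d (Num.min d1 d2).
have mP (w : R) : `|w| < m -> [/\ `|w| < d, `|w| < d1 & `|w| < d2].
  by rewrite !lt_min => /andP[? /andP[]].
have m0 : 0 < m by rewrite !lt_min d0 d10.
exists m => // h k hm km.
have aa : `|a - a| < m by rewrite subrr normr0.
have bb : `|b - b| < m by rewrite subrr normr0.
have ha : `|a + h - a| < m by rewrite addrAC subrr add0r.
have kb : `|b + k - b| < m by rewrite addrAC subrr add0r.
have [x [xm _ E1]] : exists c, [/\ `|c - a| < m, `|c - a| <= `|a + h - a| &
    f (a + h) (b + k) - f a (b + k) = f1 c (b + k) * (a + h - a)].
  apply: (@MVT_ball _ (f ^~ (b + k)) (f1 ^~ (b + k)) a m) => // w /mP[wd _ _].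
  by have [kd _ _] := mP _ kb; have [] := df _ _ wd kd.
have [y [ym _ E2]] : exists c, [/\ `|c - b| < m, `|c - b| <= `|b + k - b| &
    f a (b + k) - f a b = f2 a c * (b + k - b)].
  apply: (@MVT_ball _ (f a) (f2 a) b m) => // w /mP[wd _ _].
  by have [ad _ _] := mP _ aa; have [] := df _ _ ad wd.
have -> : f (a + h) (b + k) - f a b - (f1 a b * h + f2 a b * k) =
  (f1 x (b + k) - f1 a b) * h + (f2 a y - f2 a b) * k.
  have -> : f (a + h) (b + k) - f a b =
     (f (a + h) (b + k) - f a (b + k)) + (f a (b + k) - f a b) by ring.
  by rewrite E1 E2; ring.
rewrite (le_trans (ler_normD _ _))// !normrM mulrDr lerD// ler_wpM2r// ltW//.
  by apply: dP1; [case: (mP _ xm)|case: (mP _ kb)].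
by apply: dP2; [case: (mP _ aa)|case: (mP _ ym)].
Qed.

Lemma partial_pt i (k : nat) (U : set 'rV[R]_2) (f : 'rV[R]_2 -> R) s (a b : R) :
  Ck k U f -> (size s < k)%N -> U (pt i a b) ->
  is_derive a (1 : R) (fun x => partials s f (pt i x b)) (partials (i :: s) f (pt i a b)).
Proof.
by move=> [df _] sk Uab; apply/is_derive_pt; apply/derivableP/df.
Qed.

Lemma near2P (T : topologicalType) (p : T) (P : T -> T -> Prop) :
  (\forall x \near p & y \near p, P x y) <->
  exists2 A : set T, nbhs p A & forall x y, A x -> A y -> P x y.
Proof.
split=> [[[A B] [/= nA nB] AB]|[A nA AP]].
  exists (A `&` B); first exact: filterI.
  by move=> x y [Ax _] [_ By]; apply: (AB (x, y)); split.
by exists (A, A) => // -[x y] [] /=; exact: AP.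
Qed.

Lemma loc_hoelder0 (n : nat) (U : set 'rV[R]_n.+1) (f : 'rV[R]_n.+1 -> R) :
  (forall x, U x -> {for x, continuous f}) -> loc_hoelder 0 U f.
Proof.
move=> cf p Up; exists 2.
have FF : ProperFilter (nbhs p) by exact: nbhs_pfilter.
have /(@cvgrPdist_lt _ _ _ _ FF)/(_ 1 ltr01) H := cf p Up.
near=> x y; rewrite powRr0 mulr1.
have -> : f x - f y = (f p - f y) - (f p - f x) by ring.
rewrite (le_trans (ler_normB _ _))// -[leRHS](natrD _ 1 1) lerD// ltW//.
  by near: y.
by near: x.
Unshelve. all: by end_near. Qed.

(** Exponent 0 lets the smooth class reuse the Hoelder calculus, as the intersection of the classes
    C^{k,0}. *)
Lemma of_class_Smooth (n k : nat) (U : set 'rV[R]_n.+1) (f : 'rV[R]_n.+1 -> R) :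
  of_class (@Smooth R) U f -> of_class (Hoelder k 0) U f.
Proof.
move=> Cf; split=> // s sk; apply: loc_hoelder0 => x Ux.
by have [_] := Cf k; apply.
Qed.

Lemma reg1_restrict (al : R) i (k : nat) (U : set 'rV[R]_2) (f : 'rV[R]_2 -> R) s (a b : R) :
  of_class (Hoelder k al) U f -> (size s <= k)%N -> U (pt i a b) ->
  reg1 al (fun a => partials s f (pt i a b)) a.
Proof.
move=> [Cf Hf] sk Ua; split.
  have [_ /(_ s _ sk Ua)/continuous_ptP cf] := Cf.
  move=> e e0; have [d d0 dP] := cf e e0; exists d => // y yd.
  by apply: dP; rewrite // subrr normr0.
have [C /near2P[A /near_ptP[d d0 dP] AP]] := Hf s sk _ Ua.
exists C, d; split=> // y z yd zd.
have bb : `|b - b| < d by rewrite subrr normr0.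
have := AP _ _ (dP _ _ yd bb) (dP _ _ zd bb); rewrite (enorm_pt i) !mxE.
by rewrite !eqxx !neq_rev_ord2 subrr /nrm expr0n addr0 sqrtr_sqr.
Qed.

Lemma CH_restrict (al : R) i (k : nat) (U : set 'rV[R]_2) (f : 'rV[R]_2 -> R) s m (b : R) :
  of_class (Hoelder k al) U f -> (size s + m <= k)%N ->
  CH al m (fun a => U (pt i a b)) (fun a => partials s f (pt i a b)).
Proof.
move=> Hf; elim: m s => [|m IH] s sm; split=> //;
  try by move=> a Ua; apply: reg1_restrict Hf _ Ua; rewrite (leq_trans _ sm)// leq_addr.
exists (fun a => partials (i :: s) f (pt i a b)); last by apply: IH; rewrite addSnnS.
move=> a Ua; apply: (partial_pt Hf.1) => //.
by rewrite (leq_trans _ sm)// -addn1 leq_add2l.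
Qed.
End PlaneLine.

(** * Shears and their partial derivatives *)

Section Shear.
Variable R : realType.

(** All coordinate functions of the charts and of their inverses have this form, and so do their
    partial derivatives, with [c = 0]: regularity in the plane reduces to that of [g]. *)
Definition shear (i : 'I_2) (c : R) (g : R -> R) (x : 'rV[R]_2) : R :=
  c * x ord0 (rev_ord i) + g (x ord0 i).

Definition open1 (I : R -> Prop) := forall x, I x ->
  exists2 d : R, 0 < d & forall y, `|y - x| < d -> I y.

Lemma is_derive_shear1 i c g (x : 'rV[R]_2) l : is_derive (x ord0 i) (1 : R) g l ->
  is_derive x (delta_mx ord0 i) (shear i c g) l.
Proof.
move=> dg; suff : is_derive (pt i (x ord0 i) (x ord0 (rev_ord i))) (delta_mx ord0 i)
  (shear i c g) l by rewrite -ptE.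
apply/is_derive_pt.
have := is_deriveD (is_derive_cst (c * x ord0 (rev_ord i)) (x ord0 i) (1:R)) dg.
rewrite add0r; congr is_derive; apply/funext => y.
by rewrite /shear pt1 pt2.
Qed.

Lemma is_derive_shear2 i c g (x : 'rV[R]_2) :
  is_derive x (delta_mx ord0 (rev_ord i)) (shear i c g) c.
Proof.
suff : is_derive (pt (rev_ord i) (x ord0 (rev_ord i)) (x ord0 i))
  (delta_mx ord0 (rev_ord i)) (shear i c g) c by rewrite pt_rev -ptE.
apply/is_derive_pt.
have := is_deriveD (is_deriveZ c (is_derive_id (x ord0 (rev_ord i)) (1:R)))
  (is_derive_cst (g (x ord0 i)) (x ord0 (rev_ord i)) (1:R)).
rewrite addr0 /GRing.scale/= mulr1; congr is_derive; apply/funext => y.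
by rewrite /shear -pt_rev rev_ordK pt1 pt2.
Qed.

Lemma shear_continuous i c g (x : 'rV[R]_2) : cont1 g (x ord0 i) ->
  {for x, continuous (shear i c g)}.
Proof.
move=> cg; suff : {for pt i (x ord0 i) (x ord0 (rev_ord i)), continuous (shear i c g)}.
  by rewrite -ptE.
apply/continuous_ptP => e e0; have e2 : 0 < e / 2 by rewrite divr_gt0.
have [d d0 dP] := cg _ e2.
have C0 : 0 < `|c| + 1 by rewrite ltr_wpDl.
exists (Num.min d (e / 2 / (`|c| + 1))); first by rewrite lt_min d0 divr_gt0.
move=> y z; rewrite !lt_min => /andP[/dP y1 _] /andP[_ z2].
rewrite /shear !pt1 !pt2.
set u := x ord0 i in y1 *; set v := x ord0 (rev_ord i) in z2 *.
have -> : c * z + g y - (c * v + g u) = c * (z - v) + (g y - g u) by ring.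
rewrite (le_lt_trans (ler_normD _ _))// [e]splitr ler_ltD// normrM.
rewrite ltr_pdivlMr// in z2; rewrite (le_trans _ (ltW z2))// mulrC ler_wpM2l//.
by rewrite lerDl.
Qed.

Lemma shear_hoelder (al : R) i c g (U : set 'rV[R]_2) : 0 <= al <= 1 ->
  (forall x, U x -> reg1 al g (x ord0 i)) -> loc_hoelder al U (shear i c g).
Proof.
move=> al01 rg x Ux; have [_ [C [d [d0 dP]]]] := rg x Ux.
have [_ [C' [d' [d'0 d'P]]]] := reg1_id al01 (x ord0 (rev_ord i)).
exists (`|c| * `|C'| + `|C|); apply/near2P.
pose A := [set y : 'rV[R]_2 | `|y ord0 i - x ord0 i| < d /\
    `|y ord0 (rev_ord i) - x ord0 (rev_ord i)| < d'].
exists A.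
  suff : \forall y \near pt i (x ord0 i) (x ord0 (rev_ord i)), A y by rewrite -ptE.
  apply/near_ptP; exists (Num.min d d'); first by rewrite lt_min d0.
  by move=> y z; rewrite !lt_min /A/= !pt1 !pt2 => /andP[? _] /andP[_ ?].
move=> y z /= [y1 y2] [z1 z2]; rewrite (enorm_pt i) !mxE.
set a := y _ _ in y1 *; set b := y _ _ in y2 *.
set a' := z _ _ in z1 *; set b' := z _ _ in z2 *.
have E : shear i c g y - shear i c g z = c * (b - b') + (g a - g a').
  by rewrite /shear -/a -/b -/a' -/b'; ring.
have pw (u v w : R) : `|u| <= nrm v w -> `|u| `^ al <= nrm v w `^ al.
  by move=> h; apply: ge0_ler_powR; rewrite ?nnegrE ?nrm_ge0//; case/andP: al01.
have na : `|a - a'| <= nrm (a - a') (b - b').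
  by rewrite -ler_sqr ?nnegrE ?nrm_ge0// sqr_nrm real_normK ?num_real// lerDl sqr_ge0.
have nb : `|b - b'| <= nrm (a - a') (b - b').
  by rewrite -ler_sqr ?nnegrE ?nrm_ge0// sqr_nrm real_normK ?num_real// lerDr sqr_ge0.
rewrite E (le_trans (ler_normD _ _))// mulrDl lerD//.
  rewrite normrM -mulrA ler_wpM2l// (le_trans (d'P _ _ y2 z2))//.
  apply: (@le_trans _ _ (`|C'| * `|b - b'| `^ al)).
    by rewrite ler_wpM2r ?powR_ge0// ler_norm.
  by rewrite ler_wpM2l// pw.
rewrite (le_trans (dP _ _ y1 z1))//.
apply: (@le_trans _ _ (`|C| * `|a - a'| `^ al)).
  by rewrite ler_wpM2r ?powR_ge0// ler_norm.
by rewrite ler_wpM2l// pw.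
Qed.

Lemma near_strip i (I : R -> Prop) (x : 'rV[R]_2) : open1 I -> I (x ord0 i) ->
  \forall y \near x, I ((y : 'rV[R]_2) ord0 i).
Proof.
move=> oI Ix; suff : \forall y \near pt i (x ord0 i) (x ord0 (rev_ord i)), [set z : 'rV[R]_2 | I (z ord0 i)] y.
  by rewrite -ptE.
have [d d0 dP] := oI _ Ix; apply/near_ptP; exists d => // y z yx _.
by rewrite /= pt1; exact: dP.
Qed.

Lemma partials_shear (al : R) k i c (I : R -> Prop) g : 0 <= al <= 1 ->
  open1 I -> CH al k I g -> forall s, (size s <= k)%N -> exists c' g', CH al (k - size s) I g' /\
    forall x : 'rV[R]_2, I (x ord0 i) -> partials s (shear i c g) x = shear i c' g' x.
Proof.
move=> al01 oI Kg; elim=> [|j s IH] sk; first by exists c, g; rewrite subn0.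
have [c' [g' [Kg' E]]] := IH (ltnW sk).
have Eq (x : 'rV[R]_2) : I (x ord0 i) -> partials (j :: s) (shear i c g) x =
    'D_(delta_mx ord0 j) (shear i c' g') x.
  move=> Ix; apply: near_eq_derive; near=> y; apply: E.
  by near: y; exact: near_strip.
rewrite [size (j :: s)]/= subnS; have : (0 < k - size s)%N by rewrite subn_gt0.
case: (k - size s)%N Kg' => // m [rg' [g'' dg' Kg'']] _.
have [ji|ji] := ord2P i j.
  exists 0, g''; split=> // x Ix; rewrite Eq// ji.
  have [_ ->] := is_derive_shear1 c' (dg' _ Ix).
  by rewrite /shear mul0r add0r.
exists 0, (fun=> c'); split; first exact: CH_cst.
move=> x Ix; rewrite Eq// ji.
by have [_ ->] := is_derive_shear2 i c' g' x; rewrite /shear mul0r add0r.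
Unshelve. all: by end_near. Qed.

Lemma shear_of_class_Hoelder (al : R) k i c (I : R -> Prop) g (U : set 'rV[R]_2) :
  0 <= al <= 1 -> open1 I -> CH al k I g -> (forall x, U x -> I (x ord0 i)) ->
  of_class (Hoelder k al) U (shear i c g).
Proof.
move=> al01 oI Kg UI.
have nE s c' g' x : (forall x : 'rV[R]_2, I (x ord0 i) -> partials s (shear i c g) x = shear i c' g' x) ->
    U x -> \forall y \near x, shear i c' g' y = partials s (shear i c g) y.
  move=> E Ux; near=> y; apply/esym/E.
  by near: y; apply: near_strip => //; exact: UI.
split; first split.
- move=> s j x sk Ux; have [c' [g' [Kg' E]]] := partials_shear i c al01 oI Kg (ltnW sk).
  apply: near_eq_derivable (nE _ _ _ _ E Ux) _.
  have : (0 < k - size s)%N by rewrite subn_gt0.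
  case: (k - size s)%N Kg' => // m [rg' [g'' dg' Kg'']] _.
  have [->|->] := ord2P i j.
    by have [] := is_derive_shear1 c' (dg' _ (UI _ Ux)).
  by have [] := is_derive_shear2 i c' g' x.
- move=> s x sk Ux; have [c' [g' [Kg' E]]] := partials_shear i c al01 oI Kg sk.
  have cs : {for x, continuous (shear i c' g')}.
    by apply: shear_continuous; have [] := CH_reg Kg' (UI _ Ux).
  suff : partials s (shear i c g) @ x --> partials s (shear i c g) x by [].
  rewrite (E x (UI _ Ux)).
  exact: cvg_trans (near_eq_cvg (nE _ _ _ _ E Ux)) cs.
- move=> s sk x Ux; have [c' [g' [Kg' E]]] := partials_shear i c al01 oI Kg sk.
  have Hs : loc_hoelder al U (shear i c' g').
    by apply: shear_hoelder => // y Uy; exact: CH_reg Kg' (UI _ Uy).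
  have [C /near2P[A nA AP]] := Hs x Ux; exists C; apply/near2P.
  exists (A `&` [set y : 'rV[R]_2 | I (y ord0 i)]).
    by apply: filterI => //; apply: near_strip => //; exact: UI.
  by move=> y z [Ay Iy] [Az Iz]; rewrite !E//; exact: AP.
Unshelve. all: by end_near. Qed.

End Shear.

(** * Analytic functions *)

Section PolyNorm.
Variable R : realType.
Implicit Types p q : {poly R}.

(** Weighted l^1 norm of the coefficients. It dominates the supremum on [|x| <= r], is
    submultiplicative and behaves well under composition, so bounds on polynomials pass to products
    and substitutions. *)
Definition pnorm (r : R) p := \sum_(i < size p) `|p`_i| * r ^+ i.

Lemma pnorm_wide n r p : (size p <= n)%N -> pnorm r p = \sum_(i < n) `|p`_i| * r ^+ i.
Proof.
move=> pn; rewrite /pnorm (big_ord_widen n (fun i => `|p`_i| * r ^+ i))// big_mkcond /=.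
apply: eq_bigr => i _; case: ifPn => //; rewrite -leqNgt => h.
by rewrite nth_default// normr0 mul0r.
Qed.

Lemma pnorm_ge0 r p : 0 <= r -> 0 <= pnorm r p.
Proof. by move=> r0; apply: sumr_ge0 => i _; rewrite mulr_ge0// exprn_ge0. Qed.

Lemma pnorm_MXaddC r p (c : R) : pnorm r (p * 'X + c%:P) = pnorm r p * r + `|c|.
Proof.
have sz : (size (p * 'X + c%:P)%R <= (size p).+1)%N.
  rewrite (leq_trans (size_polyD _ _))// geq_max (leq_trans (size_polyC_leq1 c))// andbT.
  by have [->|p0] := eqVneq p 0; [rewrite mul0r size_poly0|rewrite size_mulX].
rewrite (pnorm_wide r sz) big_ord_recl /= coefD coefMX coefC /= add0r expr0 mulr1 addrC.
congr (_ + _); rewrite /pnorm mulr_suml; apply: eq_bigr => i _.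
by rewrite coefD coefMX coefC /= addr0 /bump /= add1n exprSr mulrA.
Qed.

Lemma pnorm0 r : pnorm r 0 = 0.
Proof. by rewrite /pnorm size_poly0 big_ord0. Qed.

Lemma pnormD r p q : 0 <= r -> pnorm r (p + q) <= pnorm r p + pnorm r q.
Proof.
move=> r0; set n := maxn (size p) (size q).
rewrite (@pnorm_wide n _ (p + q)) ?size_polyD// (@pnorm_wide n _ p) ?leq_maxl//.
rewrite (@pnorm_wide n _ q) ?leq_maxr// -big_split /=; apply: ler_sum => i _.
by rewrite -mulrDl ler_wpM2r ?exprn_ge0// coefD ler_normD.
Qed.

Lemma pnormC r (c : R) : pnorm r c%:P = `|c|.
Proof. by rewrite -[c%:P]add0r -(mul0r 'X) pnorm_MXaddC pnorm0 mul0r add0r. Qed.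

Lemma pnormX r : pnorm r 'X = r.
Proof.
by rewrite -['X]mul1r -[_ * _]addr0 -(polyC0 R) pnorm_MXaddC (pnormC _ 1) normr1 mul1r normr0 addr0.
Qed.

Lemma pnormMX r p : pnorm r (p * 'X) = pnorm r p * r.
Proof. by rewrite -[_ * 'X]addr0 -(polyC0 R) pnorm_MXaddC normr0 addr0. Qed.

Lemma pnormZ r c p : pnorm r (c *: p) = `|c| * pnorm r p.
Proof.
rewrite (@pnorm_wide (size p) _ (c *: p)) ?size_scale_leq// /pnorm mulr_sumr.
by apply: eq_bigr => i _; rewrite coefZ normrM mulrA.
Qed.

Lemma pnormM r p q : 0 <= r -> pnorm r (p * q) <= pnorm r p * pnorm r q.
Proof.
move=> r0; elim/poly_ind: p => [|p c IH]; first by rewrite mul0r pnorm0 mul0r.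
rewrite mulrDl mulrAC mul_polyC pnorm_MXaddC (le_trans (pnormD _ _ r0))//.
by rewrite pnormMX pnormZ mulrDl lerD2r mulrAC ler_wpM2r.
Qed.

Lemma pnorm_comp r p q : 0 <= r -> pnorm r (q \Po p) <= pnorm (pnorm r p) q.
Proof.
move=> r0; elim/poly_ind: q => [|q c IH]; first by rewrite comp_poly0 !pnorm0.
rewrite comp_polyD comp_polyM comp_polyX comp_polyC pnorm_MXaddC.
rewrite (le_trans (pnormD _ _ r0))// pnormC lerD2r (le_trans (pnormM _ _ r0))//.
by rewrite ler_wpM2r// pnorm_ge0.
Qed.

Lemma pnorm_mono r s p : 0 <= r -> r <= s -> pnorm r p <= pnorm s p.
Proof.
move=> r0 rs; apply: ler_sum => i _; rewrite ler_wpM2l//.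
by rewrite lerXn2r// nnegrE// (le_trans r0).
Qed.

Lemma pnorm_coef r p i : 0 <= r -> `|p`_i| * r ^+ i <= pnorm r p.
Proof.
move=> r0; have [ip|ip] := ltnP i (size p); last first.
  by rewrite nth_default// normr0 mul0r pnorm_ge0.
rewrite /pnorm (bigD1 (Ordinal ip))//= lerDl sumr_ge0// => j _.
by rewrite mulr_ge0// exprn_ge0.
Qed.

(** For [|x| <= t r] every term of degree at least [k] is smaller by a factor [t ^ k] than its share
    of the norm. *)
Lemma horner_tail r t p k (x : R) : 0 < r -> 0 <= t <= 1 -> `|x| <= t * r ->
  `|p.[x] - \sum_(i < k) p`_i * x ^+ i| <= t ^+ k * pnorm r p.
Proof.
move=> r0 /andP[t0 t1] xt; set n := maxn (size p) k.
rewrite (@horner_coef_wide _ n) ?leq_maxl//.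
rewrite [X in _ - X](big_ord_widen n (fun i => p`_i * x ^+ i)) ?leq_maxr// [X in _ - X]big_mkcond /=.
rewrite -sumrB (le_trans (ler_norm_sum _ _ _))//.
rewrite (@pnorm_wide n _ p) ?leq_maxl// mulr_sumr; apply: ler_sum => i _.
case: ifPn => [_|]; first by rewrite subrr normr0 !mulr_ge0 ?exprn_ge0// ltW.
rewrite -leqNgt subr0 normrM normrX => ki; rewrite mulrCA ler_wpM2l//.
rewrite (@le_trans _ _ ((t * r) ^+ i))// ?lerXn2r ?nnegrE ?mulr_ge0 ?(ltW r0)//.
rewrite exprMn ler_wpM2r ?exprn_ge0 ?(ltW r0)//.
by rewrite -(subnK ki) exprD ler_piMl ?exprn_ge0// exprn_ile1.
Qed.

Lemma pnorm_horner r p (x : R) : 0 < r -> `|x| <= r -> `|p.[x]| <= pnorm r p.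
Proof.
move=> r0 xr; have := @horner_tail r 1 p 0 x r0.
by rewrite ler01 lexx mul1r big_ord0 subr0 expr0 mul1r => /(_ isT xr).
Qed.

Lemma geo_half_sum (q : R) n : 0 <= q <= 1 / 2 -> \sum_(i < n) q ^+ i <= 2.
Proof.
move=> /andP[q0 q2]; apply: (@le_trans _ _ (\sum_(i < n) (1 / 2) ^+ i)).
  by apply: ler_sum => i _; rewrite lerXn2r ?nnegrE// divr_ge0.
have -> : \sum_(i < n) (1 / 2) ^+ i = 2 - 2 * (1 / 2) ^+ n :> R.
  elim: n => [|n IH]; first by rewrite big_ord0 expr0; ring.
  by rewrite big_ord_recr /= IH exprS; field.
by rewrite gerBl mulr_ge0// exprn_ge0// divr_ge0.
Qed.

End PolyNorm.

(** * Power series in one variable *)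

Section AnalyticLine.
Variable R : realType.

Lemma cvgn_epsP (u : nat -> R) (l : R) : u @ \oo --> l <->
  forall e : R, 0 < e -> exists N, forall n, (N <= n)%N -> `|u n - l| < e.
Proof.
split=> [/cvgrPdist_lt h e /h [N _ hN]|h].
  by exists N => n Nn; rewrite distrC; exact: hN.
apply/cvgrPdist_lt => e /h [N hN]; exists N => // n /= Nn.
by rewrite distrC; exact: hN.
Qed.

Lemma cvgn_close (u v : nat -> R) (l M : R) :
  (forall n, `|u n - v n| <= (1 / 2) ^+ n * M) -> v @ \oo --> l -> u @ \oo --> l.
Proof.
move=> uv vl; apply: cvg_sub0 vl; apply: norm_cvg0.
have h : `|1 / 2 : R| < 1 by rewrite ger0_norm ?divr_ge0//; lra.
apply: (@squeeze_cvgr _ _ _ _ (cst 0) (geometric M (1 / 2))).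
- by near=> n; rewrite normr_ge0 /= /geometric /= mulrC uv.
- exact: cvg_cst.
- exact: cvg_geometric h.
Unshelve. all: by end_near. Qed.

Lemma cvgn_le_bound (u : nat -> R) (l c M : R) k : u @ \oo --> l ->
  (forall n, (k <= n)%N -> `|u n - c| <= M) -> `|l - c| <= M.
Proof.
move=> /cvgn_epsP h uc; apply: (@ler_eps_scale _ _ _ 1) => e e0.
have [N hN] := h e e0; pose n := maxn N k.
have := hN n (leq_maxl _ _); have := uc n (leq_maxr _ _).
have := ler_distD (u n) l c; rewrite (distrC l (u n)); lra.
Qed.

(** Absolute convergence is encoded by the Cauchy bound [M], and partial sums are polynomials, to
    which [pnorm] and divisibility apply. *)
Definition an1 (f : R -> R) (t : R) := exists (a : nat -> R) (r M : R),
  [/\ 0 < r, forall n, `|a n| * r ^+ n <= M &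
    forall h, `|h| < r -> (\poly_(n < k) a n).[h] @[k --> \oo] --> f (t + h)].

(** On half the radius the Cauchy bound gives a geometric series of ratio at most [1 / 2], whence
    the factor 2. *)
Lemma pnorm_trunc (a : nat -> R) r M s k : 0 < r -> (forall n, `|a n| * r ^+ n <= M) ->
  0 <= s <= r / 2 -> pnorm s (\poly_(n < k) a n) <= M * 2.
Proof.
move=> r0 aM /andP[s0 s2]; rewrite (pnorm_wide _ (size_poly _ _)).
have M0 : 0 <= M by apply: le_trans (aM 0%N); rewrite mulr_ge0// exprn_ge0// ltW.
apply: (@le_trans _ _ (\sum_(i < k) M * (s / r) ^+ i)).
  apply: ler_sum => i _; rewrite coef_poly ltn_ord.
  have -> : s ^+ i = r ^+ i * (s / r) ^+ i by rewrite -exprMn mulrC divfK// gt_eqF.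
  by rewrite mulrA ler_wpM2r// exprn_ge0// divr_ge0// ltW.
rewrite -mulr_sumr ler_wpM2l// geo_half_sum//; apply/andP; split.
  by rewrite divr_ge0// ltW.
by rewrite ler_pdivrMr//; lra.
Qed.

Lemma poly_trunc_tail (a : nat -> R) r M (f t : R) k h : 0 < r ->
  (forall n, `|a n| * r ^+ n <= M) -> 0 <= t <= 1 -> `|h| <= t * (r / 2) ->
  (\poly_(n < k) a n).[h] @[k --> \oo] --> f ->
  `|f - (\poly_(n < k) a n).[h]| <= t ^+ k * (M * 2).
Proof.
move=> r0 aM t01 hr cf; apply: (cvgn_le_bound (k := k) cf) => n kn.
have r2 : 0 < r / 2 by rewrite divr_gt0.
have := @horner_tail _ (r / 2) t (\poly_(n < n) a n) k h r2 t01 hr.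
have -> : \sum_(i < k) (\poly_(n < n) a n)`_i * h ^+ i = (\poly_(n < k) a n).[h].
  rewrite (@horner_coef_wide _ k) ?size_poly//; apply: eq_bigr => i _.
  by rewrite !coef_poly ltn_ord (leq_trans (ltn_ord i) kn).
move=> /le_trans; apply; case/andP: t01 => t0 _.
by rewrite ler_wpM2l ?exprn_ge0// (pnorm_trunc _ r0)// ltW//=.
Qed.

(** Divisibility by powers of [X] expresses that coefficients become final; unlike explicit
    coefficients it passes easily through products and compositions. *)
Lemma coef_stable (P : nat -> {poly R}) : (forall k, 'X^k %| P k.+1 - P k) ->
  forall i k, (i < k)%N -> (P k)`_i = (P i.+1)`_i.
Proof.
move=> HP i k; elim: k => // k IH; rewrite ltnS leq_eqVlt => /orP[/eqP->//|ik].
rewrite -IH//; apply/eqP; rewrite -subr_eq0 -coefB.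
by have /dvdpP[q ->] := HP k; rewrite coefMXn ik.
Qed.

(* Coefficients that stabilise along a sequence of polynomials bounded in norm
   are those of a power series. *)
Lemma an1_poly_limit (P : nat -> {poly R}) f t r M : 0 < r ->
  (forall k, pnorm r (P k) <= M) -> (forall k, 'X^k %| P k.+1 - P k) ->
  (forall h, `|h| < r / 2 -> (P k).[h] @[k --> \oo] --> f (t + h)) -> an1 f t.
Proof.
move=> r0 PM Pst Pf; have r2 : 0 < r / 2 by rewrite divr_gt0.
exists (fun n => (P n.+1)`_n), (r / 2), M; split=> //.
  move=> n; apply: le_trans (PM n.+1); apply: le_trans (pnorm_coef _ n (ltW r0)).
  by rewrite ler_wpM2l// lerXn2r ?nnegrE ?ltW//; lra.
move=> h hr; apply: cvgn_close (Pf h hr) => k; rewrite distrC.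
have h2 : `|h| <= 1 / 2 * r by rewrite (le_trans (ltW hr))//; lra.
have := @horner_tail _ r (1 / 2) (P k) k h r0 _ h2.
have -> : \sum_(i < k) (P k)`_i * h ^+ i = (\poly_(n < k) (P n.+1)`_n).[h].
  rewrite (@horner_coef_wide _ k) ?size_poly//; apply: eq_bigr => i _.
  by rewrite coef_poly ltn_ord (coef_stable Pst).
move=> H; rewrite (le_trans (H _))//; first by apply/andP; split; lra.
by rewrite ler_wpM2l ?exprn_ge0 ?divr_ge0.
Qed.

Lemma an1_shrink f t : an1 f t -> forall s : R, 0 < s -> exists (a : nat -> R) (r M : R),
  [/\ 0 < r, r <= s, forall n, `|a n| * r ^+ n <= M &
    forall h, `|h| < r -> (\poly_(n < k) a n).[h] @[k --> \oo] --> f (t + h)].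
Proof.
move=> [a [r [M [r0 aM af]]]] s s0; exists a, (Num.min r s), M; split.
- by rewrite lt_min r0.
- by rewrite ge_min lexx orbT.
- have m0 : 0 < Num.min r s by rewrite lt_min r0.
  move=> n; apply: le_trans (aM n); rewrite ler_wpM2l// lerXn2r ?nnegrE ?(ltW r0) ?(ltW m0)//.
  by rewrite ge_min lexx.
- by move=> h; rewrite lt_min => /andP[/af].
Qed.

Lemma an1_ext f g t d : 0 < d -> (forall h, `|h| < d -> f (t + h) = g (t + h)) ->
  an1 f t -> an1 g t.
Proof.
move=> d0 fg /an1_shrink/(_ d d0)[a [r [M [r0 rd aM af]]]].
exists a, r, M; split=> // h hr; rewrite -fg; first exact: af.
exact: lt_le_trans rd.
Qed.

Lemma trunc_stable (a : nat -> R) k : 'X^k %| (\poly_(n < k.+1) a n) - \poly_(n < k) a n.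
Proof.
by rewrite !poly_def big_ord_recr /= addrAC subrr add0r -mul_polyC dvdp_mull.
Qed.

Lemma an1_same_radius f g t : an1 f t -> an1 g t -> exists (a b : nat -> R) (r M : R),
  [/\ 0 < r, forall n, `|a n| * r ^+ n <= M /\ `|b n| * r ^+ n <= M,
    forall h, `|h| < r -> (\poly_(n < k) a n).[h] @[k --> \oo] --> f (t + h) &
    forall h, `|h| < r -> (\poly_(n < k) b n).[h] @[k --> \oo] --> g (t + h)].
Proof.
move=> [a [r [M [r0 aM af]]]] /an1_shrink/(_ r r0)[b [s [N [s0 sr bN bg]]]].
exists a, b, s, (Num.max M N); split=> //.
  move=> n; rewrite !le_max bN orbT; split=> //; apply/orP; left.
  by apply: le_trans (aM n); rewrite ler_wpM2l// lerXn2r ?nnegrE ?(ltW r0) ?(ltW s0).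
by move=> h hs; apply: af; exact: lt_le_trans sr.
Qed.

(** The product of the truncations is not a truncation of the product series, but its coefficients
    below degree [k] are final, as [an1_poly_limit] requires. *)
Lemma an1M f g t : an1 f t -> an1 g t -> an1 (fun x => f x * g x) t.
Proof.
move=> ff /(an1_same_radius ff)[a [b [r [M [r0 abM af bg]]]]].
have r2 : 0 < r / 2 by rewrite divr_gt0.
have r2' : 0 <= r / 2 <= r / 2 by rewrite lexx ltW.
apply: (@an1_poly_limit (fun k => (\poly_(n < k) a n) * \poly_(n < k) b n) _ _ (r / 2)
  ((M * 2) * (M * 2))) => //.
- move=> k; rewrite (le_trans (pnormM _ _ (ltW r2)))// ler_pM ?pnorm_ge0 ?(ltW r2)//.
    by apply: (pnorm_trunc _ r0) => // n; case: (abM n).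
  by apply: (pnorm_trunc _ r0) => // n; case: (abM n).
- move=> k; set A := \poly_(n < k) a n; set B := \poly_(n < k) b n.
  set A' := \poly_(n < k.+1) a n; set B' := \poly_(n < k.+1) b n.
  have -> : A' * B' - A * B = (A' - A) * B' + A * (B' - B) by ring.
  by apply: dvdp_add; [apply: dvdp_mulr|apply: dvdp_mull]; exact: trunc_stable.
- move=> h hr; have hr' : `|h| < r by lra.
  under eq_fun do rewrite hornerM.
  by apply: cvgM; [exact: af|exact: bg].
Qed.

Lemma an1D f g t : an1 f t -> an1 g t -> an1 (fun x => f x + g x) t.
Proof.
move=> ff /(an1_same_radius ff)[a [b [r [M [r0 abM af bg]]]]].
have r2 : 0 < r / 2 by rewrite divr_gt0.
have r2' : 0 <= r / 2 <= r / 2 by rewrite lexx ltW.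
apply: (@an1_poly_limit (fun k => (\poly_(n < k) a n) + \poly_(n < k) b n) _ _ (r / 2)
  ((M * 2) + (M * 2))) => //.
- move=> k; rewrite (le_trans (pnormD _ _ (ltW r2)))// lerD//.
    by apply: (pnorm_trunc _ r0) => // n; case: (abM n).
  by apply: (pnorm_trunc _ r0) => // n; case: (abM n).
- move=> k; rewrite opprD addrACA.
  by apply: dvdp_add; exact: trunc_stable.
- move=> h hr; have hr' : `|h| < r by lra.
  under eq_fun do rewrite hornerD.
  by apply: cvgD; [exact: af|exact: bg].
Qed.

Lemma an1_poly (p : {poly R}) t : an1 (horner (p \Po ('X - t%:P))) t.
Proof.
apply: (@an1_poly_limit (fun k => \poly_(n < k) p`_n) _ _ 1 (pnorm 1 p)) => //.
- move=> k; rewrite (pnorm_wide _ (size_poly _ _)) (@pnorm_wide _ (size p + k) _ p) ?leq_addr//.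
  rewrite (big_ord_widen (size p + k) (fun i => `|(\poly_(n < k) p`_n)`_i| * 1 ^+ i)) ?leq_addl//.
  rewrite big_mkcond /=; apply: ler_sum => i _; rewrite coef_poly.
  by case: (i < k)%N; rewrite /= ?lexx// mulr_ge0// exprn_ge0.
- move=> k; exact: trunc_stable.
- move=> h _; rewrite horner_comp !hornerE addrAC subrr add0r.
  apply/cvgn_epsP => e e0; exists (size p) => n pn.
  rewrite (@horner_coef_wide _ n) ?size_poly// (horner_coef_wide _ pn).
  rewrite (eq_bigr (fun i : 'I_n => p`_i * h ^+ i)) ?subrr ?normr0// => i _.
  by rewrite coef_poly ltn_ord.
Qed.

Lemma an1_cst (c t : R) : an1 (fun=> c) t.
Proof.
by apply: (an1_ext ltr01) (an1_poly c%:P t) => h _; rewrite comp_polyC hornerC.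
Qed.

Lemma an1_id (t : R) : an1 id t.
Proof.
apply: (an1_ext ltr01) (an1_poly ('X + t%:P) t) => h _.
by rewrite comp_polyD comp_polyX comp_polyC subrK hornerX.
Qed.

Lemma an1N f t : an1 f t -> an1 (fun x => - f x) t.
Proof.
move=> /(an1M (an1_cst (-1) t)); apply: (an1_ext ltr01) => h _.
by rewrite mulN1r.
Qed.

End AnalyticLine.

(** * Composition with an inverse function, by power series *)

Section AnalyticInverse.
Variable R : realType.

Lemma dvdp_comp_sub (p q B : {poly R}) : p - q %| (B \Po p) - (B \Po q).
Proof.
elim/poly_ind: B => [|B c IH]; first by rewrite !comp_poly0 subrr dvdp0.
rewrite !comp_polyD !comp_polyM !comp_polyX !comp_polyC.
have -> : (B \Po p) * p + c%:P - ((B \Po q) * q + c%:P) =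
  ((B \Po p) - (B \Po q)) * p + (B \Po q) * (p - q) by ring.
by apply: dvdp_add; [exact: dvdp_mulr|exact: dvdp_mull].
Qed.

Lemma cvgn_geometric_steps (u : nat -> R) (C B : R) :
  (forall k, `|u k.+1 - u k| <= (1 / 2) ^+ k * C) -> (forall k, `|u k| <= B) ->
  exists2 l, u @ \oo --> l & `|l| <= B.
Proof.
(* Subtracting a geometric term with twice the constant makes the sequence nondecreasing without
   changing its limit. *)
move=> uC uB; pose v k := u k - (1 / 2) ^+ k * (2 * C).
have C0 : 0 <= C by have := uC 0%N; rewrite expr0 mul1r; exact: le_trans.
have /cvg_ex[l /= vl] : cvgn v.
  apply: nondecreasing_is_cvgn.
    apply/nondecreasing_seqP => k; rewrite /v exprS; have := uC k.
    by rewrite ler_norml => /andP[+ _]; set e := _ ^+ k; lra.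
  exists B => _ [k _ <-]; rewrite /v; have := uB k; rewrite ler_norml => /andP[_].
  have : 0 <= (1 / 2) ^+ k * (2 * C) by rewrite mulr_ge0 ?exprn_ge0 ?divr_ge0// mulr_ge0.
  by lra.
have ul : u @ \oo --> l.
  apply: (@cvgn_close _ u v l (2 * C)) => // k.
  by rewrite /v subKr ger0_norm// mulr_ge0 ?exprn_ge0 ?divr_ge0// mulr_ge0.
exists l => //; have := @cvgn_le_bound _ u l 0 B 0 ul.
by rewrite subr0; apply => n _; rewrite subr0.
Qed.

(** The tail of the series is uniformly small on [|h| <= r / 4], so the point may move together with
    the degree. The offset [m] is 2 for [F], whose truncation at [k + 2] matches that of its
    second-order remainder at [k]. *)
Lemma poly_trunc_cvg (a : nat -> R) r M f t (y : nat -> R) w m : 0 < r ->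
  (forall n, `|a n| * r ^+ n <= M) ->
  (forall h, `|h| < r -> (\poly_(n < k) a n).[h] @[k --> \oo] --> f (t + h)) ->
  (forall k, `|y k| <= r / 4) -> y @ \oo --> w -> cont1 f (t + w) ->
  (\poly_(n < k + m) a n).[y k] @[k --> \oo] --> f (t + w).
Proof.
move=> r0 aM af yr yw cf.
have M0 : 0 <= M by apply: le_trans (aM 0%N); rewrite mulr_ge0// exprn_ge0// ltW.
apply: (@cvgn_close _ _ (fun k => f (t + y k)) _ (M * 2)).
  move=> k; rewrite distrC.
  have hr : `|y k| < r by rewrite (le_lt_trans (yr k))//; lra.
  have hr2 : `|y k| <= 1 / 2 * (r / 2) by rewrite (le_trans (yr k))//; lra.
  have t01 : 0 <= (1 / 2 : R) <= 1 by apply/andP; split; lra.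
  rewrite (le_trans (poly_trunc_tail (k + m) r0 aM t01 hr2 (af _ hr)))//.
  rewrite ler_wpM2r ?mulr_ge0// exprD ler_piMr ?exprn_ge0 ?divr_ge0//.
  by rewrite exprn_ile1//; lra.
apply/cvgn_epsP => e /cf[d d0 dP]; have [N hN] := (cvgn_epsP _ _).1 yw d d0.
exists N => n /hN h; apply: dP.
by have -> : t + y n - (t + w) = y n - w by ring.
Qed.

Lemma an1_coef01 (a : nat -> R) r M f t : 0 < r ->
  (forall n, `|a n| * r ^+ n <= M) ->
  (forall h, `|h| < r -> (\poly_(n < k) a n).[h] @[k --> \oo] --> f (t + h)) ->
  f t = a 0%N /\ is_derive t (1 : R) f (a 1%N).
Proof.
move=> r0 aM af; have M0 : 0 <= M.
  by apply: le_trans (aM 0%N); rewrite mulr_ge0// exprn_ge0// ltW.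
have f0 : f t = a 0%N.
  have := af 0; rewrite normr0 addr0 => /(_ r0) c0.
  apply/eqP; rewrite -subr_eq0 -normr_le0.
  have := @cvgn_le_bound _ _ _ (a 0%N) 0 1 c0; apply => n n1.
  rewrite (@horner_coef_wide _ n) ?size_poly//; case: n n1 => // n _.
  rewrite big_ord_recl big1 ?coef_poly/= ?expr0 ?mulr1 ?addr0 ?subrr ?normr0//.
  by move=> i _; rewrite expr0n mulr0.
split=> //; apply/is_deriveE_eps => e e0.
pose K := M * 2 * (4 / r ^+ 2) + 1.
have K0 : 0 < K by rewrite ltr_wpDl// !mulr_ge0// invr_ge0 exprn_ge0// ltW.
exists (Num.min (r / 2) (e / K)); first by rewrite lt_min !divr_gt0.
move=> h; rewrite lt_min => /andP[hr]; rewrite ltr_pdivlMr// => he.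
have t01 : 0 <= `|h| * (2 / r) <= 1.
  rewrite mulr_ge0// ?divr_ge0 ?(ltW r0)//= mulrA ler_pdivrMr// mul1r; lra.
have ht : `|h| <= `|h| * (2 / r) * (r / 2).
  by rewrite -mulrA [X in _ * X](_ : _ = 1) ?mulr1//; field; rewrite gt_eqF.
have hr' : `|h| < r by lra.
have := poly_trunc_tail 2 r0 aM t01 ht (af _ hr').
rewrite (@horner_coef_wide _ 2) ?size_poly// big_ord_recl big_ord1 /= !coef_poly/=.
rewrite expr0 mulr1 expr1 /bump/= -f0 opprD addrA => /le_trans; apply.
rewrite [e * _]mulrC; apply: (@le_trans _ _ (`|h| * (`|h| * K))); last first.
  by rewrite ler_wpM2l// ltW.
have -> : (`|h| * (2 / r)) ^+ 2 * (M * 2) = `|h| * (`|h| * (M * 2 * (4 / r ^+ 2))).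
  by field; rewrite gt_eqF.
by rewrite !ler_wpM2l// lerDl.
Qed.

(* With [F (t + y) = F t + l (y - y^2 C(y))], the inverse function solves
   [y = v / l + y^2 C(y)]: it is the limit of polynomials [P k], which are bounded
   in a weighted l^1 norm of the coefficients. *)
Lemma an1_param F Y t l g d : an1 F t -> an1 Y t -> 0 < d ->
  (forall h, `|h| < d -> cont1 F (t + h) /\ cont1 Y (t + h)) ->
  is_derive t (1 : R) F l -> l != 0 ->
  (forall h, `|h| < d -> g (F (t + h)) = Y (t + h)) -> an1 g (F t).
Proof.
move=> /an1_same_radius aF /aF{aF}[a [b [r [M [r0 abM af bY]]]]] d0 cFY dF l0 gFY.
have aM n : `|a n| * r ^+ n <= M by case: (abM n).
have bM n : `|b n| * r ^+ n <= M by case: (abM n).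
have M0 : 0 <= M by apply: le_trans (aM 0%N); rewrite mulr_ge0// exprn_ge0// ltW.
have [F0 dFa] := an1_coef01 r0 aM af.
have la : a 1%N = l by have [_ <-] := dFa; have [_ <-] := dF.
pose c n := - (a n.+2 / l).
pose M' := M / (`|l| * r ^+ 2).
have ln0 : 0 < `|l| by rewrite normr_gt0.
have cM n : `|c n| * r ^+ n <= M'.
  rewrite normrN normrM normfV /M' ler_pdivlMr ?mulr_gt0 ?exprn_gt0//.
  rewrite [leLHS](_ : _ = `|a n.+2| * r ^+ n.+2) ?aM// !exprS expr0 mulr1.
  by field; rewrite gt_eqF.
have M'0 : 0 <= M' by apply: le_trans (cM 0%N); rewrite mulr_ge0// exprn_ge0// ltW.
(* The iteration must preserve the ball of radius [s] for the norm of weight [q]: [X / l]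
   contributes [s / 2] since [q = s |l| / 2], and the quadratic term contributes at most
   [2 M' s^2 <= s / 2]. The bounds [r / 4] and [d / 2] keep the values within reach of the series
   and of the hypotheses. *)
pose s := Num.min (Num.min (r / 4) (d / 2)) (1 / (4 * M' + 1)).
have M41 : 0 < 4 * M' + 1 by lra.
have s0 : 0 < s by rewrite !lt_min !divr_gt0.
have [sr sd sM] : [/\ s <= r / 4, s <= d / 2 & s * (4 * M' + 1) <= 1].
  by rewrite -ler_pdivlMr// /s !ge_min !lexx /= ?orbT.
clearbody s; pose q := s * `|l| / 2.
have q0 : 0 < q by rewrite divr_gt0// mulr_gt0.
pose C k := \poly_(n < k) c n.
(* Fixed-point iteration for [y = X / l + C(y) y^2], with [C] truncated in step, so that each
   iterate is a polynomial. *)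
pose P := fix P k := if k is k'.+1 then l^-1 *: 'X + (C k' \Po P k') * P k' ^+ 2 else 0 : {poly R}.
have PS k : P k.+1 = l^-1 *: 'X + (C k \Po P k) * P k ^+ 2 by [].
have s01 : 0 <= s <= r / 2 by apply/andP; split; lra.
have Ps k : pnorm q (P k) <= s.
  elim: k => [|k IH]; first by rewrite pnorm0 ltW.
  rewrite PS (le_trans (pnormD _ _ (ltW q0)))// pnormZ pnormX normfV.
  have -> : `|l|^-1 * q = s / 2 by rewrite /q; field; rewrite gt_eqF.
  have n0 := pnorm_ge0 (P k) (ltW q0).
  have h1 : pnorm q (C k \Po P k) <= M' * 2.
    rewrite (le_trans (pnorm_comp _ _ (ltW q0)))// (le_trans (pnorm_mono _ n0 IH))//.
    exact: (pnorm_trunc _ r0).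
  have h2 : pnorm q (P k ^+ 2) <= s * s.
    by rewrite expr2 (le_trans (pnormM _ _ (ltW q0)))// ler_pM.
  have h3 : pnorm q ((C k \Po P k) * P k ^+ 2) <= M' * 2 * (s * s).
    by rewrite (le_trans (pnormM _ _ (ltW q0)))// ler_pM// pnorm_ge0// ltW.
  have : s * (s * (4 * M' + 1)) <= s * 1 by rewrite ler_wpM2l// ltW.
  have : 0 <= s * s by rewrite mulr_ge0// ltW.
  clear -h3; lra.
have XP k : 'X %| P k.
  elim: k => [|k IH]; first exact: dvdp0.
  rewrite PS; apply: dvdp_add; first by rewrite -mul_polyC dvdp_mull.
  by apply: dvdp_mull; rewrite expr2; exact: dvdp_mulr.
have stC k p : 'X %| p -> 'X^k %| (C k.+1 \Po p) - (C k \Po p).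
  move=> Xp; rewrite -comp_polyB /C !poly_def big_ord_recr /= addrAC subrr add0r.
  by rewrite comp_polyZ comp_Xn_poly -mul_polyC; apply: dvdp_mull; exact: dvdp_exp2r.
(* Since the iterates vanish at 0, the factor [y^2] gains one order of agreement at each step. *)
have stP k : 'X^(k.+1) %| P k.+1 - P k.
  elim: k => [|k IH].
    by rewrite PS /= expr0n/= mulr0 addr0 subr0 -mul_polyC dvdp_mull.
  rewrite (PS k.+1) (PS k).
  set p' := P k.+1 in IH *; set p := P k in IH *.
  have -> : l^-1 *: 'X + (C k.+1 \Po p') * p' ^+ 2 - (l^-1 *: 'X + (C k \Po p) * p ^+ 2) =
    ((C k.+1 \Po p') - (C k \Po p')) * p' ^+ 2 +
    (((C k \Po p') - (C k \Po p)) * p' * p' + (C k \Po p) * ((p' - p) * (p' + p))) by ring.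
  have Xp' : 'X %| p' := XP k.+1. have Xp : 'X %| p := XP k.
  apply: dvdp_add; last apply: dvdp_add.
  - have -> : 'X^(k.+2) = 'X^k * 'X^2 :> {poly R} by rewrite -exprD addn2.
    by apply: dvdp_mul; [exact: stC|exact: dvdp_exp2r].
  - apply: dvdp_mulr; rewrite exprSr; apply: dvdp_mul => //.
    exact: dvdp_trans IH (dvdp_comp_sub _ _ _).
  - apply: dvdp_mull; rewrite exprSr; apply: dvdp_mul => //.
    exact: dvdp_add.
have stP' k : 'X^k %| P k.+1 - P k.
  by apply: dvdp_trans (stP k); rewrite dvdp_Pexp2l ?size_polyX.
have stB k : 'X^k %| (\poly_(n < k.+1) b n \Po P k.+1) - (\poly_(n < k) b n \Po P k).
  set B := \poly_(n < k) b n; set B' := \poly_(n < k.+1) b n.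
  have -> : (B' \Po P k.+1) - (B \Po P k) = ((B' \Po P k.+1) - (B \Po P k.+1)) +
     ((B \Po P k.+1) - (B \Po P k)) by ring.
  apply: dvdp_add; last exact: dvdp_trans (stP' k) (dvdp_comp_sub _ _ _).
  rewrite -comp_polyB /B /B' !poly_def big_ord_recr /= addrAC subrr add0r.
  rewrite comp_polyZ comp_Xn_poly -mul_polyC; apply: dvdp_mull.
  by apply: dvdp_exp2r; exact: (XP k.+1).
apply: (@an1_poly_limit _ (fun k => \poly_(n < k) b n \Po P k) _ _ q (M * 2)) => //.
  move=> k; rewrite (le_trans (pnorm_comp _ _ (ltW q0)))//.
  by rewrite (le_trans (pnorm_mono _ (pnorm_ge0 _ (ltW q0)) (Ps k)))// (pnorm_trunc _ r0).
move=> v vq; have vq' : `|v| <= q by lra.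
have yB k : `|(P k).[v]| <= s by rewrite (le_trans (pnorm_horner _ q0 vq')).
have [w yw ws] : exists2 w, (fun k => (P k).[v]) @ \oo --> w & `|w| <= s.
  apply: (@cvgn_geometric_steps _ (s + s)) => // k.
  have h2 : `|v| <= 1 / 2 * q by rewrite (le_trans (ltW vq))//; lra.
  have t01 : 0 <= (1 / 2 : R) <= 1 by apply/andP; split; lra.
  have := horner_tail (P k.+1 - P k) k q0 t01 h2.
  rewrite big1 ?subr0 => [|i _]; last first.
    by have /dvdpP[z ->] := stP' k; rewrite coefMXn ltn_ord mul0r.
  rewrite hornerD hornerN => /le_trans; apply.
  rewrite ler_wpM2l ?exprn_ge0 ?divr_ge0// (le_trans (pnormD _ _ (ltW q0)))//.
  by rewrite lerD// -scaleN1r pnormZ normrN normr1 mul1r.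
have wd : `|w| < d by rewrite (le_lt_trans ws)//; lra.
have yr k : `|(P k).[v]| <= r / 4 by rewrite (le_trans (yB k)).
have [cF cY] := cFY w wd.
have Fw : F (t + w) = F t + v.
  have cv := @poly_trunc_cvg a r M F t _ w 2 r0 aM af yr yw cF.
  apply/esym/(cvg_unique _ _ cv) => //.
  (* The truncated [F] is [F t + l (y - y^2 C(y))], and by the recursion its value at [y = P k]
     misses [F t + v] by [l (P k - P k.+1)], which tends to 0. *)
  have E k : (\poly_(n < k + 2) a n).[(P k).[v]] = F t + v + l * ((P k).[v] - (P k.+1).[v]).
    have -> : \poly_(n < k + 2) a n = (a 0%N)%:P + l *: 'X - l *: (C k * 'X^2).
      apply/polyP => i; rewrite coef_poly addn2 !coefD coefN !coefZ coefC coefX coefMXn.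
      case: i => [|[|i]] /=; rewrite ?mulr0 ?mulr1 ?add0r ?addr0 ?subr0//.
      rewrite coef_poly !ltnS -addn2 addnK; case: ifP => _; last by rewrite mulr0 oppr0.
      by rewrite addn2 /c mulrN opprK mulrC divfK.
    rewrite PS !(hornerD, hornerN, hornerZ, hornerM, hornerC, hornerX, hornerXn, horner_exp).
    rewrite horner_comp F0; field.
    by [].
  rewrite (_ : (fun k => _) = (fun k => F t + v + l * ((P k).[v] - (P k.+1).[v]))); last first.
    by apply/funext => k; rewrite -E.
  have c1 : (fun k => (P k.+1).[v]) @ \oo --> w.
    by have := yw; rewrite -(cvg_shiftS (fun k => (P k).[v])).
  have c2 : (fun k => l * ((P k).[v] - (P k.+1).[v])) @ \oo --> l * (w - w).
    by apply: cvgM; [exact: cvg_cst|exact: cvgB].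
  have := cvgD (cvg_cst (F t + v)) c2; rewrite subrr mulr0 addr0.
  exact.
have -> : g (F t + v) = Y (t + w) by rewrite -Fw gFY.
have := @poly_trunc_cvg b r M Y t _ w 0 r0 bM bY yr yw cY.
rewrite (_ : (fun k => _) = (fun k => (\poly_(n < k) b n \Po P k).[v]))//.
by apply/funext => k; rewrite addn0 horner_comp.
Qed.

End AnalyticInverse.

(** * Double power series *)

Section AnalyticPlane.
Variable R : realType.
Implicit Types (A c : nat -> nat -> R) (i : 'I_2).

Definition box c N := \sum_(m < N) \sum_(n < N) c m n.

Definition idx2 i (m n : nat) : {ffun 'I_2 -> nat} := [ffun k => if k == i then m else n].

Lemma mpsum_box i (a : {ffun 'I_2 -> nat} -> R) (h : 'rV[R]_2) N :
  mpsum a h N = box (fun m n => a (idx2 i m n) *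
    (h ord0 i ^+ m * h ord0 (rev_ord i) ^+ n)) N.
Proof.
rewrite /mpsum /box pair_bigA /=.
pose F (p : 'I_N * 'I_N) : {ffun 'I_2 -> 'I_N} := [ffun k => if k == i then p.1 else p.2].
rewrite (reindex F) /=; last first.
  exists (fun f => (f i, f (rev_ord i))) => [[x y] _|f _].
    by rewrite /F !ffunE eqxx neq_rev_ord2.
  apply/ffunP => k; rewrite /F ffunE.
  by case: (ord2P i k) => ->; rewrite ?eqxx ?neq_rev_ord2.
apply: eq_bigr => -[x y] _; congr (a _ * _).
  by apply/ffunP => k; rewrite !ffunE /=; case: ifP.
rewrite (bigD1 i)//= (bigD1 (rev_ord i)) ?neq_rev_ord2//= big1 ?mulr1.
  by rewrite !ffunE /= eqxx neq_rev_ord2.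
by move=> k; case: (ord2P i k) => ->; rewrite eqxx ?andbF.
Qed.

Lemma box_ge0_nondecreasing c : (forall m n, 0 <= c m n) ->
  nondecreasing_seq (box c).
Proof.
move=> c0; apply/nondecreasing_seqP => N; rewrite /box big_ord_recr /=.
rewrite -[leLHS]addr0 lerD//; last by apply: sumr_ge0.
by apply: ler_sum => m _; rewrite big_ord_recr /= lerDl.
Qed.

(** Square sums are monotone for nonnegative terms only, so [c] is written as the difference of
    [|c| + c] and [|c|]. *)
Lemma box_cvg c B : (forall N, box (fun m n => `|c m n|) N <= B) -> cvgn (box c).
Proof.
move=> cB; have c1 : cvgn (box (fun m n => `|c m n|)).
  apply: nondecreasing_is_cvgn; first exact: box_ge0_nondecreasing.
  by exists B => _ [N _ <-].
have c2 : cvgn (box (fun m n => `|c m n| + c m n)).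
  apply: nondecreasing_is_cvgn.
    apply: box_ge0_nondecreasing => m n.
    by rewrite -[c m n]opprK subr_ge0 normrN ler_norm.
  exists (B + B) => _ [N _ <-]; rewrite /box.
  under eq_bigr do rewrite big_split.
  rewrite big_split /= lerD// (le_trans _ (cB N))//.
  by apply: ler_sum => m _; apply: ler_sum => n _; exact: ler_norm.
have -> : box c = (fun N => box (fun m n => `|c m n| + c m n) N - box (fun m n => `|c m n|) N).
  apply/funext => N; rewrite /box -sumrB; apply: eq_bigr => m _.
  by rewrite -sumrB; apply: eq_bigr => n _; rewrite addrAC subrr add0r.
exact: is_cvgB.
Qed.

Lemma box_geo c (M q : R) N : 0 <= M -> 0 <= q <= 1 / 2 ->
  (forall m n, `|c m n| <= M * (q ^+ m * q ^+ n)) -> box (fun m n => `|c m n|) N <= M * 4.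
Proof.
move=> M0 q2 cM.
apply: (@le_trans _ _ (\sum_(m < N) (M * q ^+ m) * 2)).
  apply: ler_sum => m _; apply: (@le_trans _ _ (\sum_(n < N) M * q ^+ m * q ^+ n)).
    by apply: ler_sum => n _; rewrite -mulrA.
  rewrite -mulr_sumr ler_wpM2l// ?geo_half_sum//.
  by rewrite mulr_ge0// exprn_ge0//; case/andP: q2.
rewrite -mulr_suml -mulr_sumr; have := geo_half_sum N q2.
move=> h; have : M * \sum_(i < N) q ^+ i <= M * 2 by rewrite ler_wpM2l.
lra.
Qed.

Lemma coef_geo A (r M h k t : R) m n : 0 < r -> (forall m n, `|A m n| * r ^+ (m + n) <= M) ->
  `|h| <= t * r -> `|k| <= t * r -> `|A m n * (h ^+ m * k ^+ n)| <= M * (t ^+ m * t ^+ n).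
Proof.
move=> r0 AM ht kt.
have t0 : 0 <= t by rewrite -(pmulr_lge0 _ r0) (le_trans (normr_ge0 h)).
rewrite !normrM !normrX.
apply: (@le_trans _ _ (`|A m n| * ((t * r) ^+ m * (t * r) ^+ n))).
  rewrite ler_wpM2l// ler_pM ?exprn_ge0// lerXn2r// nnegrE// mulr_ge0// ltW//.
have -> : `|A m n| * ((t * r) ^+ m * (t * r) ^+ n) = `|A m n| * r ^+ (m + n) * (t ^+ m * t ^+ n).
  by rewrite !exprMn exprD; ring.
by rewrite ler_wpM2r// mulr_ge0// exprn_ge0.
Qed.

Definition an2 i (f : 'rV[R]_2 -> R) (a b : R) := exists A (r M : R),
  [/\ 0 < r, forall m n, `|A m n| * r ^+ (m + n) <= M &
    forall h k, `|h| < r -> `|k| < r ->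
      box (fun m n => A m n * (h ^+ m * k ^+ n)) @ \oo --> f (pt i (a + h) (b + k))].

(** Absolute convergence at the corner [(r, r)] bounds every single term, which is the Cauchy bound;
    conversely, on half the radius that bound dominates the terms by a double geometric series of
    ratio [1 / 2]. *)
Lemma analytic_atP i f a b : analytic_at f (pt i a b) <-> an2 i f a b.
Proof.
have D1 h k : (pt i (a + h) (b + k) - pt i a b) ord0 i = h.
  by rewrite !mxE !eqxx addrAC subrr add0r.
have D2 h k : (pt i (a + h) (b + k) - pt i a b) ord0 (rev_ord i) = k.
  by rewrite !mxE !neq_rev_ord2 addrAC subrr add0r.
split=> [[a0 /near_ptP[e e0 eP]]|[A [r [M [r0 AM Af]]]]].
  pose r := e / 2; have r0 : 0 < r by rewrite divr_gt0.
  have re : r < e by rewrite ltr_pdivrMr// ltr_pMr// ltr1n.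
  have sh (x h : R) : `|h| < e -> `|x + h - x| < e by rewrite addrAC subrr add0r.
  have rn : `|r| < e by rewrite gtr0_norm.
  have [cv _] := eP _ _ (sh a r rn) (sh b r rn).
  exists (fun m n => a0 (idx2 i m n)), r.
  pose u := box (fun m n => `|a0 (idx2 i m n)| * (r ^+ m * r ^+ n)).
  have uE : mpsum (fun m => `|a0 m|) (map_mx Num.norm (pt i (a + r) (b + r) - pt i a b)) = u.
    apply/funext => N; rewrite (mpsum_box i).
    by rewrite ![map_mx _ _ _ _]mxE D1 D2 (gtr0_norm r0).
  have u0 m n : 0 <= `|a0 (idx2 i m n)| * (r ^+ m * r ^+ n).
    by rewrite !mulr_ge0// exprn_ge0// ltW.
  exists (limn u); split=> // [m n|h k hr kr].
    rewrite uE in cv; pose N := (maxn m n).+1.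
    apply: le_trans (nondecreasing_cvgn_le (box_ge0_nondecreasing u0) cv N).
    have mN : (m < N)%N by rewrite ltnS leq_maxl.
    have nN : (n < N)%N by rewrite ltnS leq_maxr.
    rewrite /u /box (bigD1 (Ordinal mN))//= (bigD1 (Ordinal nN))//= exprD -addrA lerDl.
    by rewrite addr_ge0// sumr_ge0// => ? _; rewrite sumr_ge0.
  have [_] := eP _ _ (sh a h (lt_trans hr re)) (sh b k (lt_trans kr re)).
  rewrite (_ : mpsum _ _ = box (fun m n => a0 (idx2 i m n) * (h ^+ m * k ^+ n)))//.
  by apply/funext => N; rewrite (mpsum_box i) D1 D2.
have M0 : 0 <= M by apply: le_trans (AM 0%N 0%N); rewrite mulr_ge0// exprn_ge0// ltW.
exists (fun m => A (m i) (m (rev_ord i))); apply/near_ptP.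
have E m n : A (idx2 i m n i) (idx2 i m n (rev_ord i)) = A m n.
  by rewrite /idx2 !ffunE eqxx neq_rev_ord2.
exists (r / 2); first by rewrite divr_gt0.
move=> x y xr yr; rewrite -(subrK a x) -(subrK b y) ![_ - _ + _]addrC.
set h := x - a in xr *; set k := y - b in yr *; split.
  rewrite (_ : mpsum _ _ = box (fun m n => `|A m n * (h ^+ m * k ^+ n)|)); last first.
    apply/funext => N; rewrite (mpsum_box i) ![map_mx _ _ _ _]mxE D1 D2.
    by congr box; apply/funext => m; apply/funext => n; rewrite E !normrM !normrX.
  apply: nondecreasing_is_cvgn; first exact: box_ge0_nondecreasing.
  exists (M * 4) => _ [N _ <-]; apply: (@box_geo _ M (1 / 2)) => //.
    by apply/andP; split; lra.
  by move=> m n; apply: (coef_geo (r := r)) => //; lra.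
rewrite (_ : mpsum _ _ = box (fun m n => A m n * (h ^+ m * k ^+ n))); last first.
  by apply/funext => N; rewrite (mpsum_box i) D1 D2 //; congr box; apply/funext => m; apply/funext => n; rewrite E.
by apply: Af; lra.
Qed.

Lemma an2_line i f a b : an2 i f a b -> an1 (fun x => f (pt i x b)) a.
Proof.
move=> [A [r [M [r0 AM Af]]]]; exists (A ^~ 0%N), r, M; split=> //.
  by move=> n; have := AM n 0%N; rewrite addn0.
move=> h hr; have := Af h 0 hr; rewrite normr0 addr0 => /(_ r0) c0.
apply/cvgn_epsP => e e0; have [N hN] := (cvgn_epsP _ _).1 c0 e e0.
exists N.+1 => n nN; have := hN n (ltnW nN).
suff -> : (\poly_(n0 < n) A n0 0%N).[h] = box (fun m n => A m n * (h ^+ m * 0 ^+ n)) n by [].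
rewrite horner_poly /box; apply: eq_bigr => m _; case: n nN m => // n _ m.
rewrite big_ord_recl /= expr0 mulr1 big1 ?addr0// => j _.
by rewrite expr0n !mulr0.
Qed.

Lemma an2_continuous i f a b : an2 i f a b -> {for pt i a b, continuous f}.
Proof.
move=> [A [r [M [r0 AM Af]]]].
have M0 : 0 <= M by apply: le_trans (AM 0%N 0%N); rewrite mulr_ge0// exprn_ge0// ltW.
have key h k t : 0 <= t <= 1 -> `|h| <= t * (r / 2) -> `|k| <= t * (r / 2) ->
    `|f (pt i (a + h) (b + k)) - A 0%N 0%N| <= t * (M * 4).
  move=> /andP[t0 t1] ht kt.
  have tr : t * (r / 2) < r by rewrite (le_lt_trans (ler_piMl _ t1))//; lra.
  have c1 := Af h k (le_lt_trans ht tr) (le_lt_trans kt tr).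
  apply: (@cvgn_le_bound _ _ _ _ _ 1 c1) => -[//|N] _.
  pose c m n := if (m + n == 0)%N then 0 else A m n * (h ^+ m * k ^+ n).
  have -> : box (fun m n => A m n * (h ^+ m * k ^+ n)) N.+1 - A 0%N 0%N = box c N.+1.
    pose d m n := if (m + n == 0)%N then A 0%N 0%N else 0.
    have -> : box (fun m n => A m n * (h ^+ m * k ^+ n)) N.+1 = box c N.+1 + box d N.+1.
      rewrite /box -big_split /=; apply: eq_bigr => m _; rewrite -big_split /=.
      apply: eq_bigr => n _; rewrite /c /d; case: eqP => [/eqP|_]; last by rewrite addr0.
      by rewrite addn_eq0 => /andP[/eqP-> /eqP->]; rewrite !expr0 !mulr1 add0r.
    have -> : box d N.+1 = A 0%N 0%N; last by rewrite addrK.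
    rewrite /box big_ord_recl [X in _ + X]big1 ?addr0 => [|m _]; last first.
      by rewrite big1// => n _; rewrite /d /bump.
    by rewrite big_ord_recl [X in _ + X]big1 ?addr0// => n _; rewrite /d /bump.
  have ck m n : `|c m n| <= (t * M) * ((1 / 2) ^+ m * (1 / 2) ^+ n).
    rewrite /c; case: ifPn => [_|mn].
      by rewrite normr0 !mulr_ge0 ?exprn_ge0 ?divr_ge0.
    have ht' : `|h| <= t / 2 * r by lra.
    have kt' : `|k| <= t / 2 * r by lra.
    rewrite (le_trans (coef_geo m n r0 AM ht' kt'))//.
    rewrite [t * M]mulrC -mulrA ler_wpM2l// -!exprD [t / 2](_ : _ = t * (1 / 2)); last by field.
    rewrite exprMn ler_wpM2r ?exprn_ge0 ?divr_ge0//.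
    by rewrite -[leRHS]expr1; apply: ler_wiXn2l => //; rewrite lt0n.
  rewrite mulrA; apply: le_trans (box_geo N.+1 _ _ ck); last first.
  - by apply/andP; split; lra.
  - by rewrite mulr_ge0.
  rewrite /box (le_trans (ler_norm_sum _ _ _))//; apply: ler_sum => m _.
  exact: ler_norm_sum.
have f0 : f (pt i a b) = A 0%N 0%N.
  apply/eqP; rewrite -subr_eq0 -normr_le0.
  by have := key 0 0 0; rewrite !addr0 normr0 !mul0r lexx ler01 => /(_ isT isT isT).
apply/continuous_ptP => e e0.
pose t := Num.min 1 (e / (M * 4 + 1)).
have K0 : 0 < M * 4 + 1 by lra.
have t0 : 0 < t by rewrite lt_min ltr01 divr_gt0.
have t1 : t <= 1 by rewrite ge_min lexx.
have te : t * (M * 4 + 1) <= e by rewrite -ler_pdivlMr// ge_min lexx orbT.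
exists (t * (r / 2)); first by rewrite mulr_gt0// divr_gt0.
move=> x y /ltW xr /ltW yr; have := key _ _ t _ xr yr.
rewrite ![_ + (_ - _)]addrC !subrK f0 (ltW t0) t1 => /(_ isT).
lra.
Qed.

Lemma horner_taylor2 (p : {poly R}) (x s d : R) : 0 < d -> `|s| <= d ->
  `|p.[x + s] - p.[x] - p^`().[x] * s| <= (`|s| / d) ^+ 2 * pnorm (d + `|x|) p.
Proof.
move=> d0 sd; pose q := p \Po ('X + x%:P).
have q0 : q`_0 = p.[x] by rewrite -horner_coef0 horner_comp !hornerE.
have q1 : q`_1 = p^`().[x].
  have -> : q`_1 = (q^`())`_0 by rewrite coef_deriv.
  by rewrite -horner_coef0 deriv_comp derivD derivX derivC addr0 mulr1 horner_comp !hornerE.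
have qs : q.[s] = p.[x + s] by rewrite horner_comp !hornerE addrC.
have t01 : 0 <= `|s| / d <= 1 by rewrite divr_ge0 ?(ltW d0)//= ler_pdivrMr// mul1r.
have st : `|s| <= `|s| / d * d by rewrite divfK ?gt_eqF.
have := horner_tail q 2 d0 t01 st.
rewrite big_ord_recl big_ord1 /= expr0 mulr1 expr1 /bump /= qs q0 q1 opprD addrA.
move/le_trans; apply; rewrite ler_wpM2l ?exprn_ge0//; first by case/andP: t01.
rewrite (le_trans (pnorm_comp _ _ (ltW d0)))// pnorm_mono ?pnorm_ge0 ?(ltW d0)//.
by rewrite (le_trans (pnormD _ _ (ltW d0)))// pnormX pnormC.
Qed.

(** Term-by-term differentiation. For fixed [k] the square sums are polynomials in [h] whose
    second-order Taylor remainders are bounded uniformly in [N], so the first-order expansion passes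
    to the limit. *)
Lemma an2_partial i f a b : an2 i f a b ->
  derivable f (pt i a b) (delta_mx ord0 i) /\ an2 i (partial i f) a b.
Proof.
move=> [A [r [M [r0 AM Af]]]].
have M0 : 0 <= M by apply: le_trans (AM 0%N 0%N); rewrite mulr_ge0// exprn_ge0// ltW.
pose A' m n := m.+1%:R * A m.+1 n.
have r20 : 0 < r / 2 by rewrite divr_gt0.
(* Halving the radius absorbs the factor [m + 1 <= 2 ^ m]. *)
have AM' m n : `|A' m n| * (r / 2) ^+ (m + n) <= M / r.
  rewrite ler_pdivlMr// normrM ger0_norm//.
  apply: (@le_trans _ _ (`|A m.+1 n| * r ^+ (m.+1 + n))); last exact: AM.
  rewrite addSn exprSr mulrA ler_wpM2r ?(ltW r0)// mulrAC [leLHS]mulrC ler_wpM2l//.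
  rewrite expr_div_n mulrA ler_pdivrMr ?exprn_gt0// mulrC ler_wpM2l ?exprn_ge0 ?(ltW r0)//.
  by rewrite -natrX ler_nat (leq_trans (ltn_expl m (ltnSn 1)))// leq_exp2l// leq_addr.
have M'0 : 0 <= M / r by rewrite divr_ge0// ltW.
pose c h k m n := A' m n * (h ^+ m * k ^+ n).
pose f1 h k := limn (box (c h k)).
have cg (h k : R) (m n : nat) : `|h| <= r / 4 -> `|k| <= r / 4 -> `|c h k m n| <= (M / r) * ((1 / 2) ^+ m * (1 / 2) ^+ n).
  by move=> hr kr; apply: (coef_geo (r := r / 2)) => //; lra.
have h01 : 0 <= (1 / 2 : R) <= 1 / 2 by apply/andP; split; lra.
have f1c h k : `|h| <= r / 4 -> `|k| <= r / 4 -> box (c h k) @ \oo --> f1 h k.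
  move=> hr kr; apply: (@box_cvg _ ((M / r) * 4)) => N.
  by apply: (@box_geo _ _ (1 / 2)) => // m n; exact: cg.
have D h k : `|h| < r / 8 -> `|k| < r / 8 ->
    is_derive (a + h) (1 : R) (fun x => f (pt i x (b + k))) (f1 h k).
  move=> hr kr; pose P N := \poly_(m < N) (\sum_(n < N) A m n * k ^+ n).
  have hr4 : `|h| <= r / 4 by lra. have kr4 : `|k| <= r / 4 by lra.
  have Pc x : `|x| < r -> (P N).[x] @[N --> \oo] --> f (pt i (a + x) (b + k)).
    move=> xr; have kr1 : `|k| < r by lra.
    have := Af x k xr kr1.
    rewrite (_ : box _ = (fun N => (P N).[x]))//; apply/funext => N.
    rewrite horner_poly /box; apply: eq_bigr => m _; rewrite mulr_suml.
    by apply: eq_bigr => n _; ring.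
  have dPc : (P N)^`().[h] @[N --> \oo] --> f1 h k.
    apply: (@cvgn_close _ _ (box (c h k)) _ (M / r * 4)); last exact: f1c.
    case=> [|N].
      by rewrite /P poly_def big_ord0 deriv0 horner0 /box big_ord0 subrr normr0 expr0 mul1r mulr_ge0.
    have -> : (P N.+1)^`().[h] = \sum_(m < N) \sum_(n < N.+1) c h k m n.
      rewrite (@horner_coef_wide _ N); last first.
        apply/leq_sizeP => j Nj.
        by rewrite coef_deriv coef_poly ltnS ltnNge Nj /= mul0rn.
      apply: eq_bigr => m _; rewrite coef_deriv coef_poly ltnS ltn_ord -mulr_natl.
      rewrite mulr_sumr mulr_suml; apply: eq_bigr => n _.
      by rewrite /c /A'; ring.
    (* Differentiation turns the square of side [N + 1] into [N] rows of that length; the missing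
       row [m = N] is geometrically small. *)
    rewrite /box big_ord_recr /= opprD addrA subrr sub0r normrN.
    rewrite (le_trans (ler_norm_sum _ _ _))//.
    apply: (@le_trans _ _ (\sum_(n < N.+1) (M / r * (1 / 2) ^+ N) * (1 / 2) ^+ n)).
      by apply: ler_sum => n _; rewrite -mulrA cg.
    rewrite -mulr_sumr; have := geo_half_sum N.+1 h01 => hs.
    apply: (@le_trans _ _ (M / r * (1 / 2) ^+ N * 2)).
      by rewrite ler_wpM2l// mulr_ge0// exprn_ge0.
    by rewrite exprS; set z := _ ^+ N; lra.
  apply/is_deriveE_eps => e e0.
  pose K := (8 / r) ^+ 2 * (M * 2 * 2) + 1.
  have K0 : 0 < K by rewrite ltr_wpDl// mulr_ge0 ?sqr_ge0// !mulr_ge0.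
  exists (Num.min (r / 8) (e / K)); first by rewrite lt_min !divr_gt0.
  move=> s; rewrite lt_min => /andP[sr]; rewrite ltr_pdivlMr// => se.
  have d0 : 0 < r / 8 by rewrite divr_gt0.
  have hsr : `|h + s| < r by have := ler_normD h s; lra.
  have hr1 : `|h| < r by lra.
  have T N : `|(P N).[h + s] - (P N).[h] - (P N)^`().[h] * s| <=
      (`|s| / (r / 8)) ^+ 2 * (M * 2 * 2).
    rewrite (le_trans (horner_taylor2 _ _ d0 (ltW sr)))// ler_wpM2l ?sqr_ge0//.
    apply: (pnorm_trunc _ r0); last by apply/andP; split; [rewrite addr_ge0// ltW|lra].
    move=> m; rewrite -[_ * r ^+ m]ger0_norm; last by rewrite mulr_ge0// exprn_ge0// ltW.
    rewrite normrM normr_id -normrM mulr_suml (le_trans (ler_norm_sum _ _ _))//.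
    apply: (@le_trans _ _ (\sum_(n < N) M * (1 / 2) ^+ n)); last first.
      by rewrite -mulr_sumr ler_wpM2l// geo_half_sum.
    apply: ler_sum => n _; have := AM m n; rewrite exprD => AMn.
    have kn : `|k| ^+ n <= r ^+ n * (1 / 2) ^+ n.
      rewrite -exprMn lerXn2r// ?nnegrE//; last by lra.
      by rewrite mulr_ge0// ltW.
    rewrite !normrM !normrX [`|r|]gtr0_norm//.
    apply: (@le_trans _ _ (`|A m n| * (r ^+ n * (1 / 2) ^+ n) * r ^+ m)).
      by rewrite ler_wpM2r ?exprn_ge0 ?(ltW r0)// ler_wpM2l.
    have -> : `|A m n| * (r ^+ n * (1 / 2) ^+ n) * r ^+ m =
      (`|A m n| * (r ^+ m * r ^+ n)) * (1 / 2) ^+ n by ring.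
    by rewrite ler_wpM2r// exprn_ge0.
  have c1 : (fun N => (P N).[h + s] - (P N).[h] - (P N)^`().[h] * s) @ \oo -->
      f (pt i (a + (h + s)) (b + k)) - f (pt i (a + h) (b + k)) - f1 h k * s.
    apply: cvgB; first by apply: cvgB; exact: Pc.
    by apply: cvgM => //; exact: cvg_cst.
  have := @cvgn_le_bound _ _ _ 0 ((`|s| / (r / 8)) ^+ 2 * (M * 2 * 2)) 0 c1.
  rewrite subr0 -(addrA a) => H.
  apply: le_trans (H _) _; first by move=> N _; rewrite subr0; exact: T.
  rewrite [e * _]mulrC; apply: (@le_trans _ _ (`|s| * (`|s| * K))); last first.
    by rewrite ler_wpM2l// ltW.
  have -> : (`|s| / (r / 8)) ^+ 2 * (M * 2 * 2) = `|s| * (`|s| * ((8 / r) ^+ 2 * (M * 2 * 2))).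
    by field; rewrite gt_eqF.
  by rewrite !ler_wpM2l// lerDl.
have r80 : 0 < r / 8 by rewrite divr_gt0.
have pE h k : `|h| < r / 8 -> `|k| < r / 8 ->
    is_derive (pt i (a + h) (b + k)) (delta_mx ord0 i) f (f1 h k).
  by move=> hr kr; apply/is_derive_pt; exact: D.
split.
  by have := pE 0 0; rewrite !addr0 normr0 => /(_ r80 r80)[].
exists A', (r / 8), (M / r); split=> //.
  move=> m n; apply: le_trans (AM' m n); rewrite ler_wpM2l// lerXn2r// ?nnegrE; lra.
move=> h k hr kr; have [_ E] := pE h k hr kr.
rewrite /partial E; apply: f1c; lra.
Qed.

Lemma analytic_partials (U : set 'rV[R]_2) (f : 'rV[R]_2 -> R) s :
  (forall p, U p -> analytic_at f p) -> forall p, U p -> analytic_at (partials s f) p.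
Proof.
move=> fa; elim: s => [//|j s IH] p /IH; rewrite (ptE j p) => /analytic_atP fp.
by apply/analytic_atP; case: (an2_partial fp).
Qed.

Lemma of_class_analytic_smooth (U : set 'rV[R]_2) (f : 'rV[R]_2 -> R) :
  of_class (@Analytic R) U f -> of_class (@Smooth R) U f.
Proof.
move=> fa k; split=> [s j x _ Ux|s x _ Ux].
  have := analytic_partials s fa Ux; rewrite {1}(ptE j x) => /analytic_atP/an2_partial[].
  by rewrite -ptE.
have := analytic_partials s fa Ux; rewrite {1}(ptE ord0 x) => /analytic_atP/an2_continuous.
by rewrite -ptE.
Qed.

Lemma shear_analytic i (c : R) g (x : 'rV[R]_2) : an1 g (x ord0 i) -> analytic_at (shear i c g) x.
Proof.
move=> [a [r [M [r0 aM ag]]]]; rewrite (ptE i x); apply/analytic_atP.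
set t := x ord0 i in ag *; set b := x ord0 (rev_ord i).
have M0 : 0 <= M by apply: le_trans (aM 0%N); rewrite mulr_ge0// exprn_ge0// ltW.
pose A m n := if n == 0%N then a m + (if m == 0%N then c * b else 0)
  else if (n == 1%N) && (m == 0%N) then c else 0.
exists A, r, (M + `|c * b| + `|c| * r); split=> //.
  move=> m n; have cr : 0 <= `|c| * r by rewrite mulr_ge0// ltW.
  have := aM m; have := normr_ge0 (c * b); rewrite /A.
  case: n => [|[|n]] /=; case: m => [|m] /=; rewrite ?addr0 ?addn0 ?normr0 ?mul0r ?addn1 ?expr0 ?expr1 ?mulr1; try lra.
  by have := ler_normD (a 0%N) (c * b); lra.
move=> h k hr kr; rewrite /shear pt1 pt2.
have cb : (fun N => c * (b + k) + (\poly_(n < N) a n).[h]) @ \oo --> c * (b + k) + g (t + h).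
  by apply: cvgD; [exact: cvg_cst|exact: ag].
apply/cvgn_epsP => e e0; have [N hN] := (cvgn_epsP _ _).1 cb e e0.
exists N.+2 => n nN; have := hN n (leq_trans (leqW (leqnSn N)) nN).
suff -> : box (fun m n => A m n * (h ^+ m * k ^+ n)) n = c * (b + k) + (\poly_(n0 < n) a n0).[h] by [].
case: n nN => [//|[//|n]] _.
have rowE m : \sum_(j < n.+2) A m j * (h ^+ m * k ^+ j) =
    a m * h ^+ m + (if m == 0%N then c * (b + k) else 0).
  rewrite !big_ord_recl /= big1 ?addr0 => [|j _]; last by rewrite /A /bump /= mul0r.
  by rewrite /A /bump /=; case: m => [|m] /=; rewrite ?expr0 ?expr1; ring.
rewrite /box; under eq_bigr do rewrite rowE.
rewrite big_split /= addrC horner_poly; congr (_ + _).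
by rewrite big_ord_recl /= big1 ?addr0.
Qed.

End AnalyticPlane.

(** * The graph and its charts *)

Section InverseLine.
Variable R : realType.

(** Monotonicity and the intermediate value theorem invert [G] on the image of the interval of
    radius [d / 2], whose ends still lie in the domain. The last clause, that [T] is also a left
    inverse around [T u], is what [an1_param] asks for. *)
Lemma inverse_line (G G' : R -> R) x1 d : 0 < d ->
  (forall x, `|x - x1| < d -> is_derive x (1 : R) G (G' x) /\ 0 < G' x) ->
  exists (I : R -> Prop) (T : R -> R), [/\ open1 I, I (G x1) &
    forall u, I u -> [/\ `|T u - x1| < d, G (T u) = u,
      is_derive u (1 : R) T (G' (T u))^-1 &
      exists2 e : R, 0 < e & forall h, `|h| < e -> T (G (T u + h)) = T u + h]].
Proof.
move=> d0 dG; have xx : `|x1 - x1| < d by rewrite subrr normr0.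
have mono x y : `|x - x1| < d -> `|y - x1| < d -> x < y -> G x < G y.
  move=> xd yd xy; have dG' w : `|w - x1| < d -> is_derive w (1 : R) G (G' w).
    by case/dG.
  have [c [cd _ E]] := MVT_ball dG' yd xd.
  by rewrite -subr_gt0 E mulr_gt0 ?subr_gt0//; case: (dG _ cd).
have inj x y : `|x - x1| < d -> `|y - x1| < d -> G x = G y -> x = y.
  move=> xd yd E; case: (ltgtP x y) => // h.
    by have := mono _ _ xd yd h; rewrite E ltxx.
  by have := mono _ _ yd xd h; rewrite E ltxx.
pose h := d / 2; have h0 : 0 < h by rewrite divr_gt0.
have hd : h < d by rewrite ltr_pdivrMr// ltr_pMr// ltr1n.
pose I u := G (x1 - h) < u < G (x1 + h).
have sh (s : R) : `|s| <= h -> `|x1 + s - x1| < d.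
  by move=> sh; rewrite addrAC subrr add0r (le_lt_trans sh).
have lh : `|x1 - h - x1| < d by apply: sh; rewrite normrN gtr0_norm.
have rh : `|x1 + h - x1| < d by apply: sh; rewrite gtr0_norm.
have surj u : I u -> exists x, `|x - x1| < d /\ G x = u.
  move=> /andP[u1 u2].
  have cG : {within `[x1 - h, x1 + h], continuous G}.
    apply: continuous_in_subspaceT => y; rewrite inE/= in_itv/= => /andP[y1 y2].
    have yd : `|y - x1| < d.
      by rewrite ltr_norml; apply/andP; split; lra.
    have [[dy _] _] := dG y yd.
    by apply: differentiable_continuous; apply/derivable1_diffP.
  have ab : x1 - h <= x1 + h by lra.
  have [|c] := @IVT _ G _ _ u ab cG.
    by rewrite ge_min le_max (ltW u1) (ltW u2) orbT.
  rewrite in_itv/= => /andP[c1 c2] <-; exists c; split=> //.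
  by rewrite ltr_norml; apply/andP; split; lra.
pose T u := xget x1 [set x | `|x - x1| < d /\ G x = u].
have TP u : I u -> `|T u - x1| < d /\ G (T u) = u.
  by move=> /surj[x xP]; rewrite /T; case: xgetP => [z -> //|/(_ x)].
have IG x : `|x - x1| < h -> I (G x).
  move=> xh; have xd := lt_trans xh hd.
  by move: xh; rewrite ltr_norml => /andP[? ?]; apply/andP; split; apply: mono => //; lra.
have TG x : `|x - x1| < h -> T (G x) = x.
  by move=> xh; have [? ?] := TP _ (IG _ xh); apply: inj => //; exact: lt_trans hd.
have Th u : I u -> `|T u - x1| < h.
  move=> Iu; have [Td GT] := TP _ Iu; case/andP: Iu; rewrite -{1 2}GT => u1 u2.
  rewrite ltr_norml; apply/andP; split.
    by rewrite ltNge; apply/negP => c; have := mono (T u) (x1 - h) Td lh;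
       case: (ltgtP (T u) (x1 - h)) => [_ /(_ isT)|cc|cc _]; [lra|lra|move: u1; rewrite -cc ltxx].
  by rewrite ltNge; apply/negP => c; have := mono (x1 + h) (T u) rh Td;
     case: (ltgtP (T u) (x1 + h)) => [cc|_ /(_ isT)|cc _]; [lra|lra|move: u2; rewrite -cc ltxx].
have near_T u : I u -> exists2 e : R, 0 < e & forall s, `|s| < e -> `|T u + s - x1| < h.
  move=> /Th Tu; exists (h - `|T u - x1|); first by rewrite subr_gt0.
  by move=> s sh'; have := ler_normD (T u - x1) s; rewrite addrAC; lra.
exists I, T; split.
- move=> u /andP[u1 u2]; exists (Num.min (u - G (x1 - h)) (G (x1 + h) - u)).
    by rewrite lt_min !subr_gt0 u1.
  move=> y; rewrite lt_min !ltr_norml => /andP[/andP[? ?] /andP[? ?]].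
  by apply/andP; split; lra.
- by apply: IG; rewrite subrr normr0.
- move=> u Iu; have [Td GT] := TP _ Iu; have [e e0 eP] := near_T _ Iu.
  split=> //; last by exists e => // s se; apply/TG/eP.
  have [dGT G0] := dG _ Td; rewrite -{1}GT.
  have nT : \forall y \near T u, `|y - x1| < h.
    exists e => // y; rewrite /= (distrC (T u)) => yu.
    by have := eP _ yu; rewrite [T u + _]addrC subrK.
  apply: (is_derive_inverse _ _ dGT (lt0r_neq0 G0)).
    by near=> y; apply: TG; near: y.
  near=> y; have [|[dy _] _] := dG y; first by apply: lt_trans hd; near: y.
  by apply: differentiable_continuous; apply/derivable1_diffP.
Unshelve. all: by end_near. Qed.

End InverseLine.

(** * The distance to a closed set *)

Section DistanceTube.
Variables (R : realType) (S : set 'rV[R]_2).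
Hypotheses (S0 : S !=set0) (Sc : closed S).

Lemma dist_set_ge0 x : 0 <= dist S x.
Proof.
apply: lb_le_inf; first by case: S0 => s Ss; exists (enorm (x - s)); exists s.
by move=> _ [s _ <-]; exact: sqrtr_ge0.
Qed.

Lemma dist_set_le x s : S s -> dist S x <= enorm (x - s).
Proof.
move=> Ss; apply: ge_inf; last by exists s.
by exists 0 => _ [y _ <-]; exact: sqrtr_ge0.
Qed.

Lemma dist_set_attained x : exists2 s, S s & dist S x = enorm (x - s).
Proof.
pose a := x ord0 ord0; pose b := x ord0 (rev_ord ord0).
have E y z : enorm (x - pt ord0 y z) = nrm (y - a) (z - b).
  rewrite (enorm_pt ord0) !mxE eqxx neq_rev_ord2 /nrm; congr Num.sqrt.
  by rewrite -/a -/b; ring.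
case: S0 => s0 Ss0; pose M := enorm (x - s0).
have M0 : 0 <= M by exact: sqrtr_ge0.
have [||||y [z [[Syz yzM] yzP]]] := @EVT_plane R (fun y z => - nrm (y - a) (z - b))
   (fun y z => S (pt ord0 y z) /\ nrm (y - a) (z - b) <= M) (M + `|a| + `|b|) 1.
- move=> p q y z; rewrite mul1r opprK addrC distrC; have := nrm_lip (y - a) (z - b) (p - a) (q - b).
  have -> : p - a - (y - a) = - (y - p) by ring.
  have -> : q - b - (z - b) = - (z - q) by ring.
  by rewrite !normrN distrC.
- move=> y z [_]; rewrite nrm_le// => h.
  have hx : `|y - a| <= M.
    rewrite -ler_sqr ?nnegrE// real_normK ?num_real//.
    by rewrite (le_trans _ h)// lerDl sqr_ge0.
  have hy : `|z - b| <= M.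
    rewrite -ler_sqr ?nnegrE// real_normK ?num_real//.
    by rewrite (le_trans _ h)// lerDr sqr_ge0.
  have := ler_normD (y - a) a; have := ler_normD (z - b) b; rewrite !subrK.
  by have := normr_ge0 a; have := normr_ge0 b => *; split; lra.
- move=> y z nK; have [Syz|nS] := pselect (S (pt ord0 y z)); last first.
    have oS : open (~` S) by rewrite openC.
    have [e e0 eP] : exists2 e : R, 0 < e & forall x0 y0 : R, `|x0 - y| < e ->
       `|y0 - z| < e -> (~` S) (pt ord0 x0 y0).
      by apply/near_ptP; exact: open_nbhs_nbhs.
    by exists e => // p q py qz [Spq _]; exact: (eP p q py qz).
  have Mn : M < nrm (y - a) (z - b) by rewrite ltNge; apply/negP => h; apply: nK.
  exists ((nrm (y - a) (z - b) - M) / 2); first by rewrite divr_gt0// subr_gt0.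
  move=> p q py qz [_]; have := nrm_lip (y - a) (z - b) (p - a) (q - b).
  have -> : p - a - (y - a) = p - y by ring.
  have -> : q - b - (z - b) = q - z by ring.
  by rewrite ler_norml => /andP[+ _]; lra.
- exists (s0 ord0 ord0), (s0 ord0 (rev_ord ord0)); rewrite -ptE; split=> //.
  by rewrite -E -ptE.
exists (pt ord0 y z) => //; apply/eqP; rewrite eq_le dist_set_le//= E.
apply: lb_le_inf; first by exists M; exists s0.
move=> _ [s Ss <-]; rewrite [s](ptE ord0) E.
have [h|h] := leP (nrm (s ord0 ord0 - a) (s ord0 (rev_ord ord0) - b)) M.
  by rewrite -lerN2; apply: yzP; rewrite -ptE.
by rewrite (le_trans yzM)// ltW.
Qed.

End DistanceTube.

Section TubeOfClass.
Variable R : realType.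

Lemma CkW (n k m : nat) (U : set 'rV[R]_n.+1) (f : 'rV[R]_n.+1 -> R) :
  (m <= k)%N -> Ck k U f -> Ck m U f.
Proof.
move=> mk [df cf]; split=> [s i x sm|s x sm]; [apply: df|apply: cf].
  exact: leq_trans mk.
exact: leq_trans mk.
Qed.

Lemma class_C2 (c : regularity R) (U : set 'rV[R]_2) (f : 'rV[R]_2 -> R) :
  admissible c -> of_class c U f -> Ck 2 U f.
Proof.
case: c => [k al [k2 _] [Cf _]|_ Cf|_ /of_class_analytic_smooth Cf]; [|exact: Cf..].
exact: CkW k2 Cf.
Qed.

Lemma diff2_partials i k (U : set 'rV[R]_2) (f : 'rV[R]_2 -> R) s (a b e : R) :
  Ck k U f -> (size s < k)%N -> 0 < e ->
  (forall x y, `|x - a| < e -> `|y - b| < e -> U (pt i x y)) ->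
  diff2 (fun x y => partials s f (pt i x y)) a b
    (partials (i :: s) f (pt i a b)) (partials (rev_ord i :: s) f (pt i a b)).
Proof.
move=> Cf sk e0 eP.
have Uab : U (pt i a b) by apply: eP; rewrite subrr normr0.
apply: (@diff2_C1 _ _ (fun x y => partials (i :: s) f (pt i x y))
  (fun x y => partials (rev_ord i :: s) f (pt i x y)) a b e) => //.
- move=> x y xa yb; have Uxy := eP _ _ xa yb; split.
    exact: partial_pt Cf sk Uxy.
  have := @partial_pt _ (rev_ord i) k U f s y x Cf sk; rewrite pt_rev => /(_ Uxy).
  by congr is_derive; apply/funext => z; rewrite pt_rev.
- move=> e' e'0; have [_ /(_ (i :: s) _ sk Uab)/continuous_ptP cf] := Cf.
  exact: cf.
- move=> e' e'0; have [_ /(_ (rev_ord i :: s) _ sk Uab)/continuous_ptP cf] := Cf.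
  exact: cf.
Qed.

Variable S : set 'rV[R]_2.
Hypotheses (S0 : S !=set0) (Sc : closed S).

Lemma dist_set_lip i (a b x y : R) :
  `|dist S (pt i x y) - dist S (pt i a b)| <= `|x - a| + `|y - b|.
Proof.
have key (p q y1 z1 : R) : dist S (pt i y1 z1) <= dist S (pt i p q) + (`|y1 - p| + `|z1 - q|).
  have [s Ss ->] := dist_set_attained S0 Sc (pt i p q).
  rewrite (le_trans (dist_set_le _ Ss))// !(enorm_pt i) !mxE !eqxx !neq_rev_ord2.
  have := nrmD (p - s ord0 i) (q - s ord0 (rev_ord i)) (y1 - p) (z1 - q).
  have -> : p - s ord0 i + (y1 - p) = y1 - s ord0 i by ring.
  have -> : q - s ord0 (rev_ord i) + (z1 - q) = z1 - s ord0 (rev_ord i) by ring.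
  move=> /le_trans; apply.
  by rewrite lerD2l nrm_le_sum.
rewrite ler_norml; apply/andP; split.
  by have := key x y a b; rewrite (distrC a) (distrC b); lra.
by have := key a b x y; lra.
Qed.

(** [partials] applies the head of the list last; hence [d12], the derivative of [d1] in the second
    variable, is the one indexed by [[:: rev_ord i; i]]. *)
Lemma dist_set_tube i (r : R) : interior S = set0 -> 0 < r ->
  Ck 2 [set x : 'rV[R]_2 | 0 < dist S x < r] (dist S) ->
  let P s a b := partials s (dist S) (pt i a b) in
  C2_tube (fun a b => S (pt i a b)) (P [::]) (P [:: i]) (P [:: rev_ord i])
    (P [:: i; i]) (P [:: rev_ord i; i]) (P [:: i; rev_ord i])
    (P [:: rev_ord i; rev_ord i]) r.
Proof.
move=> Si r0 Cf P; set U := [set x | _] in Cf.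
have Unear a b : U (pt i a b) -> exists2 e : R, 0 < e & forall x y,
    `|x - a| < e -> `|y - b| < e -> U (pt i x y).
  move=> /= /andP[Dg Dl]; set D := dist S (pt i a b) in Dg Dl.
  exists (Num.min D (r - D) / 2).
    by rewrite divr_gt0// lt_min Dg subr_gt0.
  move=> x y xa yb; have := dist_set_lip i a b x y.
  rewrite -/D /U/= ler_norml => /andP[h1 h2].
  have : Num.min D (r - D) <= D by rewrite ge_min lexx.
  have : Num.min D (r - D) <= r - D by rewrite ge_min lexx orbT.
  by move=> h3 h4; apply/andP; split; lra.
have df s a b : (size s < 2)%N -> U (pt i a b) ->
    diff2 (fun x y => partials s (dist S) (pt i x y)) a b
      (partials (i :: s) (dist S) (pt i a b)) (partials (rev_ord i :: s) (dist S) (pt i a b)).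
  by move=> s2 /Unear[e e0 eP]; exact: diff2_partials Cf s2 e0 eP.
split=> //.
- by move=> a b; exact: dist_set_ge0.
- move=> a b f g Sf; have := dist_set_le (pt i a b) Sf.
  rewrite (enorm_pt i) !mxE !eqxx !neq_rev_ord2 => h.
  by rewrite -sqr_nrm ler_sqr ?nnegrE ?nrm_ge0 ?dist_set_ge0.
- move=> a b; have [s Ss E] := dist_set_attained S0 Sc (pt i a b).
  exists (s ord0 i), (s ord0 (rev_ord i)); rewrite -ptE; split=> //.
  by rewrite /P /= E (enorm_pt i) sqr_nrm !mxE eqxx neq_rev_ord2.
- move=> a b e e0; apply: contrapT => nex.
  suff : interior S (pt i a b) by rewrite Si.
  apply/near_ptP; exists e => // x y xa yb; apply: contrapT => nS.
  by apply: nex; exists x, y.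
- by move=> a b Dr; exact: df.
- by move=> a b Dr; exact: df.
- by move=> a b Dr; exact: df.
- move=> a b Uab e e0; have e2 : 0 < e / 2 by rewrite divr_gt0.
  have [_ cf] := Cf.
  have /continuous_ptP/(_ _ e2)[d1 d10 dP1] := cf [:: i; i] _ isT Uab.
  have /continuous_ptP/(_ _ e2)[d2 d20 dP2] := cf [:: rev_ord i; rev_ord i] _ isT Uab.
  exists (Num.min d1 d2); first by rewrite lt_min d10.
  move=> x y; rewrite !lt_min => /andP[x1 x2] /andP[y1 y2].
  have := dP1 _ _ x1 y1; have := dP2 _ _ x2 y2; move=> h2 h1.
  rewrite /P opprD addrACA (le_lt_trans (ler_normD _ _))// [e]splitr.
  exact: (ltrD h1 h2).
Qed.

End TubeOfClass.

(** * Regularity of the graph function *)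

Section GraphClass.
Variable R : realType.

Definition line_class (c : regularity R) (I : R -> Prop) (g : R -> R) : Prop :=
  match c with
  | Hoelder k al => CH al k I g
  | Smooth => forall k, CH 0 k I g
  | Analytic => forall u, I u -> an1 g u
  end.

Lemma line_class_id c I : admissible c -> line_class c I id.
Proof.
case: c => [k al [_ al01]|_|_] /=; first exact: CH_id.
  by move=> k; apply: CH_id; rewrite lexx ler01.
by move=> u _; exact: an1_id.
Qed.

Lemma line_classN c I g : admissible c -> line_class c I g -> line_class c I (fun x => - g x).
Proof.
case: c => [k al [_ al01]|_|_] /=; first exact: CHN.
  by move=> h k; apply: CHN; rewrite ?lexx ?ler01.
by move=> h u Iu; apply/an1N/h.
Qed.

Lemma shear_of_class c i c0 (I : R -> Prop) g (U : set 'rV[R]_2) :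
  admissible c -> open1 I -> line_class c I g -> (forall x, U x -> I (x ord0 i)) ->
  of_class c U (shear i c0 g).
Proof.
case: c => [k al [_ al01]|_|_] oI Kg UI /=.
- exact: shear_of_class_Hoelder Kg UI.
- move=> k; have al01 : 0 <= (0 : R) <= 1 by rewrite lexx ler01.
  by have [] := shear_of_class_Hoelder c0 al01 oI (Kg k) UI.
- by move=> p Up; apply/shear_analytic/Kg/UI.
Qed.

(** Count of derivatives in the class C^{k,al}: [G'] has order [k - 2], so [T] has order [k - 1],
    and so has the slope composed with [T]. The graph function is a primitive of the latter and
    regains order [k]. In the analytic class no order is lost and [an1_param] applies directly. *)
Lemma graph_line_class c (U : set 'rV[R]_2) (f : 'rV[R]_2 -> R) i x2 (I J : R -> Prop) T :
  let P s x := partials s f (pt i x x2) in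
  let G x := x - P [::] x * P [:: i] x in
  let Y x := x2 - P [::] x * P [:: rev_ord i] x in
  let G' x := P [:: rev_ord i] x ^+ 2 *
    (1 - P [::] x * (P [:: i; i] x + P [:: rev_ord i; rev_ord i] x)) in
  admissible c -> of_class c U f -> open1 J -> open1 I ->
  (forall x, J x -> [/\ U (pt i x x2), P [:: rev_ord i] x != 0, G' x != 0,
    is_derive x (1 : R) G (G' x) &
    is_derive x (1 : R) Y (- (P [:: i] x / P [:: rev_ord i] x) * G' x)]) ->
  (forall u, I u -> [/\ J (T u), G (T u) = u,
    is_derive u (1 : R) T (G' (T u))^-1 &
    exists2 e : R, 0 < e & forall h, `|h| < e -> T (G (T u + h)) = T u + h]) ->
  line_class c I (fun u => Y (T u)).
Proof.
move=> P G Y G' adm Kf oJ oI HJ HI.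
have JU x : J x -> U (pt i x x2) by case/HJ.
have B0 x : J x -> P [:: rev_ord i] x != 0 by case/HJ.
have IJ u : I u -> J (T u) by case/HI.
have key k al : (2 <= k)%N -> 0 <= al <= 1 -> of_class (Hoelder k al) U f ->
    CH al k I (fun u => Y (T u)).
  case: k => [//|[//|k]] _ al01 Kk.
  have KP s m : (size s + m <= k.+2)%N -> CH al m J (P s).
    by move=> sm; apply: CH_sub JU _; exact: CH_restrict Kk sm.
  have KG' : CH al k J G'.
    have KB : CH al k J (P [:: rev_ord i]) by apply: KP; rewrite add1n leqnSn.
    apply: CHM; first exact: (CHM KB KB).
    apply: CHD; first exact: CH_cst.
    apply/(CHN al01)/CHM; first by apply: KP; rewrite add0n ltnW.
    by apply: CHD; apply: KP; rewrite add2n.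
  have dT u : I u -> is_derive u (1 : R) T (G' (T u))^-1 by case/HI.
  have G0 x : J x -> G' x != 0 by case/HJ.
  have cT u : I u -> cont1 T u.
    by move=> Iu e e0; exact: is_derive_near_lt (dT u Iu) e0.
  have lT u : I u -> lip1 T u.
    move=> Iu; have [d d0 dP] := oI u Iu.
    apply: (lip1_deriv d0 (f' := fun u => (G' (T u))^-1)).
      by move=> y /dP; exact: dT.
    move=> e e0; have [cV _] := reg1V (G0 _ (IJ _ Iu)) (CH_reg KG' (IJ _ Iu)).
    have [d' d'0 d'P] := cV e e0; have [d2 d20 d2P] := cT u Iu d' d'0.
    by exists d2 => // y /d2P /d'P.
  have KT : CH al k.+1 I T by exact: (CH_inverse al01 IJ lT KG' G0 dT).
  pose W x := - (P [:: i] x / P [:: rev_ord i] x).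
  have KW : CH al k.+1 J W.
    apply: (CHN al01); apply: CHM; first by apply: KP; rewrite add1n.
    by apply: (CHV al01) => //; apply: KP; rewrite add1n.
  have KWT : CH al k.+1 I (fun u => W (T u)) by exact: (CH_comp al01 IJ lT KW KT).
  have dg u : I u -> is_derive u (1 : R) (fun u => Y (T u)) (W (T u)).
    move=> Iu; have [_ _ G'0 _ dY] := HJ _ (IJ _ Iu).
    have dTu := dT _ Iu.
    have := is_derive1_comp dY dTu.
    by congr is_derive; rewrite -/(W (T u)) mulfK.
  split; last by exists (fun u => W (T u)).
  move=> u Iu; apply: (lip1_reg al01); have [d d0 dP] := oI u Iu.
  apply: (lip1_deriv d0 (f' := fun u => W (T u))).
    by move=> y /dP; exact: dg.
  by have [] := CH_reg KWT Iu.
case: c adm Kf => [k al [k2 al01]|_|_] Kf /=.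
- exact: key.
- move=> k; have Kk : of_class (Hoelder k.+2 0) U f by exact: of_class_Smooth.
  have a01 : 0 <= (0 : R) <= 1 by rewrite lexx ler01.
  by have /(CHW (al := 0))/(CHW (al := 0)) := key k.+2 0 isT a01 Kk.
- move=> u Iu; have [Ju GT dT [e e0 eP]] := HI u Iu.
  have PA s x : J x -> an1 (P s) x.
    move=> Jx; apply: an2_line; apply/analytic_atP.
    exact: (analytic_partials s Kf (JU _ Jx)).
  have aG : an1 G (T u).
    by apply: an1D; [exact: an1_id|apply/an1N/an1M; exact: PA].
  have aY : an1 Y (T u).
    by apply: an1D; [exact: an1_cst|apply/an1N/an1M; exact: PA].
  have [d d0 dP] := oJ _ Ju; have [_ _ G0 dG _] := HJ _ Ju.
  rewrite -GT; apply: (@an1_param _ G Y (T u) _ _ (Num.min d e) aG aY _ _ dG G0).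
  + by rewrite lt_min d0.
  + move=> h; rewrite lt_min => /andP[hd _].
    have [|_ _ _ dGh dYh] := HJ (T u + h); first by apply: dP; rewrite addrAC subrr add0r.
    split=> e' e'0; [exact: is_derive_near_lt dGh e'0|exact: is_derive_near_lt dYh e'0].
  + by move=> h; rewrite lt_min => /andP[_ /eP ->].
Qed.

End GraphClass.

(** * Flattening charts, and the isolated point *)

Section Chart.
Variable R : realType.

Lemma line_class_cont c (I : R -> Prop) g u : line_class c I g -> I u -> cont1 g u.
Proof.
case: c => [k al||] /= Kg Iu.
- by have [] := CH_reg Kg Iu.
- by have [] := CH_reg (Kg 0%N) Iu.
- move=> e e0; have [a [r [M [r0 aM ag]]]] := Kg u Iu.
  by have [_ dg] := an1_coef01 r0 aM ag; exact: is_derive_near_lt dg e0.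
Qed.

Lemma graph_chart c i (S : set 'rV[R]_2) (p : 'rV[R]_2) (I : R -> Prop) g (e : R) :
  admissible c -> open1 I -> line_class c I g -> I (p ord0 i) -> 0 < e ->
  (forall x : 'rV[R]_2, I (x ord0 i) ->
     `|x ord0 (rev_ord i) - p ord0 (rev_ord i)| < e ->
     (S x <-> x ord0 (rev_ord i) = g (x ord0 i))) ->
  exists U V phi psi, [/\ diffeo c U V phi psi, U p &
    forall x, U x -> (S x <-> forall k : 'I_2, (1 <= k)%N -> phi x ord0 k = 0)].
Proof.
move=> adm oI Kg Ip e0 HS; pose j := rev_ord i; pose o : 'I_2 := ord0.
pose U := [set x : 'rV[R]_2 | I (x ord0 i) /\ `|x ord0 j - p ord0 j| < e].
pose V := [set y : 'rV[R]_2 | I (y ord0 o) /\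
  `|y ord0 (rev_ord o) + g (y ord0 o) - p ord0 j| < e].
(* The coordinate along [i] always becomes coordinate 0, because the slice is where coordinate 1
   vanishes; subtracting [g] flattens the graph. *)
pose phi (x : 'rV[R]_2) := pt o (x ord0 i) (x ord0 j - g (x ord0 i)).
pose psi (y : 'rV[R]_2) := pt i (y ord0 o) (y ord0 (rev_ord o) + g (y ord0 o)).
have strip_open (q : 'I_2) (c1 : R) (h : R -> R) : (forall u, I u -> cont1 h u) ->
    open [set x : 'rV[R]_2 | I (x ord0 q) /\ `|shear q 1 h x - c1| < e].
  move=> ch; rewrite openE => x [Ix xe]; rewrite /interior.
  have cs : {for x, continuous (shear q 1 h)} by exact: shear_continuous (ch _ Ix).
  have FF : ProperFilter (nbhs x) by exact: nbhs_pfilter.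
  have e1 : 0 < e - `|shear q 1 h x - c1| by rewrite subr_gt0.
  have n1 := near_strip oI Ix.
  have n2 : \forall y \near x, `|shear q 1 h x - shear q 1 h y| < e - `|shear q 1 h x - c1|.
    by move/(@cvgrPdist_lt _ _ _ _ FF): cs; apply.
  apply: filterS2 n1 n2 => y Iy ye; split=> //.
  rewrite distrC in ye.
  have := ler_normD (shear q 1 h y - shear q 1 h x) (shear q 1 h x - c1).
  by rewrite addrA subrK; lra.
exists U, V, phi, psi; split.
- split.
  + rewrite (_ : U = [set x : 'rV[R]_2 | I (x ord0 i) /\ `|shear i 1 (fun=> 0) x - p ord0 j| < e]).
      apply: strip_open => u _ d d0; exists 1 => // y _.
      by rewrite subrr normr0.
    by apply/funext => x; rewrite /U /= /shear mul1r addr0.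
  + rewrite (_ : V = [set x : 'rV[R]_2 | I (x ord0 o) /\ `|shear o 1 g x - p ord0 j| < e]).
      by apply: strip_open => u Iu; exact: line_class_cont Kg Iu.
    by apply/funext => x; rewrite /V /= /shear mul1r.
  + move=> k; have [->|->] := ord2P o k.
      rewrite (_ : (fun x => _) = shear i 0 id); last first.
        by apply/funext => x; rewrite /phi pt1 /shear mul0r add0r.
      by apply: (shear_of_class _ adm oI (line_class_id I adm)) => x [].
    rewrite (_ : (fun x => _) = shear i 1 (fun u => - g u)); last first.
      by apply/funext => x; rewrite /phi pt2 /shear mul1r.
    by apply: (shear_of_class _ adm oI (line_classN adm Kg)) => x [].
  + move=> k; have [->|->] := ord2P i k.
      rewrite (_ : (fun x => _) = shear o 0 id); last first.
        by apply/funext => x; rewrite /psi pt1 /shear mul0r add0r.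
      by apply: (shear_of_class _ adm oI (line_class_id I adm)) => x [].
    rewrite (_ : (fun x => _) = shear o 1 g); last first.
      by apply/funext => x; rewrite /psi pt2 /shear mul1r.
    by apply: (shear_of_class _ adm oI Kg) => x [].
  + split=> [x [Ix xe]|y [Iy ye]]; rewrite /U /V /phi /psi /=.
      by rewrite pt1 pt2 subrK -ptE.
    by rewrite pt1 /j pt2 addrK -ptE.
- by split; rewrite // subrr normr0.
- move=> x [Ix xe]; rewrite (HS x Ix xe); split=> [E k|/(_ (rev_ord o) isT)].
    have [->//|-> _] := ord2P o k.
    by rewrite /phi pt2 /j E subrr.
  by rewrite /phi pt2 => /eqP; rewrite subr_eq0 => /eqP.
Qed.

Lemma connected_isolated_point (S : set 'rV[R]_2) (p1 p2 t : R) : connected S ->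
  S (pt ord0 p1 p2) -> 0 < t ->
  (forall q1 q2, S (pt ord0 q1 q2) -> (q1 = p1 /\ q2 = p2) \/
     t ^+ 2 <= (q1 - p1) ^+ 2 + (q2 - p2) ^+ 2) -> S = [set pt ord0 p1 p2].
Proof.
move=> cS Sp t0 HS; apply/esym; apply: cS; first by exists (pt ord0 p1 p2).
- exists (interior [set x : 'rV[R]_2 | nrm (x ord0 ord0 - p1) (x ord0 (rev_ord ord0) - p2) < t]).
    exact: open_interior.
  apply/seteqP; split=> [_ ->|x [Sx /interior_subset/= xt]].
    split=> //; apply/near_ptP; exists (t / 2); first by rewrite divr_gt0.
    move=> x y xp yp; rewrite /= pt1 pt2 (le_lt_trans (nrm_le_sum _ _))//; lra.
  rewrite [x](ptE ord0) in Sx *; have [[-> ->]//|] := HS _ _ Sx.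
  move: xt; rewrite -sqr_nrm => xt; rewrite ler_sqr ?nnegrE ?nrm_ge0 ?(ltW t0)//.
  by rewrite leNgt xt.
- exists [set pt ord0 p1 p2].
    apply: accessible_closed_set1; apply: hausdorff_accessible.
    exact: norm_hausdorff.
  by rewrite setIC; apply/esym/setIidPl => _ ->.
Qed.

End Chart.

Theorem mainTheorem3 (R : realType) (S : set 'rV[R]_2) (c : regularity R)
  (S_neq0 : S !=set0) (S_closed : closed S) (S_connected : connected S)
  (S_int0 : interior S = set0) (c_adm : admissible c)
  (d_reg : exists2 r : R, 0 < r &
     of_class c [set x : 'rV[R]_2 | 0 < dist S x < r] (dist S)) :
  (exists p : 'rV[R]_2, S = [set p]) \/ submanifold c 1 S.
Proof.
have [r r0 Kd] := d_reg.
have tube i := dist_set_tube S_neq0 S_closed i S_int0 r0 (class_C2 c_adm Kd).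
pose P i s a b := partials s (dist S) (pt i a b).
pose L i := lap (P i [:: i; i]) (P i [:: rev_ord i; rev_ord i]).
have [[a [b [Dr E]]]|nirr] := pselect (exists a b,
    0 < P ord0 [::] a b < r /\ P ord0 [::] a b * L ord0 a b = 1).
  left; have [Sp _ _] := normal_foot (tube ord0) Dr.
  eexists; apply: (connected_isolated_point S_connected Sp (proj1 (andP Dr))).
  by move=> q1 q2 Sq; have := irregular_isolated (tube ord0) Dr E Sq.
(* Exchanging the axes merely swaps the two terms of the Laplacian, so regularity holds for both
   choices of the first axis. *)
right; have reg i a b : 0 < P i [::] a b < r -> P i [::] a b * L i a b != 1.
  move=> Dr; apply/eqP => E; apply: nirr.
  have [i0|i0] := ord2P ord0 i; first by exists a, b; rewrite -i0.
  have K := @rev_ordK 2 ord0.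
  exists b, a; move: Dr E; rewrite /L /lap /P i0 pt_rev.
  rewrite K.
  have sw (u v w : R) : u * (v + w) = 1 -> u * (w + v) = 1 by rewrite addrC.
  by move=> Dr /sw E; split.
move=> p Sp.
(* The axis [i] is chosen not parallel to the normal, so that [S] is a graph over it near [p]. *)
suff [i [n1 [n2 [nn n20]]]] : exists i n1 n2,
    normal (fun a b => S (pt i a b)) (P i [::]) r (p ord0 i) (p ord0 (rev_ord i)) n1 n2 /\ n2 != 0.
  have [x1 [x2 [d [e [d0 e0 [G1 Y1] HJ HS]]]]] := regular_graph (tube i) (reg i) nn n20.
  pose G x := x - P i [::] x x2 * P i [:: i] x x2.
  pose G' x := P i [:: rev_ord i] x x2 ^+ 2 * (1 - P i [::] x x2 * L i x x2).
  have dG x : `|x - x1| < d -> is_derive x (1 : R) G (G' x) /\ 0 < G' x.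
    move=> /HJ[Dr d20 _ _]; split; first exact: (is_derive_foot_fst (tube i) Dr).
    exact: (regular_slope_gt0 (tube i) (reg i) Dr d20).
  have [I [T [oI IG HT]]] := inverse_line d0 dG.
  pose Y x := x2 - P i [::] x x2 * P i [:: rev_ord i] x x2.
  have Kg : line_class c I (fun u => Y (T u)).
    apply: (@graph_line_class R c _ _ i x2 I (fun x => `|x - x1| < d) T c_adm Kd) => //.
      move=> x xd; exists (d - `|x - x1|); first by rewrite subr_gt0.
      move=> y yx; rewrite (_ : y - x1 = (y - x) + (x - x1)); last by rewrite addrA subrK.
      by apply: le_lt_trans (ler_normD _ _) _; rewrite -ltrBrDr.
    move=> x xd; have [Dr d20 _ _] := HJ x xd; have [dGx G0] := dG x xd.
    (* The velocity of the ordinate of the foot is written as the slope times [G'], a factor which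
       cancels against the derivative of [T]. *)
    have sl (u v w l : R) : v != 0 ->
        - (u * v * (1 - w * l)) = - (u / v) * (v ^+ 2 * (1 - w * l)) by move=> v0; field.
    split.
    - exact: Dr.
    - exact: d20.
    - exact: lt0r_neq0 G0.
    - exact: dGx.
    have := is_derive_foot_snd (tube i) Dr.
    rewrite (sl _ _ _ _ d20).
    exact.
  have Ip : I (p ord0 i) by rewrite -G1; exact: IG.
  apply: (graph_chart c_adm oI Kg Ip e0).
  move=> x Ix xe; have [Td GT _ _] := HT _ Ix; have [_ _ STx _] := HJ _ Td.
  rewrite -/(G (T (x ord0 i))) GT in STx.
  split=> [Sx|E]; last by rewrite (ptE i x) E.
  by apply: (HS _ _ Td xe); rewrite -/(G (T (x ord0 i))) GT -ptE.
rewrite (ptE ord0 p) in Sp; have [n1 [n2 nn]] := normal_exists (tube ord0) Sp.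
have [n20|n20] := eqVneq n2 0; last by exists ord0, n1, n2.
exists (rev_ord ord0), n2, n1; case: nn => _ nE nP; rewrite rev_ordK; split; last first.
  apply/eqP => n10; move/eqP: nE; rewrite n10 n20 expr0n/= addr0.
  by rewrite eq_sym oner_eq0.
split; [by rewrite pt_rev|by rewrite addrC|].
by move=> s sr; rewrite /P /= pt_rev; exact: nP.
Qed.
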